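(* Let $e=\min\{i\ge 2 : \ell \mid \frac{q^i-1}{q-1}\}$ and $d=\nu_\ell\big(\frac{q^e-1}{q-1}\big)$. If $d=1$, then the series $L=L(0)\supseteq L(1)\supseteq L(2)\supseteq\cdots$ (all repetitions removed) is the radical series of $L$.
   Context: Let $n\ge 2$ and $G=\mathrm{GL}_n(q)$, the general linear group over the finite field $F_q$ of characteristic $p$. Let $\ell\ne p$ be a prime, and let $R$ be a local principal ideal domain of characteristic $0$ with maximal ideal $\ell R$, containing a primitive $p$-th root of unity; $K=R/\ell R$. Modules are left modules. $\nu_\ell$ denotes the $\ell$-adic valuation of integers. $B$ is the group of upper triangular matrices in $G$; $S_n$ is viewed as the subgroup of permutation matrices of $G$; $\widehat{S}=\sum_{s\in S}s\in RG$ for $S\subseteq G$. Put $\varepsilon=\sum_{\sigma\in S_n}\mathrm{sg}(\sigma)\,\sigma\widehat{B}\in RG$. The Steinberg lattice is the left ideal $I=RG\cdot\varepsilon$, and $L=I/\ell I$, a $KG$-module. Let $f:I\times I\to R$ be the restriction to $I$ of the $R$-bilinear form on $RG$ given by $(g,h)\mapsto\delta_{g,h}$ for $g,h\in G$, scaled by $1/|B|$ (it takes values in $R$). For $c\ge 0$ put $I(c)=\{x\in I : f(x,I)\subseteq \ell^cR\}$ and $L(c)=(I(c)+\ell I)/\ell I$. The radical series of $L$ is $\mathrm{rad}^0(L)=L$, $\mathrm{rad}^{i+1}(L)=\mathrm{rad}(\mathrm{rad}^i(L))$. *)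

(* Defs.v *)
From HB Require Import structures.
From mathcomp Require Import all_boot all_order all_fingroup all_algebra.
From mathcomp Require Import generic_quotient ring_quotient fraction.
From mathcomp Require Import boolp classical_sets.

Set Implicit Arguments.
Unset Strict Implicit.
Unset Printing Implicit Defensive.

Import GRing.Theory.
Local Open Scope classical_set_scope.
Local Open Scope ring_scope.
Local Open Scope quotient_scope.

Definition submodule (A : pzRingType) (V : lmodType A) (S : set V) : Prop :=
  S 0 /\ forall (a : A) (u v : V), S u -> S v -> S (a *: u + v).

Definition maximal_submodule_of (A : pzRingType) (V : lmodType A)
    (N M : set V) : Prop :=
  [/\ submodule M, M `<` N &
    forall M' : set V,
      submodule M' -> M `<=` M' -> M' `<=` N -> M' = M \/ M' = N].

Definition radical (A : pzRingType) (V : lmodType A) (N : set V) : set V :=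
  N `&` \bigcap_(M in maximal_submodule_of N) M.

Definition radical_series (A : pzRingType) (V : lmodType A) (i : nat) : set V :=
  iter i (@radical A V) setT.

Arguments radical_series {A} V i.

(* Ideals of R are the submodules of the regular module R^o. *)

Definition principal_ideal (R : comPzRingType) (a : R) : set R^o :=
  [set r * a | r in setT].

Definition principal_ideal_domain (R : idomainType) : Prop :=
  forall J : set R^o, submodule J -> exists a : R, J = principal_ideal a.

Definition local_with_maximal_ideal (R : comPzRingType) (M : set R^o) : Prop :=
  forall J : set R^o, maximal_submodule_of setT J <-> J = M.

(* For a monotone series s, [remove_repetitions s] is the strictly monotone
   series of its distinct terms; if there are only finitely many of them, the
   last one is repeated forever. *)

Definition next_new (T : Type) (s : nat -> T) (c : nat) : nat :=
  if pselect (exists m : nat, (c < m)%N && `[< s m <> s c >]) is left h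
  then ex_minn h else c.

Definition remove_repetitions (T : Type) (s : nat -> T) (k : nat) : T :=
  s (iter k (next_new s) 0%N).

Section MultiplesOf.
Variables (V : zmodType) (l : nat).

Definition multiples : {pred V} := fun x => `[< exists y : V, x = y *+ l >].

Lemma multiplesP x : reflect (exists y : V, x = y *+ l) (x \in multiples).
Proof. exact: asboolP. Qed.

Lemma multiples_zmod_closed : zmod_closed multiples.
Proof.
split=> [|x y /multiplesP[x' ->] /multiplesP[y' ->]]; apply/multiplesP.
  by exists 0; rewrite mul0rn.
by exists (x' - y'); rewrite mulrnBl.
Qed.

HB.instance Definition _ :=
  GRing.isZmodClosed.Build V multiples multiples_zmod_closed.
End MultiplesOf.

Arguments multiples V l : clear implicits.

(* R / l R, a commutative ring which may a priori be trivial *)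
Section ResidueRing.
Variables (R : comPzRingType) (l : nat).

Definition residue : Type := Quotient.quot (multiples R l).

HB.instance Definition _ := GRing.Zmodule.on residue.
HB.instance Definition _ := EqQuotient.on residue.

Lemma residue_eqP (x y : R) :
  reflect (exists z, x - y = z *+ l) (x == y %[mod residue]).
Proof. by rewrite -Quotient.idealrBE; apply: multiplesP. Qed.

Lemma residue_piD : {morph \pi_residue : x y / x + y}.
Proof. by move=> x y; rewrite [LHS]Quotient.pi_add. Qed.

Lemma residue_pi0 : \pi_residue 0 = 0.
Proof. by apply: (addrI (\pi_residue 0)); rewrite -residue_piD !addr0. Qed.

Definition residue_one : residue := lift_cst residue 1.
Definition residue_mul : residue -> residue -> residue := lift_op2 residue *%R.

Lemma residue_pi1 : \pi_residue 1 = residue_one.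
Proof. by unlock residue_one. Qed.

Lemma residue_piM : {morph \pi_residue : x y / x * y >-> residue_mul x y}.
Proof.
move=> x y; unlock residue_mul; apply/eqP/residue_eqP.
have /eqP/residue_eqP[u hu] : \pi_residue (repr (\pi_residue x)) = \pi x.
  by rewrite reprK.
have /eqP/residue_eqP[v hv] : \pi_residue (repr (\pi_residue y)) = \pi y.
  by rewrite reprK.
exists (- (x * v) - u * repr (\pi_residue y)).
rewrite mulrnDl !mulNrn -mulrnAr -mulrnAl -hu -hv mulrBr mulrBl !opprB.
by rewrite addrA subrK.
Qed.

Fact residue_mulA : associative residue_mul.
Proof.
move=> x y z; rewrite -[x]reprK -[y]reprK -[z]reprK.
by rewrite -!residue_piM mulrA.
Qed.

Fact residue_mulC : commutative residue_mul.
Proof.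
by move=> x y; rewrite -[x]reprK -[y]reprK -!residue_piM mulrC.
Qed.

Fact residue_mul1 : left_id residue_one residue_mul.
Proof. by move=> x; rewrite -[x]reprK -residue_pi1 -residue_piM mul1r. Qed.

Fact residue_mulD : left_distributive residue_mul +%R.
Proof.
move=> x y z; rewrite -[x]reprK -[y]reprK -[z]reprK.
by rewrite -residue_piD -!residue_piM mulrDl residue_piD.
Qed.

HB.instance Definition _ := GRing.Zmodule_isComPzRing.Build residue
  residue_mulA residue_mulC residue_mul1 residue_mulD.

Lemma residue_pi_mul : {morph \pi_residue : x y / x * y}.
Proof. exact: residue_piM. Qed.
End ResidueRing.

Section GroupAlgebra.
Variables (R : pzRingType) (gT : finGroupType).

(* x : galg R gT stands for the formal sum of the x g . g. *)
Definition galg : Type := {ffun gT -> R}.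

HB.instance Definition _ := GRing.Zmodule.on galg.

Definition galg_of (g : gT) : galg := [ffun h => (h == g)%:R].

Definition galg_mul (x y : galg) : galg :=
  [ffun g => \sum_(h : gT) x h * y (h^-1 * g)%g].

Fact galg_mulA : associative galg_mul.
Proof.
move=> x y z; apply/ffunP=> g; rewrite !ffunE.
under eq_bigr => h _ do rewrite ffunE mulr_sumr.
under [RHS]eq_bigr => k _ do rewrite ffunE mulr_suml.
rewrite [RHS]exchange_big; apply: eq_bigr => h _ /=.
rewrite [RHS](reindex_inj (mulgI h)); apply: eq_bigr => k _ /=.
by rewrite mulrA mulKg invMg -mulgA.
Qed.

Fact galg_mul1 : left_id (galg_of 1) galg_mul.
Proof.
move=> x; apply/ffunP=> g; rewrite ffunE (bigD1 1%g) //= ffunE eqxx mul1r.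
rewrite invg1 mul1g big1 ?addr0 // => h /negPf h1.
by rewrite ffunE h1 mul0r.
Qed.

Fact galg_mulr1 : right_id (galg_of 1) galg_mul.
Proof.
move=> x; apply/ffunP=> g; rewrite ffunE (bigD1 g) //= ffunE mulVg eqxx mulr1.
rewrite big1 ?addr0 // => h hg; rewrite ffunE -eq_mulVg1.
by rewrite (negPf hg) mulr0.
Qed.

Fact galg_mulDl : left_distributive galg_mul +%R.
Proof.
move=> x y z; apply/ffunP=> g; rewrite !ffunE -big_split /=.
by apply: eq_bigr => h _; rewrite ffunE mulrDl.
Qed.

Fact galg_mulDr : right_distributive galg_mul +%R.
Proof.
move=> x y z; apply/ffunP=> g; rewrite !ffunE -big_split /=.
by apply: eq_bigr => h _; rewrite ffunE mulrDr.
Qed.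

HB.instance Definition _ := GRing.Zmodule_isPzRing.Build galg
  galg_mulA galg_mul1 galg_mulr1 galg_mulDl galg_mulDr.

Definition sum_set (S : {set gT}) : galg := \sum_(s in S) galg_of s.
End GroupAlgebra.

Arguments galg_of {R gT} g.
Arguments sum_set {R gT} S.

Section PrincipalLeftIdeal.
Variables (A : pzRingType) (e : A).

Definition in_left_ideal : {pred A^o} := fun x => `[< exists a : A, x = a * e >].

Lemma in_left_idealP (x : A^o) :
  reflect (exists a : A, x = a * e) (x \in in_left_ideal).
Proof. exact: asboolP. Qed.

Fact left_ideal_closed : submod_closed in_left_ideal.
Proof.
split=> [|a x y /in_left_idealP[b ->] /in_left_idealP[c ->]].
  by apply/in_left_idealP; exists 0; rewrite mul0r.
by apply/in_left_idealP; exists (a * b + c); rewrite mulrDl -mulrA.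
Qed.

HB.instance Definition _ :=
  GRing.isSubmodClosed.Build A A^o in_left_ideal left_ideal_closed.

Definition left_ideal : Type := {x : A^o | x \in in_left_ideal}.

HB.instance Definition _ := SubChoice.on left_ideal.
HB.instance Definition _ := [SubChoice_isSubLmodule of left_ideal by <:].
End PrincipalLeftIdeal.

(* V / l V as a module over (R / l R) gT, for a module V over R gT *)

Section Reduction.
Variables (R : comPzRingType) (gT : finGroupType) (V : lmodType (galg R gT)).
Variable l : nat.

Definition reduction : Type := Quotient.quot (multiples V l).

HB.instance Definition _ := GRing.Zmodule.on reduction.
HB.instance Definition _ := EqQuotient.on reduction.

Lemma reduction_eqP (x y : V) :
  reflect (exists z, x - y = z *+ l) (x == y %[mod reduction]).
Proof. by rewrite -Quotient.idealrBE; apply: multiplesP. Qed.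

Lemma reduction_piD : {morph \pi_reduction : x y / x + y}.
Proof. by move=> x y; rewrite [LHS]Quotient.pi_add. Qed.

Definition galg_lift (a : galg (residue R l) gT) : galg R gT :=
  [ffun g => repr (a g)].

Definition galg_red (a : galg R gT) : galg (residue R l) gT :=
  [ffun g => \pi_(residue R l) (a g)].

Definition reduction_scale (a : galg (residue R l) gT) :
    reduction -> reduction :=
  lift_op1 reduction ( *:%R (galg_lift a)).

Lemma galg_redK : cancel galg_lift galg_red.
Proof. by move=> a; apply/ffunP=> g; rewrite !ffunE reprK. Qed.

(* l (RG) acts on V with values in l V *)
Fact reduction_scale_pi (a : galg R gT) (x : V) :
  \pi_reduction (a *: x) = reduction_scale (galg_red a) (\pi x).
Proof.
unlock reduction_scale; apply/eqP/reduction_eqP.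
have /eqP/reduction_eqP[y xy] :
    \pi_reduction x = \pi_reduction (repr (\pi_reduction x)) by rewrite reprK.
have /choice[b ab] g : exists z, a g - galg_lift (galg_red a) g = z *+ l.
  by apply/residue_eqP; rewrite !ffunE reprK.
have {}ab : a - galg_lift (galg_red a) = (finfun b : galg R gT) *+ l.
  by apply/ffunP=> g; rewrite ffunMnE !ffunE -ab !ffunE.
exists (a *: y + (finfun b : galg R gT) *: repr (\pi_reduction x)).
rewrite mulrnDl scalerMnr scalerMnl -xy -ab scalerBr scalerBl.
by rewrite addrA subrK.
Qed.

Fact galg_redD : {morph galg_red : a b / a + b}.
Proof. by move=> a b; apply/ffunP=> g; rewrite !ffunE residue_piD. Qed.

Fact galg_red1 : galg_red 1 = 1.
Proof.
apply/ffunP=> g; rewrite !ffunE; case: (g == 1%g).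
  exact: residue_pi1.
exact: residue_pi0.
Qed.

Fact galg_redM : {morph galg_red : a b / a * b}.
Proof.
move=> a b; apply/ffunP=> g; rewrite !ffunE.
rewrite (big_morph _ (@residue_piD R l) (residue_pi0 R l)).
by apply: eq_bigr => h _; rewrite !ffunE residue_pi_mul.
Qed.

Fact reduction_scaleA (a b : galg (residue R l) gT) (x : reduction) :
  reduction_scale a (reduction_scale b x) = reduction_scale (a * b) x.
Proof.
rewrite -[a]galg_redK -[b]galg_redK -[x]reprK.
by rewrite -galg_redM -!reduction_scale_pi scalerA.
Qed.

Fact reduction_scale1 : left_id 1 reduction_scale.
Proof.
by move=> x; rewrite -[x]reprK -galg_red1 -reduction_scale_pi scale1r.
Qed.

Fact reduction_scaleDr : right_distributive reduction_scale +%R.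
Proof.
move=> a x y; rewrite -[a]galg_redK -[x]reprK -[y]reprK.
by rewrite -reduction_piD -!reduction_scale_pi scalerDr reduction_piD.
Qed.

Fact reduction_scaleDl (x : reduction) :
  {morph reduction_scale^~ x : a b / a + b}.
Proof.
move=> a b; rewrite -[a]galg_redK -[b]galg_redK -[x]reprK.
by rewrite -galg_redD -!reduction_scale_pi scalerDl reduction_piD.
Qed.

HB.instance Definition _ := GRing.Zmodule_isLmodule.Build
  (galg (residue R l) gT) reduction
  reduction_scaleA reduction_scale1 reduction_scaleDr reduction_scaleDl.
End Reduction.

Section Steinberg.
Variables (F : finFieldType) (n : nat) (R : idomainType) (l : nat).
Local Notation G := {'GL_n[F]}.
Local Notation "x %:F" := (@FracField.tofrac R x).

(* The matrices in {'GL_n[F]} have size n.-1.+1, which is n for n > 0;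
   is_trig_mx means lower triangular, hence the transpose. *)
Definition borel : {set G} := [set g : G | is_trig_mx (GLval g)^T]%SET.

Definition perm_GL (s : 'S_n.-1.+1) : G := FinRing.unit _ (unitmx_perm F s).

(* In galg R G, (-1) ^+ s is the sign of s times the unit of RG. *)
Definition steinberg_elt : galg R G :=
  \sum_(s : 'S_n.-1.+1) (-1) ^+ s * galg_of (perm_GL s) * sum_set borel.

Definition steinberg_lattice : Type := left_ideal steinberg_elt.

HB.instance Definition _ := GRing.Lmodule.on steinberg_lattice.

(* |B| need not be invertible in R, hence the values in the fraction field *)
Definition steinberg_form (x y : steinberg_lattice) : {fraction R} :=
  (\sum_(g : G) (val x : galg R G) g * (val y : galg R G) g)%:F / #|borel|%:R.

Definition lattice_filtration (c : nat) : set steinberg_lattice :=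
  [set x | forall y, exists r : R, steinberg_form x y = (l%:R ^+ c * r)%:F].

Definition steinberg_mod : Type := reduction steinberg_lattice l.

HB.instance Definition _ := GRing.Lmodule.on steinberg_mod.

Definition mod_filtration (c : nat) : set steinberg_mod :=
  \pi_steinberg_mod @`
    [set x + y *+ l | x in lattice_filtration c & y in setT].
End Steinberg.

(* Main.v *)
Require Import Defs.
From HB Require Import structures.
From mathcomp Require Import all_boot all_order all_fingroup all_algebra.
From mathcomp Require Import generic_quotient ring_quotient fraction.
From mathcomp Require Import vector finfield.
From mathcomp Require Import boolp classical_sets.
From mathcomp Require Import zify.

(** The Steinberg lattice has a supply of vectors on which the form is
explicit, and these vectors detect all submodules of L.

Let U be the group of upper unitriangular matrices, A = RG, eps the generator
of I, and psi a nontrivial character of the additive group of F with values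
in R.  A function c on {1, ..., n - 1} gives the linear character
u |-> psi (sum_j c j * u_(j-1, j)) of U, and the sum E c of all
psi (- chi c u) u acts, up to the unit |U|, as the projection onto the
corresponding eigenspace.  Since I is spanned over R by the elements u * eps
with u in U ([eps_span]), this eigenspace is a line, spanned by the Whittaker
vector E c * eps ([whit_line]).

Write b_m for the image in L of the Whittaker vector of the composition m of
n, where c is the indicator of those j that lie in the same part as j - 1.  Four facts about
the b_m are needed.

(a) The value f (E c * eps, eps) is the sum of q ^ noninv s over the
permutations s which decrease on every part of m ([form_st_eps]); times the
q-factorials of the parts it is the q-factorial of n ([decreasing_sum_fact]).
Because d = 1, the l-adic valuation of the q-factorial of k is
g k = sum_j floor (k / (e l^j)) ([logn_qfact]).  Hence the valuation v m of
this value is g n minus the sum of g over the parts of m, and b_m lies in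
L(k) if and only if k <= v m ([mod_filt_whit]).

(b) If two submodules N and M of L satisfy b_m \in N -> b_m \in M for all m,
then N is contained in M ([whit_vec_separates]).  From a vector of N outside M
a Whittaker vector is reached by treating the columns of U one by one, from
the right: a nontrivial character of one column group is moved to the last
coordinate by an element of GL_k in the upper left corner.

(c) If v m = v m' and b_m lies in the submodule generated by b_m', then b_m'
lies in the submodule generated by b_m ([whit_vec_symmetry]), since the form
has an adjoint and the Whittaker lines are dual to one another.

(d) If v m > 0, then b_m lies in the submodule generated by some b_m' with
v m' = v m - 1 ([whit_vec_climb]).  Indeed b_m lies in the submodule generated
by b_m' whenever m' arises from m by adding up two adjacent parts
([merge_blocks]), and by (c) this step can be reversed if it does not change
v.  Addition of parts lowers v by the number of carries; splitting both parts
at the position of the first carry isolates two summands whose addition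
carries exactly once ([climb]).

These facts give rad L(k) = L(k + 1) ([radical_Fil]).  For b_m in L(k) but
not in L(k + 1), so v m = k, the x in L(k) with b_m \notin A x form a maximal
submodule of L(k) without b_m: it is closed under addition because a Whittaker
vector in a sum of two submodules lies in one of them, and maximal by (c).
Hence every Whittaker vector of rad L(k) lies in L(k + 1).  Conversely, if b_m
in L(k + 1) were outside a maximal submodule M of L(k), then
M + L(k + 1) = L(k) would contain the vector of valuation k above b_m
given by (d), and so would M or L(k + 1); neither is possible.  The filtration
therefore decreases strictly until it vanishes, and it is the radical
series. *)

Set Implicit Arguments.
Unset Strict Implicit.
Unset Printing Implicit Defensive.

Import GRing.Theory.

(** * Valuations of q-factorials and carries *)

(** The q-integer (q^i - 1) / (q - 1), in a form without division. *)
Definition qint (q i : nat) : nat := \sum_(k < i) q ^ k.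
Definition qfact (q n : nat) : nat := \prod_(i < n) qint q i.+1.

Lemma qintE q i : 1 < q -> (q ^ i - 1) %/ (q - 1) = qint q i.
Proof. by move=> q1; rewrite !subn1 predn_exp mulKn //; lia. Qed.

Lemma qint_gt0 q i : 0 < i -> 0 < qint q i.
Proof. by case: i => // i _; rewrite /qint big_ord_recl expn0. Qed.

Lemma qintS q i : qint q i.+1 = qint q i + q ^ i.
Proof. exact: big_ord_recr. Qed.

Lemma qintD q a b : qint q (a + b) = qint q a + q ^ a * qint q b.
Proof.
rewrite /qint big_split_ord /=; congr addn.
by rewrite big_distrr /=; apply: eq_bigr => i _; rewrite expnD.
Qed.

Lemma qintM q a b : qint q (a * b) = qint q a * qint (q ^ a) b.
Proof.
elim: b => [|b IHb]; first by rewrite muln0 /qint !big_ord0 muln0.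
by rewrite mulnS addnC qintD IHb qintS mulnDr -expnM; congr addn; apply: mulnC.
Qed.

Section Carries.
Variables (l e n : nat).
Hypotheses (l_prime : prime l) (e_ge2 : 2 <= e).

Definition carry_weight (j : nat) : nat := e * l ^ j.
Local Notation w := carry_weight.

(** As e * l^j > j, weights beyond the n-th exceed n, so a sum over j < n is
long enough to see every carry in additions with result at most n. *)
Lemma carry_weight_gt j : j < w j.
Proof.
have := ltn_expl j (prime_gt1 l_prime); rewrite /w => h.
by apply: (leq_trans h); rewrite leq_pmull //; lia.
Qed.

Lemma carry_weight_dvd i j : i <= j -> w i %| w j.
Proof. by move=> ij; rewrite dvdn_mul // dvdn_exp2l. Qed.

Lemma carry_weight_gt0 j : 0 < w j.
Proof. by apply: leq_ltn_trans (carry_weight_gt j). Qed.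

(** In the mixed radix system with place values 1, e, e l, e l^2, ..., the
defect g (a + b) - g a - g b is the number of carries in the addition of a
and b. *)
Definition carry_sum (m : nat) : nat := \sum_(j < n) m %/ w j.
Local Notation g := carry_sum.

Lemma carry_sumD a b : g a + g b <= g (a + b).
Proof.
by rewrite /g -big_split leq_sum //= => j _; rewrite divnD ?carry_weight_gt0 // leq_addr.
Qed.

(** A multiple of w j and a number below w j have disjoint digits, so their
addition carries nowhere. *)
Lemma carry_sum_split j A r : j < n -> w j %| A -> r < w j -> g (A + r) = g A + g r.
Proof.
move=> jn jA rj; rewrite /g -big_split; apply: eq_bigr => i _ /=.
rewrite divnD ?carry_weight_gt0 //; case: leqP => h; last by rewrite addn0.
exfalso; case/orP: (leq_total i j) => ij.
  have /eqP Ai : w i %| A by rewrite (dvdn_trans _ jA) ?carry_weight_dvd.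
  by move: h; rewrite Ai add0n leqNgt ltn_mod carry_weight_gt0.
have wij := carry_weight_dvd ij.
have rm : r %% w i = r.
  by rewrite modn_small // (leq_trans rj) // dvdn_leq ?carry_weight_gt0.
have : w j %| A %% w i.
  by rewrite -(dvdn_addr _ (dvdn_mull (A %/ w i) wij)) -divn_eq.
have : A %% w i < w i by rewrite ltn_mod carry_weight_gt0.
move: h; rewrite rm; case/dvdnP: wij => y -> h1 h2 /dvdnP[z zE].
rewrite zE ltn_pmul2r ?carry_weight_gt0 // in h1 h2.
have : z.+1 * w j <= y * w j by rewrite leq_mul2r h2 orbT.
by rewrite mulSn; lia.
Qed.

(** Cut both numbers at the place of the lowest carry.  Below that place
nothing carries, so the remainders r and s add up with this single carry; the
cuts themselves do not carry. *)
Lemma first_carry a b : a + b <= n -> g a + g b < g (a + b) ->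
  exists A r s B, [/\ a = A + r, b = s + B, g a = g A + g r, g b = g s + g B
    & g (r + s) = (g r + g s).+1 /\ (0 < r /\ 0 < s)].
Proof.
move=> abn lt.
(* P j: the addition of a and b carries into the place j. *)
pose P j := (j < n) && (w j <= a %% w j + b %% w j).
have exP : exists j, P j.
  case: (pickP (fun j : 'I_n => w j <= a %% w j + b %% w j)) => [j hj|none].
    by exists j; rewrite /P ltn_ord.
  move: lt; rewrite /g -big_split /=.
  under [X in _ < X]eq_bigr => j _ do rewrite divnD ?carry_weight_gt0 // none addn0.
  by rewrite ltnn.
case: (ex_minnP exP) => j /andP[jn wj] jmin.
have ra : a %% w j < w j by rewrite ltn_mod carry_weight_gt0.
have rb : b %% w j < w j by rewrite ltn_mod carry_weight_gt0.
exists (a %/ w j * w j), (a %% w j), (b %% w j), (b %/ w j * w j).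
split; last (split; last by split; lia).
- exact: divn_eq.
- by rewrite addnC; apply: divn_eq.
- by rewrite {1}(divn_eq a (w j)) (carry_sum_split jn (dvdn_mull _ (dvdnn _))) //.
- by rewrite {1}(divn_eq b (w j)) (carry_sum_split jn (dvdn_mull _ (dvdnn _))) // addnC.
rewrite -addn1 /g -big_split /=.
rewrite [LHS](bigD1 (Ordinal jn)) //= [X in _ = X + _](bigD1 (Ordinal jn)) //=.
rewrite divnD ?carry_weight_gt0 // !modn_mod wj addnAC; congr (_ + _ + _).
apply: eq_bigr => i ij; rewrite divnD ?carry_weight_gt0 //; case: leqP => h; last by rewrite addn0.
have {ij} : i < j \/ j < i by move: ij; rewrite -val_eqE /= neq_ltn => /orP.
case=> ij; exfalso.
  have wij := carry_weight_dvd (ltnW ij).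
  rewrite !modn_dvdm // in h.
  by have := jmin i; rewrite /P ltn_ord h => /(_ isT); lia.
(* Both remainders are below w j, so their sum is too small to carry at i. *)
have wij : w j * 2 <= w i.
  apply: (@leq_trans (w j.+1)); first by rewrite /w expnS; have := prime_gt1 l_prime; nia.
  by rewrite dvdn_leq ?carry_weight_gt0 // carry_weight_dvd.
by move: h; rewrite !(@modn_small _ (w i)); lia.
Qed.

(** The valuation of a product of q-factorials over the parts. *)
Definition parts_sum (m : seq nat) : nat := sumn [seq g a | a <- m].

Lemma parts_sum_cons a m : parts_sum (a :: m) = g a + parts_sum m.
Proof. by []. Qed.

(** [le] abstracts the relation that the Whittaker vector of one composition
lies in the submodule generated by that of another. Merging goes up; splitting
goes up as well when it creates no carry. *)
Section Climb.
Variable le : seq nat -> seq nat -> Prop.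
Hypotheses (le_refl : forall m, le m m)
  (le_trans : forall m1 m2 m3, sumn m1 = sumn m2 -> sumn m2 = sumn m3 -> le m1 m2 -> le m2 m3 ->
    le m1 m3)
  (le_cons : forall a m1 m2, sumn m1 = sumn m2 -> le m1 m2 -> le (a :: m1) (a :: m2))
  (le_merge : forall a b m, le (a :: b :: m) (a + b :: m))
  (le_split : forall a b m, g (a + b) = g a + g b -> le (a + b :: m) (a :: b :: m)).

Lemma parts_sum_le m : parts_sum m <= g (sumn m).
Proof.
elim: m => [|a m IHm] //=; apply: leq_trans (carry_sumD _ _).
by rewrite /parts_sum /= leq_add2l.
Qed.

(** A composition whose parts add up without carries is equivalent to its
one-part composition. *)
Lemma collapse a m :
  le (a :: m) [:: sumn (a :: m)] /\
  (parts_sum (a :: m) = g (sumn (a :: m)) -> le [:: sumn (a :: m)] (a :: m)).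
Proof.
elim: m a => [|b m IHm] a /=; first by rewrite addn0; split.
have [le1' le2] := IHm b; split=> [|h].
  apply: (le_trans (m2 := [:: a; b + sumn m])) => /=; rewrite ?addn0 //.
    by apply: le_cons => /=; rewrite ?addn0.
have h1 := parts_sum_le (b :: m); have h2 := carry_sumD a (b + sumn m).
move: h h1 h2; rewrite /parts_sum /= => h h1 h2.
apply: (le_trans (m2 := [:: a; b + sumn m])) => /=; rewrite ?addn0 //.
  by apply: le_split; lia.
by apply: le_cons; [rewrite /= addn0 | apply: le2; rewrite /parts_sum /=; lia].
Qed.

(** Take the shortest suffix a :: m of which the parts do not add up without
carries.  Then m may be replaced by its sum, and two parts remain. *)
Lemma climb m : sumn m <= n -> parts_sum m < g (sumn m) ->
  exists m', [/\ sumn m' = sumn m, le m m' & parts_sum m' = (parts_sum m).+1].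
Proof.
elim: m => [|a m IHm] /= mn; first by rewrite ltn0 || (rewrite /g big1 // => j _; rewrite div0n).
have [lt|ge] := ltnP (parts_sum m) (g (sumn m)).
  have [|m' [s1 l1 p1]] := IHm _ lt; first by lia.
  move=> _; exists (a :: m'); split; rewrite /= ?s1 //; first by apply: le_cons.
  by rewrite /parts_sum /= -/(parts_sum _) p1 addnS.
have pm : parts_sum m = g (sumn m) by apply/eqP; rewrite eqn_leq ge parts_sum_le.
case: m pm {IHm ge} mn => [|b m] pm mn.
  by rewrite /parts_sum /= !addn0 ltnn.
have [C1 C2] := collapse b m; rewrite parts_sum_cons pm.
have {}C2 := C2 pm; move: (b :: m) mn pm C1 C2 => r mn pm C1 C2 lt.
have [A [x [y [B [ea eb ga gb [gxy _]]]]]] := first_carry mn lt.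
(* Split a = A + x and the sum y + B of the rest, then merge x and y. *)
exists [:: A; x + y; B]; split; rewrite ?ea ?eb /=; first by lia.
  apply: (le_trans (m2 := [:: A + x; y + B])); rewrite /= ?eb; try lia.
    by rewrite -eb; apply: le_cons => //=; rewrite addn0.
  apply: (le_trans (m2 := [:: A, x & [:: y + B]])) => /=; try lia.
    by apply: le_split; rewrite -ea.
  apply: (le_trans (m2 := [:: A; x; y; B])) => /=; try lia.
    do 2 (apply: le_cons => /=; first by lia).
    by apply: le_split; rewrite -eb.
  by apply: le_cons => /=; [lia | apply: le_merge].
by rewrite !parts_sum_cons -ea ga -eb gb gxy [parts_sum [::]]/parts_sum /=; lia.
Qed.
End Climb.
End Carries.

Section Valuation.
Variables (l : nat).
Hypothesis l_prime : prime l.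

Lemma qint_modn Q m k : Q = 1 %[mod m] -> qint Q k = k %[mod m].
Proof.
move=> Q1; elim: k => [|k IHk]; first by rewrite /qint big_ord0.
by rewrite qintS -modnDm IHk -[Q ^ k %% m]modnXm Q1 modnXm exp1n modnDm addn1.
Qed.

(** Lifting the exponent, base case: writing Q = x l + 1, the sum of the
Q^k is l plus x l binomial(l, 2) modulo l^2, and l divides the binomial
coefficient unless l = 2. *)
Lemma logn_qint_prime Q : Q = 1 %[mod l] -> (l = 2 -> Q = 1 %[mod 4]) ->
  logn l (qint Q l) = 1.
Proof.
move=> Q1 Q4; have l1 := prime_gt1 l_prime; have l0 := prime_gt0 l_prime.
have g0 : 0 < qint Q l by apply: qint_gt0.
have dvdl : l %| qint Q l by rewrite /dvdn (qint_modn _ Q1) modnn.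
suff ndvd : ~~ (l ^ 2 %| qint Q l).
  apply/eqP; rewrite eqn_leq; apply/andP; split.
    by rewrite leqNgt -pfactor_dvdn.
  by rewrite -pfactor_dvdn.
have [l2|/eqP l2] := l =P 2.
  have -> : l ^ 2 = 4 by rewrite l2.
  by rewrite /dvdn (qint_modn l (Q4 l2)) l2.
pose x := Q %/ l; have Qx : Q = x * l + 1.
  by rewrite {1}(divn_eq Q l) Q1 modn_small.
have Qk k : Q ^ k = k * x * l + 1 %[mod l ^ 2].
  elim: k => [|k IHk] //; rewrite expnS -modnMm IHk modnMm Qx.
  have -> : (x * l + 1) * (k * x * l + 1) = (k * x * x) * l ^ 2 + (k.+1 * x * l + 1).
    by rewrite expnS expn1; nia.
  by rewrite modnMDl.
have qk k : qint Q k = 'C(k, 2) * x * l + k %[mod l ^ 2].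
  elim: k => [|k IHk]; first by rewrite /qint big_ord0.
  rewrite qintS -modnDm IHk Qk modnDm binS bin1; congr (_ %% _).
  by move: 'C(k, 2) => c; nia.
have [y Cy] : exists y, 'C(l, 2) = y * l.
  have: l %| 'C(l, 2) by apply: prime_dvd_bin => //; lia.
  by case/dvdnP=> y ->; exists y.
rewrite /dvdn qk Cy.
have -> : y * l * x * l + l = (y * x) * l ^ 2 + l by nia.
by rewrite modnMDl modn_small; [lia | nia].
Qed.

Lemma logn_qint1 Q k : Q = 1 %[mod l] -> (l = 2 -> Q = 1 %[mod 4]) ->
  logn l (qint Q k) = logn l k.
Proof.
move=> + + ; have [n] := ubnP k; elim: n => // n IHn in k Q * => kn Q1 Q4.
case: (posnP k) => [->|k0]; first by rewrite /qint big_ord0.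
have [/dvdnP[k' Ek]|ndvd] := boolP (l %| k); last first.
  rewrite !logn_coprime // prime_coprime // /dvdn ?(qint_modn _ Q1) //.
have k'0 : 0 < k' by case: k' Ek k0 => // ->.
have l1 := prime_gt1 l_prime.
have Ql m : Q = 1 %[mod m] -> Q ^ l = 1 %[mod m].
  by move=> h; rewrite -modnXm h modnXm exp1n.
rewrite Ek [_ * l]mulnC qintM !lognM ?qint_gt0 //; try lia.
rewrite logn_qint_prime // (logn_prime l l_prime) eqxx IHn //.
- by rewrite Ek in kn; nia.
- exact: Ql.
- by move=> /Q4/Ql.
Qed.

Variables (q e : nat).
Hypotheses (q_gt1 : 1 < q) (e_ge2 : 2 <= e) (l_dvd : l %| qint q e)
  (e_min : forall i, 2 <= i -> l %| qint q i -> e <= i)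
  (logn_qe : logn l (qint q e) = 1).

Local Notation w := (carry_weight l e).

Lemma qe_mod : q ^ e = 1 %[mod l].
Proof.
have : l %| q ^ e - 1 by rewrite subn1 predn_exp dvdn_mull.
by rewrite -eqn_mod_dvd ?expn_gt0 ?(ltnW q_gt1) // => /eqP.
Qed.

(** The minimality of e extends to all divisible indices because,
modulo l, the q-integers of i and of i mod e differ by a unit factor. *)
Lemma dvd_qint i : l %| qint q i -> e %| i.
Proof.
move=> li; rewrite (divn_eq i e) mulnC in li.
have eq_lt : i %% e < e by rewrite ltn_mod; lia.
have {}li : l %| qint q (i %% e).
  move: li; rewrite qintD qintM dvdn_addr; last by rewrite dvdn_mulr.
  rewrite Gauss_dvdr // expnM; apply: coprimeXr.
  rewrite /coprime -gcdn_modr qe_mod gcdn_modr gcdn1 //.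
case: (i %% e =P 0) => [/eqP //|/eqP h0].
case: (i %% e =P 1) => [h1|/eqP h1].
  by move: li; rewrite h1 /qint big_ord_recl big_ord0 expn0 dvdn1 => /eqP h; move: l_prime;
    rewrite h.
by have := e_min _ li; lia.
Qed.

(** For l = 2 the hypotheses force e = 2, and q is odd, so q ^ e is
an odd square. *)
Lemma l2_mod4 : l = 2 -> q ^ e = 1 %[mod 4].
Proof.
move=> l2.
have q_odd : odd q.
  have := qe_mod; rewrite l2 !modn2 oddX /=; case: (odd q) => //.
  by rewrite orbF; case: eqP => //; lia.
have e2 : e = 2.
  have : e <= 2 by apply: e_min => //; rewrite l2 /qint !big_ord_recr big_ord0 /= expn0 expn1
    add0n dvdn2 oddD q_odd.
  by lia.
rewrite e2 -modnXm.
have : q %% 4 = 1 \/ q %% 4 = 3 by lia.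
by case=> ->.
Qed.

(** With i = e k, the q-integer of i is that of e times the q^e-integer of k,
and lifting the exponent turns the valuation of the latter into that of k. *)
Lemma logn_qint i n : 0 < i <= n -> logn l (qint q i) = \sum_(j < n) (w j %| i).
Proof.
move=> /andP[i0 i_n]; have l1 := prime_gt1 l_prime.
have [/dvdnP[k Ek]|ne] := boolP (e %| i); last first.
  rewrite (@big1 _ _ _ _ _ _ (fun j : 'I_n => (w j %| i) : nat)) => [|j _].
    by rewrite logn_coprime // prime_coprime //; apply: contra ne => /dvd_qint.
  apply/eqP; rewrite eqb0; apply: contra ne; apply: dvdn_trans.
  exact: dvdn_mulr.
have k0 : 0 < k by case: k Ek i0 => // ->.
have kn : k <= n by apply: leq_trans i_n; rewrite Ek leq_pmulr //; lia.
rewrite Ek mulnC qintM lognM ?qint_gt0 //; last by lia.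
rewrite logn_qe logn_qint1 //; [|exact: qe_mod|exact: l2_mod4].
have -> : \sum_(j < n) (w j %| e * k) = \sum_(j < n) (l ^ j %| k).
  by apply: eq_bigr => j _; rewrite dvdn_pmul2l //; lia.
rewrite logn_count_dvd // -(big_mkord predT (fun j => (l ^ j %| k) : nat)).
rewrite [RHS](big_cat_nat (n := k)) //=.
rewrite [X in _ = _ + X]big_nat_cond [X in _ = _ + X]big1 => [|j]; last first.
  rewrite andbT => /andP[kj _]; apply/eqP; rewrite eqb0; apply/negP => /dvdn_leq.
  by move=> /(_ k0); have := ltn_expl j l1; lia.
by rewrite addn0 [RHS]big_ltn // expn0 dvd1n.
Qed.

Variable n : nat.
Local Notation g := (carry_sum l e n).

Lemma logn_qfact m : m <= n -> logn l (qfact q m) = g m.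
Proof.
elim: m => [|m IHm] mn; first by rewrite /qfact big_ord0 /g big1 ?logn1 // => j _; rewrite div0n.
rewrite /qfact big_ord_recr /= lognM ?qint_gt0 //; last first.
  by apply: prodn_gt0 => i; apply: qint_gt0.
rewrite IHm ?(ltnW mn) // (@logn_qint _ n) // -big_split /=.
by apply: eq_bigr => j _; rewrite divnS ?carry_weight_gt0 // addnC.
Qed.

End Valuation.

(** * Permutations that decrease on the blocks of a composition *)

(** The complement of the inversion number: q ^ noninv s is the order of the
group of those unitriangular matrices which s conjugates into B. *)
Definition noninv n (s : 'S_n) : nat := \sum_(i < n) \sum_(j < n) ((i < j) && (s i < s j)).

Definition block_decreasing n (b : nat -> nat) (s : 'S_n) : bool :=
  [forall i : 'I_n, forall j : 'I_n, (i < j) && (b i == b j) ==> (s j < s i)].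

Definition decreasing_sum q n (b : nat -> nat) : nat :=
  \sum_(s : 'S_n | block_decreasing b s) q ^ noninv s.

(** The product of the q-integers of the tail sizes is the product of the
q-factorials of the block sizes, in a form that survives the removal of the
first element of a block. *)
Definition tail_size n (b : nat -> nat) (i : nat) : nat :=
  \sum_(j < n) ((i <= j) && (b i == b j)).

Definition block_fact q n b : nat := \prod_(i < n) qint q (tail_size n b i).

Lemma big_lift_perm n (p : 'I_n.+1) (P : pred 'S_n.+1) (f : 'S_n.+1 -> nat) :
  \sum_(s : 'S_n.+1 | P s && (s p == ord_max)) f s =
  \sum_(s : 'S_n | P (lift_perm p ord_max s)) f (lift_perm p ord_max s).
Proof.
rewrite (reindex (lift_perm p ord_max)); last first.
  (* As for the expansion of a determinant along a row: remove p from s. *)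
  pose ulsf i (s : 'S_n.+1) k := odflt k (unlift (s i) (s (lift i k))).
  have ulsfK i (s : 'S_n.+1) k: lift (s i) (ulsf i s k) = s (lift i k).
    rewrite /ulsf; have:= neq_lift i k.
    by rewrite -(can_eq (permK s)) => /unlift_some[] ? ? ->.
  have inj_ulsf: injective (ulsf p _).
    move=> s; apply: can_inj (ulsf (s p) s^-1%g) _ => k'.
    by rewrite {1}/ulsf ulsfK !permK liftK.
  exists (fun s => perm (inj_ulsf s)) => [s _ | s].
    by apply/permP=> k'; rewrite permE /ulsf lift_perm_lift lift_perm_id liftK.
  case/andP=> _ /eqP si0; apply/permP=> k.
  case: (unliftP p k) => [k'|] ->; rewrite ?lift_perm_id //.
  by rewrite lift_perm_lift -si0 permE ulsfK.
by apply: eq_bigl => s; rewrite lift_perm_id eqxx andbT.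
Qed.

Lemma ltn_lift n (p : 'I_n.+1) (i j : 'I_n) : (lift p i < lift p j) = (i < j).
Proof. by rewrite /= /bump; lia. Qed.

Lemma sum_ltn n p : p <= n -> \sum_(k < n) (k < p) = p.
Proof.
elim: n p => [|n IHn] p pn; first by rewrite big_ord0; lia.
rewrite big_ord_recr /=; have [pn'|pn'] := leqP p n; first by rewrite IHn //; lia.
have -> : p = n.+1 by lia.
rewrite addn1 -[in RHS](IHn n (leqnn n)); congr S.
by apply: eq_bigr => i _; have := ltn_ord i; lia.
Qed.

(** A maximal value placed at position p is in order with exactly the p
positions before it. *)
Lemma noninv_lift n (p : 'I_n.+1) (s : 'S_n) :
  noninv (lift_perm p ord_max s) = p + noninv s.
Proof.
rewrite /noninv (bigD1_ord p) //= [X in X + _]big1 ?add0n => [|j _]; last first.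
  by rewrite lift_perm_id /= [n < _]ltnNge leq_ord andbF.
under eq_bigr => i _.
  rewrite (bigD1_ord p) //= lift_perm_id lift_perm_lift.
  under eq_bigr => j _ do rewrite lift_perm_lift !ltn_lift.
  over.
rewrite big_split /=; congr (_ + _).
rewrite -[RHS](@sum_ltn n p) ?leq_ord //.
apply: eq_bigr => i _; rewrite [bump n _]/bump [n <= s i]leqNgt ltn_ord add0n ltn_ord andbT.
congr nat_of_bool; rewrite /bump; case: (leqP p i) => h; apply/idP/idP; lia.
Qed.

Definition first_in_block n (b : nat -> nat) (p : 'I_n) : bool :=
  [forall i : 'I_n, (i < p) ==> (b i != b p)].

(** In a block the largest value of a decreasing permutation comes first. *)
Lemma block_decreasing_lift n b (p : 'I_n.+1) (s : 'S_n) :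
  block_decreasing b (lift_perm p ord_max s) =
  first_in_block b p && block_decreasing (b \o bump p) s.
Proof.
apply/forallP/andP => [H|[/forallP F /forallP H] i].
  split; apply/forallP=> i.
    apply/implyP=> ip; apply/negP => e.
    have /forallP/(_ p) := H i; rewrite ip e /= lift_perm_id /=.
    by rewrite ltnNge leq_ord.
  apply/forallP=> j; have /forallP/(_ (lift p j)) := H (lift p i).
  by rewrite ltn_lift !lift_perm_lift ltn_lift.
apply/forallP=> j; apply/implyP=> /andP[ij bij].
case: (unliftP p i) ij bij => [i'|] ->; case: (unliftP p j) => [j'|] -> ij bij.
- rewrite !lift_perm_lift ltn_lift; have /forallP/(_ j')/implyP := H i'; apply.
  by rewrite -(ltn_lift p) ij.
- by have := F (lift p i'); rewrite ij bij.
- rewrite lift_perm_id lift_perm_lift /= /bump; have := ltn_ord (s j'); lia.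
- by rewrite ltnn in ij.
Qed.

Section Count.
Variable q : nat.

(** Recursion on the position of the largest value. *)
Lemma decreasing_sumS n b :
  decreasing_sum q n.+1 b =
  \sum_(p < n.+1 | first_in_block b p) q ^ p * decreasing_sum q n (b \o bump p).
Proof.
rewrite /decreasing_sum (partition_big (fun s : 'S_n.+1 => s^-1%g ord_max) predT) //=.
rewrite [RHS]big_mkcond /=; apply: eq_bigr => p _.
under eq_bigl => s do rewrite (can2_eq (permK s^-1) (permKV s^-1)) invgK eq_sym.
rewrite (big_lift_perm p (block_decreasing b)).
under eq_bigl => s do rewrite block_decreasing_lift.
case: ifP => h /=; last by rewrite big_pred0.
by rewrite big_distrr /=; apply: eq_bigr => s _; rewrite noninv_lift expnD.
Qed.

Lemma tail_sizeS n b (p : 'I_n.+1) (k : 'I_n) : first_in_block b p ->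
  tail_size n.+1 b (lift p k) = tail_size n (b \o bump p) k.
Proof.
move=> /forallP F; rewrite /tail_size (bigD1_ord p) //=.
have -> : (bump p k <= p) && (b (bump p k) == b p) = false.
  apply/negP => /andP[h1 h2]; have lt : bump p k < p by move: h1; rewrite /bump; lia.
  by have := F (lift p k); rewrite /= lt h2.
by rewrite add0n; apply: eq_bigr => j _; congr (nat_of_bool (_ && _)); rewrite /bump; lia.
Qed.

Lemma sum_interval (P : pred nat) p m : (forall j, p <= j -> P j.+1 -> P j) ->
  \sum_(p <= j < p + m | P j) q ^ j = q ^ p * qint q (\sum_(p <= j < p + m) P j).
Proof.
move=> Pdown; elim: m => [|m IHm].
  by rewrite addn0 !big_geq // /qint big_ord0 muln0.
rewrite addnS big_mkcond !big_nat_recr ?leq_addr //= -big_mkcond IHm.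
case: ifP => h; last by rewrite !addn0.
have all j : p <= j <= p + m -> P j.
  move=> /andP[pj]; have [k ->] : exists k, j = p + k by exists (j - p); lia.
  rewrite leq_add2l => km; move: h; have -> : p + m = p + k + (m - k) by lia.
  elim: (m - k) => [|i IHi]; first by rewrite addn0.
  by rewrite addnS => /Pdown h; apply/IHi/h; rewrite -addnA leq_addr.
rewrite addn1; have -> : \sum_(p <= i < p + m) P i = m.
  under eq_big_nat => j /andP[h1 h2] do rewrite all ?h1 ?(ltnW h2) //.
  by rewrite sum_nat_const_nat muln1 addKn.
by rewrite qintS mulnDr expnD.
Qed.

(** The powers q^j, j < n, sorted by the block of j: the block starting
at p contributes q^p times the q-integer of the size of the block. *)
Lemma sum_blocks n b : {homo b : i j / i <= j} ->
  \sum_(p < n | first_in_block b p) q ^ p * qint q (tail_size n b p) = qint q n.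
Proof.
move=> mono.
have T (p : 'I_n) : q ^ p * qint q (tail_size n b p) =
    \sum_(j < n | (p <= j) && (b p == b j)) q ^ j.
  have -> : tail_size n b p = \sum_(p <= j < p + (n - p)) (b p == b j).
    rewrite subnKC ?(ltnW (ltn_ord p)) // /tail_size.
    rewrite -(big_mkord predT (fun j => ((p <= j) && (b p == b j)) : nat)).
    rewrite (big_cat_nat (n := p)) //= ?(ltnW (ltn_ord p)) // big_nat_cond big1 => [|j]; last first.
      by rewrite andbT => /andP[_ h]; rewrite leqNgt h.
    by rewrite add0n; apply: eq_big_nat => j /andP[-> _].
  rewrite -(@sum_interval (fun j => b p == b j)) => [|j pj /eqP e].
    rewrite subnKC ?(ltnW (ltn_ord p)) // -(big_mkord (fun j =>
      (p <= j) && (b p == b j)) (fun j => q ^ j)).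
    rewrite [RHS](big_cat_nat (n := p)) //= ?(ltnW (ltn_ord p)) // [X in _ = X + _]big_nat_cond
      [X in _ = X + _]big1 => [|j].
      by rewrite add0n big_nat_cond [RHS]big_nat_cond; apply: eq_bigl => j; lia.
    by move=> /andP[/andP[_ h1] /andP[h2 _]]; lia.
  by rewrite eqn_leq {2}e !mono.
under eq_bigr => p _ do rewrite T big_mkcond.
rewrite exchange_big /=; apply: eq_bigr => j _.
have [p pj pmin] := @arg_minnP _ j (fun i : 'I_n => b i == b j) (fun i => i) (eqxx _).
rewrite (bigD1 p) /=; last first.
  apply/forallP=> i; apply/implyP=> ip; apply/negP => /eqP e.
  by have := pmin i; rewrite e => /(_ pj); lia.
rewrite pj (pmin j) // big1 ?addn0 // => i /andP[/forallP F ip].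
case: ifP => // /andP[_ bij]; exfalso.
have {pj}bip : b i == b p by rewrite (eqP bij) eq_sym.
have := F p; rewrite eq_sym bip implybF -leqNgt => le1.
have := pmin i bij => le2; case/eqP: ip; apply: val_inj => /=; lia.
Qed.

(** The q-multinomial identity, for the permutations which decrease on the
blocks; monotonicity of [b] makes the blocks intervals. *)
Lemma decreasing_sum_fact n b : {homo b : i j / i <= j} ->
  decreasing_sum q n b * block_fact q n b = qfact q n.
Proof.
elim: n b => [|n IHn] b mono.
  rewrite /block_fact /qfact !big_ord0 muln1 /decreasing_sum.
  rewrite (big_pred1 1%g) ?/noninv ?big_ord0 // => s.
  have -> : s = 1%g by apply/permP => -[].
  by rewrite /= eqxx; apply/forallP => -[].
rewrite decreasing_sumS big_distrl /= /qfact big_ord_recr /= -/(qfact q n).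
rewrite -(sum_blocks n.+1 mono) [RHS]mulnC big_distrl /=; apply: eq_bigr => p Fp.
rewrite -(IHn (b \o bump p)) => [|i j ij]; last by rewrite /= mono //= /bump; lia.
rewrite /block_fact (bigD1_ord p) //=.
under eq_bigr => k _ do rewrite (tail_sizeS _ Fp).
by rewrite mulnACA.
Qed.

End Count.

Fixpoint block_index (m : seq nat) (i : nat) : nat :=
  if m is a :: m' then if i < a then 0 else (block_index m' (i - a)).+1 else 0.

Lemma block_index_homo m : {homo block_index m : i j / i <= j}.
Proof.
elim: m => [|a m IHm] i j ij //=.
case: (ltnP i a) => // ai; case: (ltnP j a) => aj; first by lia.
by apply: IHm; lia.
Qed.

Lemma block_fact_index q m :
  block_fact q (sumn m) (block_index m) = \prod_(a <- m) qfact q a.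
Proof.
elim: m => [|a m IHm]; first by rewrite /block_fact big_ord0 big_nil.
rewrite big_cons -{}IHm /block_fact /= big_split_ord /=; congr (_ * _).
  rewrite /qfact [RHS](reindex_inj rev_ord_inj) /=; apply: eq_bigr => i _.
  congr (qint q _); rewrite /tail_size big_split_ord /= [X in _ + X]big1 ?addn0 => [|j _];
    last first.
    by rewrite ltn_ord ltnNge leq_addr /= andbF.
  under eq_bigr => j _ do rewrite !ltn_ord eqxx andbT.
  have := sum_ltn (ltnW (ltn_ord i)) => S.
  have : \sum_(k < a) (k < i) + \sum_(k < a) (i <= k) = a.
    rewrite -big_split /=.
    rewrite (eq_bigr (fun => 1)) => [|k _]; last by case: ltnP.
    by rewrite sum_nat_const card_ord muln1.
  by rewrite S; move: (\sum_(k < a) (i <= k)) => x; have := ltn_ord i; lia.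
apply: eq_bigr => i _; congr (qint q _).
rewrite /tail_size big_split_ord /= big1 ?add0n => [|j _].
  apply: eq_bigr => j _; rewrite leq_add2l !ltnNge !leq_addr /= !addKn eqSS.
  by [].
by have := ltn_ord j; case: leqP => //; lia.
Qed.

Definition joined (b : nat -> nat) (j : nat) : bool := (0 < j) && (b j.-1 == b j).

Lemma joined_cons a m j :
  joined (block_index (a :: m)) j = if j < a then 0 < j else joined (block_index m) (j - a).
Proof.
rewrite /joined /=; case: (ltnP j a) => ja.
  have -> : j.-1 < a by lia.
  by rewrite eqxx andbT.
case: (ltnP j.-1 a) => ja'.
  rewrite andbF; by have -> : 0 < j - a = false by lia.
rewrite eqSS; have -> : j.-1 - a = (j - a).-1 by lia.
by have -> : (0 < j) = (0 < j - a) by lia.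
Qed.

Lemma joined_cat x m j :
  joined (block_index (x ++ m)) j =
  if j < sumn x then joined (block_index x) j else joined (block_index m) (j - sumn x).
Proof.
elim: x j => [|a x IHx] j; first by rewrite subn0.
rewrite cat_cons !joined_cons IHx /= subnDA; case: (ltnP j a) => h.
  by have -> : j < a + sumn x by lia.
by have -> : (j - a < sumn x) = (j < a + sumn x) by lia.
Qed.

(** Compositions of n correspond to subsets of {1, ..., n - 1}. *)
Lemma joined_exists (J : nat -> bool) n :
  exists2 m, sumn m = n & forall j, 0 < j < n -> joined (block_index m) j = J j.
Proof.
suff [m [s p H]] : exists m, [/\ sumn m = n, all (leq 1) m &
    forall j, 0 < j < n -> joined (block_index m) j = J j] by exists m.
elim: n J => [|[|n] IHn] J; first by exists [::]; split => // -[].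
  by exists [:: 1]; split => // -[|[]].
have [[|a m] [//= s /andP[a0 p] H]] := IHn (fun j => J j.+1).
case J1 : (J 1).
  exists (a.+1 :: m); split=> [||j jn]; first by rewrite /= addSn s.
    by rewrite /= p.
  have := H j.-1; rewrite !joined_cons.
  case: j jn => [|[|j]] jn //; first by move=> _; rewrite [1 < _]ltnS a0 J1.
  by rewrite [j.+2 < _]ltnS subSS => -> //; lia.
exists [:: 1, a & m]; split=> [||j jn]; first by rewrite /= add1n s.
  by rewrite /= a0 p.
rewrite joined_cons; case: j jn => [|[|j]] jn //.
by rewrite subSS subn0 H //; lia.
Qed.

(** * Subgroups of the general linear group *)

Local Open Scope ring_scope.

(** GL_(N+1)(F) enters only through the matrix entries of its elements.  An
abstract carrier keeps the canonical structures on the concrete group of units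
out of unification. *)
Record linear_group (F : finFieldType) (N : nat) := LinearGroup {
  lg_sort :> finGroupType;
  ent : lg_sort -> 'M[F]_N.+1;
  matG : 'M[F]_N.+1 -> lg_sort;
  entM : forall g h, ent (g * h)%g = ent g *m ent h;
  ent1 : ent 1%g = 1%:M;
  ent_inj : injective ent;
  ent_unit : forall g, ent g \in unitmx;
  matGK : forall M, M \in unitmx -> ent (matG M) = M }.

Section Matrices.
Variables (F : finFieldType) (N : nat) (G : linear_group F N).

Lemma GL_inj (g h : G) : (forall i j, ent g i j = ent h i j) -> g = h.
Proof. by move=> e; apply/ent_inj/matrixP. Qed.

(** The pattern subgroup of the unitriangular matrices that are supported on
[D]; a group if [D] is a strict transitive relation. *)
Definition pat (D : rel 'I_N.+1) : {set G} :=
  [set g : G | [forall i, forall j, if i == j then ent g i j == 1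
                                    else D i j || (ent g i j == 0)]].

Lemma patP D (g : G) :
  reflect ((forall i, ent g i i = 1) /\
           (forall i j : 'I_N.+1, i != j -> ~~ D i j -> ent g i j = 0)) (g \in pat D).
Proof.
rewrite inE; apply: (iffP forallP) => [H|[H1 H2] i].
  split=> [i|i j ij Dij]; first by have /forallP/(_ i) := H i; rewrite eqxx => /eqP.
  by have /forallP/(_ j) := H i; rewrite (negPf ij) (negPf Dij) => /eqP.
apply/forallP=> j; case: eqVneq => [<-|ij]; first by rewrite H1.
by case: (boolP (D i j)) => //= Dij; rewrite H2.
Qed.

Definition strict (D : rel 'I_N.+1) := forall i j, D i j -> (i < j)%N.

Lemma pat_group_set D : strict D -> transitive D -> group_set (pat D).
Proof.
move=> sD tD; apply/group_setP; split.
  by apply/patP; split=> [i|i j ij _]; rewrite ent1 mxE ?eqxx ?(negPf ij).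
move=> g h /patP[g1 g2] /patP[h1 h2]; apply/patP; split=> [i|i j ij Dij].
  rewrite entM mxE (bigD1 i) //= g1 h1 mul1r big1 ?addr0 // => k ki.
  have [Dik|/g2->] := boolP (D i k); rewrite ?mul0r // 1?eq_sym //.
  have [Dki|/h2->] := boolP (D k i); rewrite ?mulr0 //.
  by have := sD _ _ Dik; have := sD _ _ Dki; lia.
rewrite entM mxE big1 // => k _.
have [->|ki] := eqVneq k i; first by rewrite h2 ?mulr0.
have [->|kj] := eqVneq k j; first by rewrite g2 ?mul0r.
have [Dik|/g2->] := boolP (D i k); rewrite ?mul0r // 1?eq_sym //.
have [Dkj|/h2->] := boolP (D k j); rewrite ?mulr0 //.
by rewrite (tD _ _ _ Dik Dkj) in Dij.
Qed.

Lemma patS (D D' : rel 'I_N.+1) : subrel D D' -> pat D \subset pat D'.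
Proof.
move=> DD; apply/fintype.subsetP=> g /patP[g1 g2]; apply/patP; split=> // i j ij Dij.
by apply: g2 => //; apply: contra Dij; apply: DD.
Qed.

Definition ltI : rel 'I_N.+1 := fun i j => (i < j)%N.
Notation U := (pat ltI).

Lemma ltI_strict : strict ltI. Proof. by []. Qed.
Lemma ltI_trans : transitive ltI. Proof. by move=> j i k; apply: ltn_trans. Qed.
Canonical U_group := Group (pat_group_set ltI_strict ltI_trans).

Lemma pat_sub D : strict D -> pat D \subset U.
Proof. by move=> sD; apply: patS => i j /sD. Qed.

Lemma upper_unit (M : 'M[F]_N.+1) : (forall i j : 'I_N.+1, (j < i)%N -> M i j = 0) ->
  (forall i, M i i != 0) -> M \in unitmx.
Proof.
move=> M0 M1; rewrite -unitmx_tr unitmxE det_trig; last first.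
  by apply/is_trig_mxP=> i j ij; rewrite mxE M0.
by rewrite unitfE prodf_seq_neq0; apply/allP=> i _ /=; rewrite mxE M1.
Qed.

Lemma lower_unit (M : 'M[F]_N.+1) : (forall i j : 'I_N.+1, (i < j)%N -> M i j = 0) ->
  (forall i, M i i != 0) -> M \in unitmx.
Proof.
move=> M0 M1; rewrite -unitmx_tr; apply: upper_unit => [i j ij|i]; rewrite mxE //.
exact: M0.
Qed.

Definition uni (f : 'I_N.+1 -> 'I_N.+1 -> F) : G :=
  matG G (\matrix_(i, j) if i == j then 1 else f i j).

Lemma uniE (f : 'I_N.+1 -> 'I_N.+1 -> F) : (forall i j, f i j != 0 -> (i < j)%N) ->
  forall i j, ent (uni f) i j = if i == j then 1 else f i j.
Proof.
move=> f0 i j; rewrite matGK ?mxE //; apply: upper_unit => [k m mk|k].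
  rewrite mxE -val_eqE gtn_eqF //; apply/eqP; apply: contraT => /f0; lia.
by rewrite mxE eqxx oner_neq0.
Qed.

Lemma card_pat D : strict D ->
  #|pat D| = (#|F| ^ (\sum_(i < N.+1) \sum_(j < N.+1) D i j))%N.
Proof.
move=> sD; pose DD := [pred ij : 'I_N.+1 * 'I_N.+1 | D ij.1 ij.2].
pose fu (f : {ffun 'I_N.+1 * 'I_N.+1 -> F}) := uni (fun i j => f (i, j)).
have supp f : f \in pffun_on 0 DD F -> forall i j, f (i, j) != 0 -> D i j.
  by move=> /pffun_onP[/supportP S _] i j; apply: contraR => h; rewrite S.
have suppl f : f \in pffun_on 0 DD F -> forall i j, f (i, j) != 0 -> (i < j)%N.
  by move=> h i j /(supp _ h)/sD.
have inj : {in pffun_on 0 DD F &, injective fu}.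
  move=> f g hf hg e; apply/ffunP=> -[i j].
  have : ent (fu f) i j = ent (fu g) i j by rewrite e.
  rewrite /fu !uniE; try exact: suppl.
  case: eqVneq => [<- _|] //.
  have f0 h : h \in pffun_on 0 DD F -> h (i, i) = 0.
    by move=> hh; apply/eqP; apply: contraT => /(suppl _ hh); rewrite ltnn.
  by rewrite !f0.
have -> : pat D = [set fu f | f in pffun_on 0 DD F].
  apply/setP=> g; apply/idP/imsetP => [/patP[g1 g2]|[f hf ->]].
    pose f := [ffun ij : 'I_N.+1 * 'I_N.+1 => if DD ij then ent g ij.1 ij.2 else 0].
    have hf : f \in pffun_on 0 DD F.
      apply/pffun_onP; split=> //; apply/supportP=> ij; rewrite ffunE.
      by rewrite inE /=; case: ifP.
    exists f => //; apply: GL_inj => i j; rewrite /fu uniE; last exact: suppl.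
    case: eqVneq => [<-|ij] //; rewrite ffunE /=.
    by case: ifP => // /negbT/g2->.
  apply/patP; rewrite /fu; split=> [i|i j ij Dij]; rewrite uniE; try exact: suppl.
    by rewrite eqxx.
  by rewrite (negPf ij); apply/eqP; apply: contraT => /(supp _ hf) => h; rewrite h in Dij.
rewrite card_in_imset // card_pffun_on; congr (_ ^ _)%N.
rewrite pair_big /= -sum1_card big_mkcond /=.
by apply: eq_bigr => -[i j] _; rewrite inE /=; case: (D i j).
Qed.

(** The column index j names the simple root (j - 1, j), so [c] is used at
1, ..., N only. *)
Definition chi (c : nat -> F) (g : G) : F :=
  \sum_(i < N.+1) \sum_(j < N.+1 | j == i.+1 :> nat) c j * ent g i j.

Lemma chiM c g h : g \in U -> h \in U -> chi c (g * h)%g = chi c g + chi c h.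
Proof.
move=> /patP[g1 g2] /patP[h1 h2]; rewrite /chi -big_split; apply: eq_bigr => i _ /=.
rewrite -big_split; apply: eq_bigr => j /eqP ji /=.
rewrite entM mxE -mulrDr; congr (_ * _).
have ij : i != j by rewrite -val_eqE /= ji neq_ltn ltnSn.
rewrite (bigD1 i) //= g1 mul1r (bigD1 j) 1?eq_sym //= h1 mulr1 big1 ?addr0 1?addrC //.
move=> k /andP[ki kj]; rewrite -val_eqE /= in ki; rewrite -val_eqE /= in kj.
have [ik|ik] := ltnP i k; last by rewrite g2 ?mul0r -?val_eqE /ltI //=; lia.
by rewrite h2 ?mulr0 -?val_eqE /ltI //=; lia.
Qed.

Lemma chi1 c : chi c 1%g = 0.
Proof.
apply: (addrI (chi c 1%g)); rewrite addr0 -chiM ?mulg1 //; exact: group1 U_group.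
Qed.

Lemma chiV c g : g \in U -> chi c g^-1%g = - chi c g.
Proof.
move=> Ug; apply: (addrI (chi c g)).
by rewrite -chiM ?(@groupVr _ U_group) // mulgV chi1 subrr.
Qed.

Lemma chiN c g : chi (fun j => - c j) g = - chi c g.
Proof.
rewrite /chi -sumrN; apply: eq_bigr => i _; rewrite -sumrN.
by apply: eq_bigr => j _; rewrite mulNr.
Qed.

Definition borelG : {set G} := [set g : G | is_trig_mx (ent g)^T].
Local Notation B := borelG.

Lemma borelP (g : G) : reflect (forall i j : 'I_N.+1, (j < i)%N -> ent g i j = 0) (g \in B).
Proof.
rewrite inE; apply: (iffP is_trig_mxP) => H i j ij; last by rewrite mxE H.
by have := H j i ij; rewrite mxE.
Qed.

Lemma borel_group_set : group_set B.
Proof.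
apply/group_setP; split; first by apply/borelP=> i j ji; rewrite ent1 mxE -val_eqE gtn_eqF.
move=> g h /borelP g0 /borelP h0; apply/borelP=> i j ji; rewrite entM mxE big1 // => k _.
have [ki|ik] := ltnP k i; first by rewrite g0 ?mul0r.
by rewrite h0 ?mulr0 //; apply: leq_trans ik.
Qed.
Canonical B_group := Group borel_group_set.

Lemma borel_diag (g : G) i : g \in B -> ent g i i != 0.
Proof.
move=> /borelP g0; have := ent_unit g.
rewrite -unitmx_tr unitmxE det_trig; last first.
  by apply/is_trig_mxP=> k j kj; rewrite mxE g0.
by rewrite unitfE prodf_seq_neq0 => /allP/(_ i (mem_index_enum i)); rewrite mxE.
Qed.

Definition torus : {set G} :=
  [set g : G | [forall i : 'I_N.+1, forall j : 'I_N.+1, (i != j) ==> (ent g i j == 0)]].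

Lemma torusP (g : G) : reflect (forall i j, i != j -> ent g i j = 0) (g \in torus).
Proof.
rewrite inE; apply: (iffP forallP) => H i; last first.
  by apply/forallP=> j; apply/implyP => h; rewrite H.
by move=> j ij; have /forallP/(_ j)/implyP/(_ ij)/eqP := H i.
Qed.

Lemma torus_sub_B : torus \subset B.
Proof.
apply/fintype.subsetP=> g /torusP g0; apply/borelP => i j ji; apply: g0.
by rewrite -val_eqE gtn_eqF.
Qed.

Definition diagG (t : 'I_N.+1 -> F) : G :=
  matG G (\matrix_(i, j) if i == j then t i else 0).

Lemma diagGE t : (forall i, t i != 0) ->
  forall i j, ent (diagG t) i j = if i == j then t i else 0.
Proof.
move=> t0 i j; rewrite matGK ?mxE //; apply: upper_unit => [k m mk|k].
  by rewrite mxE -val_eqE gtn_eqF.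
by rewrite mxE eqxx.
Qed.

Lemma mul_torusE (g t : G) i j : t \in torus -> ent (g * t)%g i j = ent g i j * ent t j j.
Proof.
move=> /torusP t0; rewrite entM mxE (bigD1 j) //= big1 ?addr0 // => k kj.
by rewrite t0 // mulr0.
Qed.

Lemma torus_mulE (g t : G) i j : t \in torus -> ent (t * g)%g i j = ent t i i * ent g i j.
Proof.
move=> /torusP t0; rewrite entM mxE (bigD1 i) //= big1 ?addr0 // => k kj.
by rewrite t0 1?eq_sym // mul0r.
Qed.

Lemma torus_conj (t u : G) i j : t \in torus ->
  ent (t * u * t^-1)%g i j = ent t i i * ent u i j / ent t j j.
Proof.
move=> Tt; have t0 := borel_diag j (fintype.subsetP torus_sub_B _ Tt).
by apply: (canRL (mulfK t0)); rewrite -mul_torusE // mulgKV torus_mulE.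
Qed.

Lemma torus_conj_U (t u : G) : t \in torus -> u \in U -> (t * u * t^-1)%g \in U.
Proof.
move=> Tt /patP[u1 u2]; have t0 i := borel_diag i (fintype.subsetP torus_sub_B _ Tt).
apply/patP; split=> [i|i j ij Dij]; rewrite torus_conj //; first by rewrite u1 mulr1 divff.
by rewrite u2 // mulr0 mul0r.
Qed.

Lemma borel_factor (g : G) : g \in B -> exists2 t, t \in torus & (g * t^-1)%g \in U.
Proof.
move=> Bg; have d0 i := borel_diag i Bg; pose t := diagG (fun i => ent g i i).
have tE := diagGE d0; have Tt : t \in torus.
  by apply/torusP=> i j ij; rewrite tE (negPf ij).
exists t => //; have Bu : (g * t^-1)%g \in B.
  by apply: (@groupM _ B_group) => //; apply: (@groupVr _ B_group);
    apply: (fintype.subsetP torus_sub_B).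
apply/patP; split=> [i|i j ij].
  have : ent (g * t^-1 * t)%g i i = ent g i i by rewrite mulgKV.
  rewrite entM mxE (bigD1 i) //= tE eqxx big1 ?addr0 => [|k ki].
    by move=> /(canRL (mulfK (d0 i))) ->; rewrite divff.
  by rewrite tE (negPf ki) mulr0.
rewrite /ltI -leqNgt => ji; have /borelP := Bu; apply.
by rewrite ltn_neqAle ji andbT eq_sym.
Qed.

Definition permG (s : 'S_N.+1) : G := matG G (perm_mx s).

Lemma permGK s : ent (permG s) = perm_mx s.
Proof. by rewrite matGK ?unitmx_perm. Qed.

Lemma permGM s t : permG (s * t)%g = (permG s * permG t)%g.
Proof. by apply: ent_inj; rewrite entM !permGK perm_mxM. Qed.

Lemma permG1 : permG 1%g = 1%g.
Proof. by apply: ent_inj; rewrite ent1 permGK perm_mx1. Qed.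

Lemma permGV s : permG s^-1%g = (permG s)^-1%g.
Proof. by apply: (mulgI (permG s)); rewrite -permGM !mulgV permG1. Qed.

Lemma permG_mulE s t (g : G) i j :
  ent (permG s * g * permG t^-1)%g i j = ent g (s i) (t j).
Proof. by rewrite !entM !permGK -[perm_mx s *m _]row_permE -col_permE !mxE. Qed.

Lemma perm_mulE s (g : G) i j : ent (permG s * g)%g i j = ent g (s i) j.
Proof. by rewrite entM permGK -row_permE mxE. Qed.

Lemma mul_permE s (g : G) i j : ent (g * permG s)%g i j = ent g i (s^-1%g j).
Proof. by rewrite entM permGK -{1}[s]invgK -col_permE mxE. Qed.

Lemma adjacent_gen (K : {group 'S_N.+1}) :
  (forall r r' : 'I_N.+1, r' = r.+1 :> nat -> tperm r r' \in K) -> K :=: [set: 'S_N.+1].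
Proof.
move=> adj; apply/eqP; rewrite finset.eqEsubset finset.subsetT -(gen_tperm ord0) gen_subG /=.
apply/fintype.subsetP=> _ /imsetP[j _ ->]; case: j => j jN.
elim: j jN => [|j IHj] jN; first by rewrite (_ : Ordinal jN = ord0) ?tperm1 ?group1 //;
  apply: val_inj.
have jN' : (j < N.+1)%N by apply: ltnW.
have [j0|j0] := posnP j.
  by apply: adj; rewrite /= j0.
have -> : tperm ord0 (Ordinal jN) = (tperm ord0 (Ordinal jN') ^ tperm (Ordinal jN') (Ordinal jN))%g.
  by rewrite tpermJ tpermL tpermD // -val_eqE /= ?(gtn_eqF j0) //.
by rewrite groupJ // ?IHj // adj.
Qed.

(** The LUP decomposition, with the lower triangular factor conjugated into U
by the longest permutation. *)
Lemma GL_generated (K : {group G}) : U \subset K -> torus \subset K ->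
  (forall r r' : 'I_N.+1, r' = r.+1 :> nat -> permG (tperm r r') \in K) ->
  forall g, g \in K.
Proof.
move=> /fintype.subsetP UK /fintype.subsetP TK adj g.
have pK s : permG s \in K.
  have gs : group_set [set s | permG s \in K].
    apply/group_setP; split; first by rewrite inE permG1 group1.
    by move=> s1 s2; rewrite !inE permGM => h1 h2; rewrite groupM.
  have := @adjacent_gen (Group gs) _; rewrite -setP /= => /(_ _ s).
  by rewrite !inE => -> // r r'; rewrite inE; apply: adj.
have BK b : b \in B -> b \in K.
  by move=> /borel_factor[t /TK Kt /UK]; rewrite groupMr ?groupV.
have := cormen_lup_correct (ent g); have := cormen_lup_perm (ent g).
have := cormen_lup_detL (ent g); have := @cormen_lup_lower _ _ (ent g).
have := @cormen_lup_upper _ _ (ent g).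
case: (cormen_lup _) => [[P L] V] /= upV lowL detL /is_perm_mxP[s ->] e.
pose w0 := perm (@rev_ord_inj N.+1).
have Lu : L \in unitmx by rewrite unitmxE detL unitr1.
have Vu : V \in unitmx.
  have : perm_mx s * ent g \in unitmx.
    by rewrite unitmx_mul unitmx_perm ent_unit.
  by rewrite e unitmx_mul => /andP[].
have KV : matG G V \in K by apply: BK; apply/borelP=> i j ij; rewrite matGK // upV.
have KL : matG G L \in K.
  have h : (permG w0 * matG G L * permG w0^-1)%g \in K.
    apply: UK; apply/patP; split=> [i|i j ij]; rewrite permG_mulE matGK //.
      by rewrite lowL ?eqxx.
    rewrite /ltI -leqNgt => ji; rewrite lowL !permE ?leq_sub2l //=.
    by rewrite (inj_eq rev_ord_inj) (negPf ij).
  by move: h; rewrite groupMr ?pK // groupMl ?pK.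
have -> : g = (permG s^-1 * (matG G L * matG G V))%g.
  apply: (mulgI (permG s)); rewrite mulgA -permGM mulgV permG1 mul1g.
  by apply: ent_inj; rewrite !entM permGK !matGK.
by rewrite !groupM.
Qed.

End Matrices.

(** * The lattice is spanned by the unipotent translates of its generator *)

Section GroupAlgebraTheory.
Variables (R : comPzRingType) (gT : finGroupType).
Implicit Types (x y : galg R gT) (g h : gT) (r : R).

Lemma galgD x y g : (x + y) g = x g + y g.
Proof. by rewrite ffunE. Qed.

Lemma galg_sum (I : Type) (s : seq I) (P : pred I) (f : I -> galg R gT) g :
  (\sum_(i <- s | P i) f i) g = \sum_(i <- s | P i) f i g.
Proof. by elim/big_rec2: _ => [|i y z _ <-]; rewrite ?ffunE. Qed.

Lemma galgM x y g : (x * y) g = \sum_h x h * y (h^-1 * g)%g.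
Proof. by rewrite ffunE. Qed.

Lemma galg_ofE g h : (galg_of g : galg R gT) h = (h == g)%:R.
Proof. by rewrite ffunE. Qed.

Lemma galg_of_mulE g x h : (galg_of g * x) h = x (g^-1 * h)%g.
Proof.
rewrite galgM (bigD1 g) //= galg_ofE eqxx mul1r big1 ?addr0 // => k /negPf kg.
by rewrite galg_ofE kg mul0r.
Qed.

Lemma galg_ofM g h : galg_of (g * h)%g = galg_of g * galg_of h :> galg R gT.
Proof.
apply/ffunP=> k; rewrite galg_of_mulE !galg_ofE.
by rewrite -(inj_eq (mulgI g) _ h) mulKVg.
Qed.

Lemma galg_of1 : galg_of 1%g = 1 :> galg R gT.
Proof. by []. Qed.

(** The constants of the group algebra; the product with a constant stands for
the scaling by an element of R. *)
Definition scal r : galg R gT := [ffun g => r *+ (g == 1%g)].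

Lemma scal_mulE r x g : (scal r * x) g = r * x g.
Proof.
rewrite galgM (bigD1 1%g) //= ffunE eqxx mulr1n invg1 mul1g big1 ?addr0 //.
by move=> k /negPf k1; rewrite ffunE k1 mulr0n mul0r.
Qed.

Lemma mul_scalE r x g : (x * scal r) g = x g * r.
Proof.
rewrite galgM (bigD1 g) //= ffunE mulVg eqxx mulr1n big1 ?addr0 //.
by move=> k kg; rewrite ffunE -eq_mulVg1 (negPf kg) mulr0n mulr0.
Qed.

Lemma scalC r x : x * scal r = scal r * x.
Proof. by apply/ffunP=> g; rewrite scal_mulE mul_scalE mulrC. Qed.

Lemma scal1 : scal 1 = 1.
Proof. by apply/ffunP=> g; rewrite !ffunE. Qed.

Lemma scal0 : scal 0 = 0.
Proof. by apply/ffunP=> g; rewrite !ffunE mul0rn. Qed.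

Lemma scalM r1 r2 : scal (r1 * r2) = scal r1 * scal r2.
Proof. by apply/ffunP=> g; rewrite scal_mulE !ffunE mulrnAr. Qed.

Lemma scalD r1 r2 : scal (r1 + r2) = scal r1 + scal r2.
Proof. by apply/ffunP=> g; rewrite !ffunE mulrnDl. Qed.

Lemma scalN r : scal (- r) = - scal r.
Proof. by apply/ffunP=> g; rewrite !ffunE mulNrn. Qed.

Lemma scal_sum (I : Type) (s : seq I) (P : pred I) (f : I -> R) :
  scal (\sum_(i <- s | P i) f i) = \sum_(i <- s | P i) scal (f i).
Proof. by elim/big_rec2: _ => [|i y z _ <-]; rewrite ?scal0 ?scalD. Qed.

Lemma scal_sign (b : bool) : scal ((-1) ^+ b) = (-1) ^+ b.
Proof. by case: b; rewrite /= ?expr0 ?expr1 ?scalN ?scal1. Qed.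

Lemma mulrn_scal x m : x *+ m = scal m%:R * x.
Proof.
elim: m => [|m IHm]; first by rewrite mulr0n scal0 mul0r.
by rewrite mulrS IHm mulrS scalD scal1 mulrDl mul1r.
Qed.

Lemma galg_expand x : x = \sum_g scal (x g) * galg_of g.
Proof.
apply/ffunP=> h; rewrite galg_sum (bigD1 h) //= scal_mulE galg_ofE eqxx mulr1.
by rewrite big1 ?addr0 // => g gh; rewrite scal_mulE galg_ofE eq_sym (negPf gh) mulr0.
Qed.

Lemma sum_setE (S : {set gT}) g : (sum_set S : galg R gT) g = (g \in S)%:R.
Proof.
rewrite /sum_set galg_sum; have [gS|gS] := boolP (g \in S).
  rewrite (bigD1 g) //= galg_ofE eqxx big1 ?addr0 // => s /andP[_ sg].
  by rewrite galg_ofE eq_sym (negPf sg).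
by rewrite big1 // => s sS; rewrite galg_ofE; case: eqP gS => // ->; rewrite sS.
Qed.

Lemma sum_set_stab (S : {group gT}) g : g \in S ->
  galg_of g * sum_set S = sum_set S :> galg R gT.
Proof.
by move=> gS; apply/ffunP=> h; rewrite galg_of_mulE !sum_setE groupMl ?groupV.
Qed.

End GroupAlgebraTheory.

Section Steinberg.
Variables (R : comPzRingType) (F : finFieldType) (N : nat) (G : linear_group F N).
Local Notation A := (galg R G).
Local Notation U := (pat G (@ltI N)).
Local Notation B := (borelG G).
Local Notation permG := (permG G).

(** The element that generates the Steinberg lattice, over an abstract
carrier of the general linear group. *)
Definition steinberg_gen : A :=
  \sum_(s : 'S_N.+1) (-1) ^+ s * galg_of (permG s) * sum_set B.
Local Notation eps := steinberg_gen.

Lemma sgn_comm (b : bool) (x : A) : x * (-1) ^+ b = (-1) ^+ b * x.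
Proof. by rewrite -scal_sign scalC. Qed.

Lemma mul_eps (x : A) :
  x * eps = \sum_(s : 'S_N.+1) (-1) ^+ s * (x * galg_of (permG s) * sum_set B).
Proof.
rewrite /steinberg_gen mulr_sumr; apply: eq_bigr => s _.
by rewrite !mulrA sgn_comm.
Qed.

Lemma epsE g : eps g = \sum_(s : 'S_N.+1) (-1) ^+ s * ((permG s^-1 * g)%g \in B)%:R.
Proof.
rewrite /steinberg_gen galg_sum; apply: eq_bigr => s _.
by rewrite -mulrA -scal_sign scal_mulE galg_of_mulE sum_setE permGV.
Qed.

(** Such g become upper triangular after conjugation by s. *)
Lemma borel_fix (s : 'S_N.+1) (g : G) :
  (forall i j : 'I_N.+1, (s j < s i)%N -> ent g i j = 0) ->
  galg_of g * galg_of (permG s) * sum_set B = galg_of (permG s) * sum_set B :> A.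
Proof.
move=> g0; rewrite -galg_ofM; have -> : (g * permG s)%g = (permG s * (permG s^-1 * g * permG s))%g.
  by rewrite !mulgA -permGM mulgV permG1 mul1g.
rewrite galg_ofM -mulrA (@sum_set_stab _ _ (B_group G)) //.
have -> : permG s = permG (s^-1)^-1 by rewrite invgK.
by apply/borelP=> i j ji; rewrite permG_mulE g0 // !permKV.
Qed.

(** Permutations normalise the torus, and the torus lies in B. *)
Lemma eps_torus (t : G) : t \in torus G -> galg_of t * eps = eps.
Proof.
move=> /torusP t0; rewrite mul_eps; apply: eq_bigr => s _.
rewrite borel_fix ?mulrA // => i j ji; apply: t0.
by apply: contraTneq ji => ->; rewrite ltnn.
Qed.

Lemma eps_perm s : galg_of (permG s) * eps = (-1) ^+ s * eps.
Proof.
rewrite mul_eps /steinberg_gen mulr_sumr [RHS](reindex_inj (mulgI s)) /=.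
apply: eq_bigr => t _; rewrite -galg_ofM -permGM odd_permM signr_addb !mulrA.
by rewrite -signr_addb addbb expr0 mul1r.
Qed.

Section RankOne.
Variables (r r' : 'I_N.+1).
Hypothesis rr' : r' = r.+1 :> nat.
Let s := tperm r r'.

(** The elementary matrix 1 + a E_(r, r+1). *)
Definition root_elt (a : F) : G :=
  uni G (fun i j => if (i == r) && (j == r') then a else 0).
Local Notation x := root_elt.

Lemma root_eltE a i j : ent (x a) i j = (i == j)%:R + ((i == r) && (j == r'))%:R * a.
Proof.
rewrite uniE => [|k m]; last by case: ifP => [/andP[/eqP-> /eqP->] _|_]; rewrite ?rr' ?eqxx.
case: (i =P j) => [->|_]; last by case: (_ && _); rewrite add0r ?mul1r ?mul0r.
case: (j =P r) => [->|_]; rewrite ?mul0r ?addr0 //.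
by rewrite -val_eqE /= rr' ltn_eqF // mul0r addr0.
Qed.

Lemma root_mulE a (g : G) i j :
  ent (x a * g)%g i j = ent g i j + (i == r)%:R * a * ent g r' j.
Proof.
rewrite entM mxE; under eq_bigr => k _ do rewrite root_eltE mulrDl.
rewrite big_split /= (bigD1 i) //= eqxx mul1r big1 ?addr0 => [|k ki]; last first.
  by rewrite eq_sym (negPf ki) mul0r.
congr (_ + _); rewrite (bigD1 r') //= eqxx andbT big1 ?addr0 // => k kr.
by rewrite (negPf kr) andbF !mul0r.
Qed.

Lemma mul_rootE a (g : G) i j :
  ent (g * x a)%g i j = ent g i j + (j == r')%:R * a * ent g i r.
Proof.
rewrite entM mxE; under eq_bigr => k _ do rewrite root_eltE mulrDr.
rewrite big_split /= (bigD1 j) //= eqxx mulr1 big1 ?addr0 => [|k /negPf->]; last first.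
  by rewrite mulr0.
congr (_ + _); rewrite (bigD1 r) //= eqxx /= mulrC big1 ?addr0 // => k /negPf->.
by rewrite mul0r mulr0.
Qed.

Lemma root_eltK a : (x (- a) * x a)%g = 1%g.
Proof.
apply: GL_inj => i j; rewrite root_mulE !root_eltE ent1 mxE.
have -> : (r' == r) = false by rewrite -val_eqE /= rr' gtn_eqF.
rewrite mul0r addr0 -addrA -[(r' == j)]eq_sym.
by case: (i == r); case: (j == r'); rewrite /= ?mul1r ?mul0r ?mulr1 ?mulr0 ?subrr ?addr0 // addrN
  addr0.
Qed.

Lemma root_in_U a : x a \in U.
Proof.
apply/patP; split=> [i|i j ij]; rewrite root_eltE ?eqxx.
  case: (i =P r) => [->|_]; rewrite ?mul0r ?addr0 //.
  by rewrite -val_eqE /= rr' ltn_eqF // mul0r addr0.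
rewrite (negPf ij) add0r /ltI; case: eqP => [->|]; case: eqP => [->|]; rewrite /= ?mul0r //.
by rewrite rr' ltnSn.
Qed.

Lemma swap_lt (i j : 'I_N.+1) : (j < i)%N -> (i, j) != (r', r) -> (s j < s i)%N.
Proof.
rewrite xpair_eqE /s !permE /= -!val_eqE /= => ji ne.
by do 2!case: eqP => ?; do 2?case: eqP => ?; lia.
Qed.

Let ss : (permG s * permG s)%g = 1%g.
Proof. by rewrite -permGM tperm2 permG1. Qed.

(** The only relation of GL_2 that is needed.  In
s x(a) s = x(1/a) s b the element b is upper triangular in the rows r, r + 1
and diagonal elsewhere.  Hence b and all x(c) fix the terms of [eps] for the w
with w r < w (r + 1), and the contributions of w and s w, which have opposite
signs, cancel. *)
Lemma rank_one_rel a : a != 0 ->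
  galg_of (permG s) * galg_of (x a) * eps = galg_of (x a^-1) * eps - eps.
Proof.
move=> a0.
(* b is chosen such that s x(a) s = x(1/a) s b. *)
pose b := (permG s * x (- a^-1) * permG s * x a * permG s)%g.
have bE i j : i != j -> (i, j) != (r, r') -> ent b i j = 0.
  rewrite xpair_eqE => ij ne.
  have -> : b = (permG s * (x (- a^-1) * (permG s * x a * permG s^-1)))%g.
    by rewrite /b tpermV !mulgA.
  rewrite perm_mulE root_mulE !permG_mulE tpermK /s tpermR !root_eltE.
  have srj : (r == tperm r r' j) = (j == r').
    by rewrite -(inj_eq (@perm_inj _ s)) tpermK tpermL eq_sym.
  have sjr : (tperm r r' j == r') = (j == r).
    by rewrite -(inj_eq (@perm_inj _ s)) tpermK tpermR.
  have isj : (i == tperm r r' j) = (tperm r r' i == j).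
    by rewrite -(inj_eq (@perm_inj _ s)) tpermK.
  have sir : (tperm r r' i == r) = (i == r').
    by rewrite -(inj_eq (@perm_inj _ s)) tpermK tpermL.
  rewrite srj sjr isj sir.
  have [ei|ir'] := eqVneq i r'.
    subst i; have -> : (r' == r) = false by rewrite -val_eqE /= rr' gtn_eqF.
    rewrite tpermR [r == j]eq_sym [j == r']eq_sym (negPf ij) /=.
    rewrite ?mulr0n ?mulr1n ?mul0r ?addr0 ?add0r ?mul1r.
    rewrite eqxx /=; case: (j == r); rewrite /= ?mul1r ?mulNr ?mulVf ?subrr //.
    by rewrite mul0r mulr0 oppr0 addr0.
  rewrite /= ?mulr0n ?mul0r ?addr0.
  have [ei|ir] := eqVneq i r.
    subst i; rewrite eqxx /= in ne.
    by rewrite tpermL [r' == j]eq_sym (negPf ne) [j == r]eq_sym (negPf ij) /= mul0r addr0.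
  have -> : tperm r r' i = i by rewrite tpermD // eq_sym.
  by rewrite (negPf ij) /= mul0r addr0.
(* T w is the contribution of w to the difference of both sides. *)
pose T (w : 'S_N.+1) : A := (-1) ^+ w *
   (galg_of (permG s) * galg_of (x a) * galg_of (permG w) * sum_set B
    - galg_of (x a^-1) * galg_of (permG w) * sum_set B
    + galg_of (permG w) * sum_set B).
have ET : \sum_w T w =
    galg_of (permG s) * galg_of (x a) * eps - galg_of (x a^-1) * eps + eps.
  rewrite !mul_eps -sumrN [in RHS]/steinberg_gen -!big_split; apply: eq_bigr => w _ /=.
  by rewrite /T mulrDr mulrBr !mulrA.
suff T0 : \sum_w T w = 0 by apply: subr0_eq; rewrite opprB addrA addrAC -ET.
rewrite (bigID (fun w : 'S_N.+1 => (w r < w r')%N)) /=.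
rewrite [X in _ + X](reindex_inj (mulgI s)) /=.
rewrite [X in _ + X](eq_bigl (fun w : 'S_N.+1 => (w r < w r')%N)); last first.
  move=> w /=; rewrite !permM tpermL tpermR -leqNgt leq_eqVlt.
  have : w r != w r' by rewrite (inj_eq perm_inj) -val_eqE /= rr' ltn_eqF.
  by rewrite -val_eqE => /negPf ->.
rewrite -big_split /= big1 // => w wr.
have fix_w g : (forall i j, i != j -> (i, j) != (r, r') -> ent g i j = 0) ->
    galg_of g * galg_of (permG w) * sum_set B = galg_of (permG w) * sum_set B :> A.
  move=> g0; apply: borel_fix => i j ji; apply: g0.
    by apply: contraTneq ji => ->; rewrite ltnn.
  by apply: contraTneq ji => -[-> ->]; rewrite -leqNgt ltnW.
have x0 c i j : i != j -> (i, j) != (r, r') -> ent (x c) i j = 0.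
  by rewrite xpair_eqE root_eltE => /negPf-> /negPf->; rewrite mul0r addr0.
have fx c := fix_w _ (x0 c); have fb := fix_w _ bE.
rewrite /T odd_mul_tperm (_ : r != r'); last by rewrite -val_eqE /= rr' ltn_eqF.
rewrite permGM !galg_ofM.
have e1 : galg_of (permG s) * galg_of (x a) * galg_of (permG w) * sum_set B
   = galg_of (permG s) * galg_of (permG w) * sum_set B :> A.
  by rewrite -!mulrA [galg_of (x a) * _]mulrA fx.
have e2 : galg_of (permG s) * galg_of (x a) * (galg_of (permG s) * galg_of (permG w)) * sum_set B
   = galg_of (x a^-1) * (galg_of (permG s) * galg_of (permG w)) * sum_set B :> A.
  have e : galg_of (permG s) * galg_of (x a) * galg_of (permG s)
     = galg_of (x a^-1) * galg_of (permG s) * galg_of b :> A.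
    rewrite -!galg_ofM /b !mulgA -[(x a^-1%R * permG s * permG s)%g]mulgA ss mulg1.
    by rewrite -{1}[a^-1]opprK root_eltK mul1g.
  by rewrite !mulrA e -!mulrA [galg_of b * _]mulrA fb.
rewrite e1 fx e2 subrr add0r addrNK /= signrN mulNr.
by apply/eqP; rewrite addr_eq0 opprK mulrA.
Qed.

Lemma swap_U (u : G) : u \in U -> ent u r r' = 0 -> (permG s * u * permG s)%g \in U.
Proof.
move=> /patP[u1 u2] u0; have {2}-> : s = (s^-1)%g by rewrite tpermV.
apply/patP; split=> [i|i j ij Dij]; rewrite permG_mulE //.
have ji : (j < i)%N by move: ij Dij; rewrite /ltI -val_eqE /=; lia.
have [[-> ->]|ne] := eqVneq (i, j) (r', r); first by rewrite /s tpermL tpermR.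
have := swap_lt ji ne => lt; apply: u2; last by rewrite /ltI -leqNgt ltnW.
by rewrite (inj_eq perm_inj).
Qed.

Lemma root_factor (u : G) : u \in U ->
  exists2 v, (v \in U) && (ent v r r' == 0) & u = (v * x (ent u r r'))%g.
Proof.
move=> Uu; exists (u * x (- ent u r r'))%g; last by rewrite -mulgA root_eltK mulg1.
rewrite (@groupM _ (U_group G)) ?root_in_U //= mul_rootE eqxx mul1r.
by case/patP: Uu => -> _; rewrite mulr1 subrr.
Qed.

End RankOne.

Definition in_span (y : A) :=
  exists f : G -> R, y = \sum_(u in U) scal G (f u) * galg_of u * eps.

Lemma in_spanD y z : in_span y -> in_span z -> in_span (y + z).
Proof.
move=> [f ->] [h ->]; exists (fun u => f u + h u); rewrite -big_split /=.
by apply: eq_bigr => u _; rewrite scalD !mulrDl.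
Qed.

Lemma in_spanZ r y : in_span y -> in_span (scal G r * y).
Proof.
move=> [f ->]; exists (fun u => r * f u); rewrite mulr_sumr.
by apply: eq_bigr => u _; rewrite scalM !mulrA.
Qed.

Lemma in_span0 : in_span 0.
Proof. by exists (fun => 0); rewrite big1 // => u _; rewrite scal0 !mul0r. Qed.

Lemma in_span_sum (I : Type) (w : seq I) (P : pred I) (f : I -> A) :
  (forall i, P i -> in_span (f i)) -> in_span (\sum_(i <- w | P i) f i).
Proof. by move=> H; elim/big_ind: _ => //; [exact: in_span0 | exact: in_spanD]. Qed.

Lemma in_span_U u : u \in U -> in_span (galg_of u * eps).
Proof.
move=> Uu; exists (fun v => (v == u)%:R); rewrite (bigD1 u) //= eqxx scal1 mul1r.
by rewrite big1 ?addr0 // => v /andP[_ /negPf->]; rewrite scal0 !mul0r.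
Qed.

(** The span of the u * eps is stable under the generators of G: under U
trivially, under the torus by conjugation, and under a simple reflection s by
writing u = v x(c) with s v s in U and using [rank_one_rel]. *)
Lemma eps_span (a : A) : in_span (a * eps).
Proof.
pose K : {set G} := [set g | `[< forall u, u \in U -> in_span (galg_of (g * u)%g * eps) >]].
have Kstab g : g \in K -> forall y, in_span y -> in_span (galg_of g * y).
  rewrite inE => /asboolP H y [f ->]; rewrite mulr_sumr; apply: in_span_sum => u Uu.
  by rewrite !mulrA scalC -!mulrA; apply: in_spanZ; rewrite mulrA -galg_ofM; apply: H.
have gK : group_set K.
  apply/group_setP; split; first by rewrite inE; apply/asboolP => u Uu; rewrite mul1g;
    apply: in_span_U.
  move=> g h Kg Kh; rewrite inE; apply/asboolP=> u Uu.
  rewrite -mulgA galg_ofM -mulrA; apply: Kstab => //.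
  by move: Kh; rewrite inE => /asboolP; apply.
have KG : forall g, g \in Group gK.
  apply: GL_generated => [||r r' rr'].
  - apply/fintype.subsetP=> g Ug; rewrite inE; apply/asboolP=> u Uu.
    by apply: in_span_U; apply: (@groupM _ (U_group G)).
  - apply/fintype.subsetP=> t Tt; rewrite inE; apply/asboolP=> u Uu.
    have -> : (t * u)%g = (t * u * t^-1 * t)%g by rewrite mulgKV.
    by rewrite galg_ofM -mulrA eps_torus //; apply: in_span_U; apply: torus_conj_U.
  - rewrite inE; apply/asboolP=> u Uu.
    have [v /andP[Uv /eqP v0] ->] := root_factor rr' Uu; move: (ent u r r') => c.
    have Uw := swap_U rr' Uv v0.
    set s := tperm r r' in Uw *.
    have -> : (permG s * (v * root_elt r r' c))%g =
      (permG s * v * permG s * (permG s * root_elt r r' c))%g.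
      by rewrite !mulgA -[(_ * permG s * permG s)%g]mulgA -permGM tperm2 permG1 mulg1.
    rewrite galg_ofM -mulrA [galg_of (permG s * root_elt r r' c)]galg_ofM.
    have [->|c0] := eqVneq c 0.
      have -> : root_elt r r' 0 = 1%g.
        by apply: GL_inj => i j; rewrite root_eltE // mulr0 addr0 ent1 mxE.
      rewrite galg_of1 mulr1 eps_perm mulrA sgn_comm -mulrA -scal_sign.
      by apply: in_spanZ; apply: in_span_U.
    rewrite rank_one_rel // mulrBr mulrA -galg_ofM; apply: in_spanD.
      by apply: in_span_U; apply: (@groupM _ (U_group G)); rewrite ?root_in_U.
    by rewrite -mulN1r -scal1 -scalN; apply: in_spanZ; apply: in_span_U.
rewrite (galg_expand a) mulr_suml; apply: in_span_sum => g _.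
rewrite -mulrA; apply: in_spanZ.
have := KG g; rewrite inE => /asboolP/(_ 1%g (group1 (U_group G))).
by rewrite mulg1.
Qed.

End Steinberg.

(** * Whittaker vectors and the value of the form on them *)

Section Whittaker.
Variables (R : idomainType) (F : finFieldType) (N : nat) (G : linear_group F N).
Local Notation A := (galg R G).
Local Notation U := (pat G (@ltI N)).
Local Notation B := (borelG G).
Local Notation permG := (permG G).
Local Notation eps := (steinberg_gen R G).
Local Notation scal := (scal G).

Variable psi : F -> R.
Hypotheses (psiD : forall a b, psi (a + b) = psi a * psi b)
  (psi0 : psi 0 = 1) (psi_nontriv : exists a, psi a != 1).

Lemma psiNK a : psi (- a) * psi a = 1.
Proof. by rewrite -psiD addNr psi0. Qed.

(** The sum over the pattern group, twisted by the character of [c]. *)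
Definition whit (D : rel 'I_N.+1) (c : nat -> F) : A :=
  \sum_(u in pat G D) scal (psi (- chi c u)) * galg_of u.
Local Notation E := (whit (@ltI N)).

Lemma mul_whit D c g : strict D -> transitive D -> g \in pat G D ->
  galg_of g * whit D c = scal (psi (chi c g)) * whit D c.
Proof.
move=> sD tD Dg; have Ug := fintype.subsetP (pat_sub G sD) _ Dg.
rewrite /whit !mulr_sumr.
rewrite [RHS](reindex_inj (mulgI g)) /=.
apply: eq_big => u; first by rewrite (@groupMl _ (Group (pat_group_set G sD tD))).
move=> Du; have Uu := fintype.subsetP (pat_sub G sD) _ Du.
rewrite [LHS]mulrA [galg_of g * scal _]scalC -mulrA -galg_ofM [RHS]mulrA -scalM -psiD chiM //.
by rewrite opprD addrA subrr add0r.
Qed.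

Lemma whit_mul D c g : strict D -> transitive D -> g \in pat G D ->
  whit D c * galg_of g = scal (psi (chi c g)) * whit D c.
Proof.
move=> sD tD Dg; have Ug := fintype.subsetP (pat_sub G sD) _ Dg.
rewrite /whit mulr_suml mulr_sumr.
rewrite [RHS](reindex_inj (mulIg g)) /=.
apply: eq_big => u; first by rewrite (@groupMr _ (Group (pat_group_set G sD tD))).
move=> Du; have Uu := fintype.subsetP (pat_sub G sD) _ Du.
rewrite -mulrA -galg_ofM [RHS]mulrA -scalM -psiD chiM //.
by rewrite opprD addrCA subrr addr0.
Qed.

Definition eigen (c : nat -> F) (y : A) : Prop :=
  forall u, u \in U -> galg_of u * y = scal (psi (chi c u)) * y.

Definition whit_eps (c : nat -> F) : A := E c * eps.
Local Notation st := whit_eps.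

Lemma st_eigen c : eigen c (st c).
Proof. by move=> u Uu; rewrite /whit_eps mulrA mul_whit ?mulrA //; exact: ltI_trans. Qed.

Lemma whit_eigen c y : eigen c y -> E c * y = scal #|U|%:R * y.
Proof.
move=> ey; rewrite /whit mulr_suml (eq_bigr (fun => y)) => [|u Uu].
  by rewrite sumr_const mulrn_scal.
by rewrite -mulrA ey // mulrA -scalM psiNK scal1 mul1r.
Qed.

Lemma eigen_eval c y u g : eigen c y -> u \in U -> y (u * g)%g = psi (- chi c u) * y g.
Proof.
move=> ey Uu; rewrite -scal_mulE -chiV // -ey ?(@groupVr _ (U_group G)) //.
by rewrite galg_of_mulE invgK.
Qed.

Definition form (x y : A) : R := \sum_g x g * y g.

Lemma formC x y : form x y = form y x.
Proof. by apply: eq_bigr => g _; rewrite mulrC. Qed.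

Lemma formDr x y z : form x (y + z) = form x y + form x z.
Proof. by rewrite /form -big_split; apply: eq_bigr => g _; rewrite galgD mulrDr. Qed.

Lemma formZr r x y : form x (scal r * y) = r * form x y.
Proof. by rewrite /form mulr_sumr; apply: eq_bigr => g _; rewrite scal_mulE mulrCA. Qed.

Lemma formZl r x y : form (scal r * x) y = r * form x y.
Proof. by rewrite formC formZr formC. Qed.

Lemma form_sumr (I : Type) (s : seq I) (P : pred I) (f : I -> A) x :
  form x (\sum_(i <- s | P i) f i) = \sum_(i <- s | P i) form x (f i).
Proof.
elim/big_rec2: _ => [|i y z _ <-]; last by rewrite formDr.
by rewrite /form big1 // => g _; rewrite ffunE mulr0.
Qed.

Lemma form_suml (I : Type) (s : seq I) (P : pred I) (f : I -> A) x :
  form (\sum_(i <- s | P i) f i) x = \sum_(i <- s | P i) form (f i) x.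
Proof. by rewrite formC form_sumr; apply: eq_bigr => i _; rewrite formC. Qed.

Lemma form_of g x y : form (galg_of g * x) y = form x (galg_of g^-1 * y).
Proof.
rewrite /form (reindex_inj (mulgI g)); apply: eq_bigr => h _ /=.
by rewrite !galg_of_mulE mulKg invgK.
Qed.

(** Both sides of this multiplicity one statement are seen on the spanning
vectors u * eps: pairing with an eigenvector and projecting onto the opposite
eigenspace extract the same scalar psi (- chi c u). *)
Lemma whit_pairing c (a : A) : exists r,
  form (st c) (a * eps) = r * form (st c) eps /\
  E (fun j => - c j) * (a * eps) = scal r * st (fun j => - c j).
Proof.
have [f ->] := eps_span a.
exists (\sum_(u in U) f u * psi (- chi c u)); split.
  rewrite form_sumr mulr_suml; apply: eq_bigr => u Uu.
  have -> : galg_of u = galg_of u^-1^-1 :> A by rewrite invgK.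
  rewrite -mulrA formZr -form_of st_eigen ?(@groupVr _ (U_group G)) //.
  by rewrite formZl mulrA chiV.
rewrite mulr_sumr scal_sum mulr_suml; apply: eq_bigr => u Uu.
rewrite !mulrA scalC -[scal _ * _ * galg_of u]mulrA whit_mul //; last exact: ltI_trans.
by rewrite chiN scalM !mulrA.
Qed.

(** The projection maps the whole lattice onto the line of the Whittaker
vector. *)
Lemma whit_line c (a : A) : exists r, E c * (a * eps) = scal r * st c.
Proof.
have [r [_]] := whit_pairing (fun j => - c j) a; have -> : (fun j => - - c j) = c.
  by apply/funext => j; rewrite opprK.
by exists r.
Qed.

Lemma eigen_whit_line c (a : A) : (#|U|%:R : R) \is a GRing.unit -> eigen c (a * eps) ->
  exists r, a * eps = scal r * st c.
Proof.
move=> Uu /whit_eigen e; have [r] := whit_line c a; rewrite e => h.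
exists ((#|U|%:R)^-1 * r); rewrite scalM -mulrA -h mulrA -scalM mulVr //.
by rewrite scal1 mul1r.
Qed.

(** The part of U conjugated into B by s. *)
Definition noninv_pat (s : 'S_N.+1) : rel 'I_N.+1 := fun i j => (i < j)%N && (s i < s j)%N.

Lemma noninv_pat_strict s : strict (noninv_pat s). Proof. by move=> i j /andP[]. Qed.
Lemma noninv_pat_trans s : transitive (noninv_pat s).
Proof. by move=> j i k /andP[h1 h2] /andP[h3 h4];
  rewrite /noninv_pat (ltn_trans h1) // (ltn_trans h2). Qed.

(** Uniqueness of the permutation in the Bruhat decomposition.  A nonzero
diagonal entry of the conjugate bounds t^-1 by s^-1 pointwise, and both have
the same sum of values. *)
Lemma bruhat_unique (v : G) (s t : 'S_N.+1) : v \in U ->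
  (permG t^-1 * (v * permG s))%g \in B -> t = s.
Proof.
move=> /patP[_ v2] Bb; set b := (_ * _)%g in Bb.
have bE i j : ent b i j = ent v (t^-1 i)%g (s^-1 j)%g.
  by rewrite perm_mulE mul_permE.
have le i : (t^-1%g i <= s^-1%g i)%N.
  have := borel_diag i Bb; rewrite bE; apply: contraR; rewrite -ltnNge => lt.
  by rewrite v2 // /ltI -?leqNgt ?(ltnW lt) // -val_eqE gtn_eqF.
have e i : (t^-1 i)%g = (s^-1 i)%g.
  apply: val_inj => /=; apply/eqP; rewrite eqn_leq le /= leqNgt; apply/negP => lt.
  have : (\sum_j t^-1%g j < \sum_j s^-1%g j)%N.
    by rewrite (bigD1 i) //= [ltnRHS](bigD1 i) //= -addSn leq_add // leq_sum.
  rewrite -!(reindex_inj (@perm_inj _ (_ : 'S_N.+1)) (P := predT) (F := fun j => nat_of_ord j)).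
  by rewrite ltnn.
by apply: invg_inj; apply/permP.
Qed.

Lemma eps_perm_eval (v : G) (s : 'S_N.+1) : v \in U ->
  eps (v * permG s)%g = (-1) ^+ s * (v \in pat G (noninv_pat s))%:R.
Proof.
move=> Uv; rewrite epsE (bigD1 s) //= big1 ?addr0 => [|t ts]; last first.
  case: (boolP (_ \in B)) => [|_]; last by rewrite mulr0.
  by move/(bruhat_unique Uv) => e; rewrite e eqxx in ts.
congr (_ * (nat_of_bool _)%:R); case/patP: (Uv) => v1 v2.
have bE i j : ent (permG s^-1 * (v * permG s))%g i j = ent v (s^-1 i)%g (s^-1 j)%g.
  by rewrite perm_mulE mul_permE.
apply/borelP/patP => [H|[_ H] i j ji]; last first.
  rewrite bE; have [//|h] := eqVneq (s^-1 i)%g (s^-1 j)%g.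
    by move/perm_inj => e; rewrite e ltnn in ji.
  by apply: H => //; rewrite /noninv_pat !permKV [(i < j)%N]ltnNge (ltnW ji) andbF.
split=> // i j ij; rewrite /noninv_pat negb_and => /orP[/v2-> //|].
rewrite -leqNgt leq_eqVlt => /orP[/eqP/val_inj/perm_inj e|lt].
  by rewrite e eqxx in ij.
by have := H (s i) (s j) lt; rewrite bE !permK.
Qed.

Lemma eps_borel b g : b \in B -> eps (g * b)%g = eps g.
Proof.
move=> Bb; rewrite !epsE; apply: eq_bigr => s _; rewrite mulgA.
by rewrite (@groupMr _ (B_group G)).
Qed.

Lemma ideal_borel (a : A) b g : b \in B -> (a * eps) (g * b)%g = (a * eps) g.
Proof.
by move=> Bb; rewrite !galgM; apply: eq_bigr => h _; rewrite mulgA eps_borel.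
Qed.

Lemma st_perm c s :
  st c (permG s) = (-1) ^+ s * \sum_(u in pat G (noninv_pat s)) psi (- chi c u).
Proof.
rewrite /whit_eps mulr_suml galg_sum mulr_sumr.
rewrite (eq_bigr (fun u => (-1) ^+ s * (psi (- chi c u) * (u \in pat G (noninv_pat s))%:R)));
  last first.
  move=> u Uu; rewrite -mulrA scal_mulE galg_of_mulE eps_perm_eval ?(@groupVr _ (U_group G)) //.
  rewrite mulrCA; congr (_ * (_ * (nat_of_bool _)%:R)).
  by rewrite (@groupV _ (Group (pat_group_set G (@noninv_pat_strict s) (@noninv_pat_trans s)))).
rewrite (bigID (mem (pat G (noninv_pat s)))) /= addrC big1 ?add0r => [|u /andP[_ /negPf->]];
  last by rewrite !mulr0.
apply: eq_big => [u|u /andP[_ ->]]; last by rewrite mulr1.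
by case: (boolP (u \in pat G (noninv_pat s))) => h;
  rewrite ?andbF // (fintype.subsetP (pat_sub G (@noninv_pat_strict s))).
Qed.

(** Orthogonality: the character is nontrivial on the root subgroup of
(i, i + 1). *)
Lemma pat_char_sum0 (D : rel 'I_N.+1) (c : nat -> F) (i j : 'I_N.+1) :
  strict D -> transitive D ->
  j = i.+1 :> nat -> D i j -> c j != 0 -> \sum_(u in pat G D) psi (- chi c u) = 0.
Proof.
move=> sD tD ji Dij cj.
have [a0 a01] := psi_nontriv; set S := \sum_(_ in _) _.
pose x := root_elt G i j (- (c j)^-1 * a0).
have Dx : x \in pat G D.
  apply/patP; split=> [k|k m km Dkm]; rewrite root_eltE //.
    have [->|ki] := eqVneq k i; last by rewrite eqxx mul0r addr0.
    by rewrite eqxx -[i == j]val_eqE /= ji ltn_eqF // mul0r addr0.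
  rewrite (negPf km) add0r; case: andP => [[/eqP e1 /eqP e2]|_]; last by rewrite mul0r.
  by rewrite e1 e2 Dij in Dkm.
have chix : - chi c x = a0.
  rewrite /chi (bigD1 i) //= (bigD1 j) ?ji //= root_eltE // !eqxx mul1r.
  rewrite [i == j](_ : _ = false) ?add0r; last by rewrite -val_eqE /= ji ltn_eqF.
  rewrite -ji mulNr mulrN mulrA divff // mul1r big1 ?addr0 => [|k /andP[/eqP e1 e2]]; last first.
    by case/eqP: e2; apply: val_inj.
  rewrite big1 ?addr0 ?opprK // => k ki; rewrite big1 // => m /eqP mk.
  by rewrite root_eltE // (negPf ki) mul0r addr0 -val_eqE /= mk ltn_eqF // mulr0.
have Ux := fintype.subsetP (pat_sub G sD) _ Dx.
have : (psi a0 - 1) * S = 0.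
  rewrite mulrBl mul1r mulr_sumr [X in _ - X](reindex_inj (mulgI x)) /=.
  apply/eqP; rewrite subr_eq0; apply/eqP/eq_big => u.
    by rewrite (@groupMl _ (Group (pat_group_set G sD tD))).
  move=> Du; have Uu := fintype.subsetP (pat_sub G sD) _ Du.
  by rewrite chiM // opprD psiD chix.
by move/eqP; rewrite mulf_eq0 subr_eq0 (negPf a01) => /eqP.
Qed.

Lemma pat_char_sum1 (D : rel 'I_N.+1) (c : nat -> F) : strict D ->
  (forall i j : 'I_N.+1, j = i.+1 :> nat -> D i j -> c j = 0) ->
  \sum_(u in pat G D) psi (- chi c u) = #|pat G D|%:R.
Proof.
move=> sD Dc; rewrite (eq_bigr (fun => 1)) ?sumr_const // => u /patP[_ u2].
rewrite /chi big1 ?oppr0 // => i _; rewrite big1 // => j /eqP ji.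
have [Dij|nD] := boolP (D i j); first by rewrite (Dc i j) ?mul0r.
by rewrite u2 ?mulr0 // -val_eqE /= ji ltn_eqF.
Qed.

Definition w0 : 'S_N.+1 := perm (@rev_ord_inj N.+1).

Lemma w0_lt i j : (w0 i < w0 j)%N = (j < i)%N.
Proof. by rewrite !permE /=; have := ltn_ord i; have := ltn_ord j; lia. Qed.

(** The coefficient at the longest permutation is a unit; it is used to see
that a multiple of a Whittaker vector is nonzero modulo l. *)
Lemma st_w0 c : st c (permG w0) = (-1) ^+ w0.
Proof.
have k0 i j : noninv_pat w0 i j = false by rewrite /noninv_pat w0_lt; lia.
rewrite st_perm pat_char_sum1; [|exact: noninv_pat_strict|by move=> i j _; rewrite k0].
rewrite card_pat; last exact: noninv_pat_strict.
rewrite big1 ?expn0 ?mulr1 // => i _; rewrite big1 // => j _.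
by rewrite k0.
Qed.

(** Blocks are intervals, so it suffices to compare neighbours. *)
Lemma block_decreasing_chain b (s : 'S_N.+1) : {homo b : i j / (i <= j)%N} ->
  reflect (forall i j : 'I_N.+1, j = i.+1 :> nat -> joined b j -> (s j < s i)%N)
    (block_decreasing b s).
Proof.
move=> mono; apply: (iffP forallP) => [H i j ji /andP[_ bij]|H i].
  have /forallP/(_ j)/implyP := H i; apply; rewrite ji ltnSn /=.
  by move: bij; rewrite ji.
apply/forallP=> j; apply/implyP => /andP[ij /eqP bij].
have [k jE] : exists k, j = (i + k.+1)%N :> nat by exists (j - i.+1)%N; lia.
elim: k j jE {ij} bij => [|k IHk] j jE bij.
  apply: H; first by rewrite jE addn1.
  by rewrite /joined jE addn1 /= bij jE addn1.
have kN : (i + k.+1 < N.+1)%N by have := ltn_ord j; lia.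
have bk : b i = b (i + k.+1)%N.
  by apply/eqP; rewrite eqn_leq mono ?leq_addr //= bij mono // jE; lia.
have h1 := IHk (Ordinal kN) erefl bk.
apply: ltn_trans h1; apply: H; first by rewrite jE /= addnS.
by rewrite /joined jE addnS /= -bk bij jE addnS.
Qed.

(** [eps] is a signed sum of indicators of the cosets s B, and the elements
of the lattice are constant on them. *)
Lemma form_eps (a : A) :
  form (a * eps) eps = #|B|%:R * \sum_(s : 'S_N.+1) (-1) ^+ s * (a * eps) (permG s).
Proof.
have yB := @ideal_borel a; move: (a * eps) yB => y yB.
rewrite mulr_sumr /form; under eq_bigr => g _ do rewrite epsE mulr_sumr.
rewrite exchange_big; apply: eq_bigr => s _ /=.
rewrite (reindex_inj (mulgI (permG s))) /=.
under eq_bigr => g _ do rewrite mulgA -permGM mulVg permG1 mul1g mulrCA.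
rewrite -mulr_sumr mulrCA; congr (_ * _).
rewrite (bigID (mem B)) /= addrC big1 ?add0r => [|g /negPf->]; last by rewrite mulr0.
rewrite (eq_bigr (fun => y (permG s))) => [|g Bg]; last by rewrite Bg mulr1 yB.
by rewrite sumr_const mulr_natl.
Qed.

(** The coefficient at s is, up to sign, the sum of a character over the
pattern group of s.  It vanishes unless the character is trivial there, which
means that s decreases on all blocks; otherwise it is the order of this
group. *)
Lemma form_st_eps (b : nat -> nat) (c : nat -> F) : {homo b : i j / (i <= j)%N} ->
  (forall j, (0 < j < N.+1)%N -> (c j != 0) = joined b j) ->
  form (st c) eps = #|B|%:R * (decreasing_sum #|F| N.+1 b)%:R.
Proof.
move=> mono cJ.
rewrite form_eps; congr (_ * _).
rewrite /decreasing_sum natr_sum [RHS]big_mkcond /=; apply: eq_bigr => s _.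
rewrite -/(st c) st_perm signrMK.
case: ifP => [/(block_decreasing_chain _ mono) H|/negbT H].
  rewrite pat_char_sum1; [|exact: noninv_pat_strict|].
    by rewrite card_pat //; exact: noninv_pat_strict.
  move=> i j ji /andP[_ sij]; apply/eqP; apply: contraTT sij.
  have jN : (0 < j < N.+1)%N by rewrite ltn_ord ji.
  by rewrite cJ // => /(H _ _ ji); rewrite -leqNgt => /ltnW.
have [i [j [ji Jj sij]]] : exists i : 'I_N.+1, exists j : 'I_N.+1,
    [/\ j = i.+1 :> nat, joined b j & (s i < s j)%N].
  apply: contrapT => none; case/negP: H; apply/(block_decreasing_chain _ mono) => i j ji Jj.
  rewrite ltnNge leq_eqVlt; apply/negP => /orP[/eqP/val_inj/perm_inj e|lt].
    by have := ji; rewrite e; lia.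
  by apply: none; exists i, j.
rewrite (@pat_char_sum0 (noninv_pat s) c i j) //; first exact: noninv_pat_strict.
- exact: noninv_pat_trans.
- by rewrite /noninv_pat ji ltnSn.
- by rewrite cJ // ltn_ord ji.
Qed.

End Whittaker.

(** * Addition of two adjacent parts *)

(** The parts a and b occupy the positions o, ..., o + a + b - 1.  The
character [c'] of the merged composition is nonzero at the cut o + a, and [c]
differs from it only there. *)
Section Merge.
Variables (R : idomainType) (F : finFieldType) (N : nat) (G : linear_group F N).
Local Notation A := (galg R G).
Local Notation U := (pat G (@ltI N)).
Local Notation permG := (permG G).
Local Notation eps := (steinberg_gen R G).
Local Notation scal := (scal G).

Variable psi : F -> R.
Hypotheses (psiD : forall a b, psi (a + b) = psi a * psi b)
  (psi0 : psi 0 = 1) (psi_nontriv : exists a, psi a != 1).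
Hypothesis q_unit : (#|F|%:R : R) \is a GRing.unit.
Local Notation st := (whit_eps G psi).
Local Notation eigen := (eigen psi).

Lemma pat_unit D : strict D -> (#|pat G D|%:R : R) \is a GRing.unit.
Proof. by move=> sD; rewrite card_pat // natrX unitrX. Qed.

Variables (o a b : nat).
Hypotheses (a0 : (0 < a)%N) (b0 : (0 < b)%N) (mN : (o + a + b <= N.+1)%N).
Variables (c c' : nat -> F).
Hypotheses (c'1 : forall j, (o < j < o + a + b)%N -> c' j = 1)
  (cc' : forall j, (0 < j < N.+1)%N -> j != (o + a)%N -> c j = c' j)
  (cr : c (o + a)%N = 0)
  (c'o : (0 < o)%N -> c' o = 0)
  (c'm : (o + a + b < N.+1)%N -> c' (o + a + b)%N = 0).

(* tau moves the first part behind the second one. *)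
Let t (i : nat) : nat :=
  if (i < o)%N then i else if (i < o + a)%N then (i + b)%N
  else if (i < o + a + b)%N then (i - a)%N else i.

Let tcase i : [\/ (i < o)%N /\ t i = i, (o <= i < o + a)%N /\ t i = (i + b)%N,
  (o + a <= i < o + a + b)%N /\ t i = (i - a)%N | (o + a + b <= i)%N /\ t i = i].
Proof.
rewrite /t; case: (ltnP i o) => h1; first by apply: Or41.
case: (ltnP i (o + a)) => h2; first by apply: Or42.
by case: (ltnP i (o + a + b)) => h3; [apply: Or43 | apply: Or44].
Qed.

Let t_lt i : (i < N.+1)%N -> (t i < N.+1)%N.
Proof. by case: (tcase i) => -[? ->]; lia. Qed.

Let tI (i : 'I_N.+1) : 'I_N.+1 := Ordinal (t_lt (ltn_ord i)).

Let tI_inj : injective tI.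
Proof.
move=> i j /(congr1 val) /= e; apply: val_inj => /=; move: e.
by case: (tcase i) => -[? ->]; case: (tcase j) => -[? ->]; lia.
Qed.

Let tau := perm tI_inj.

Let tauE i : tau i = t i :> nat.
Proof. by rewrite permE. Qed.

Let t_mono i j : (i < j)%N -> (j < o + a)%N || (o + a <= i)%N -> (t i < t j)%N.
Proof. by case: (tcase i) => -[? ->]; case: (tcase j) => -[? ->]; lia. Qed.

Let t_chi i j : (i < j)%N -> (j < o + a)%N || (o + a <= i)%N -> (j < N.+1)%N ->
  (if t j == (t i).+1 then c' (t j) else 0) = (if j == i.+1 then c j else 0).
Proof.
move=> ij side jN.
have [[e1 e2]|[e1 e2]|[e1 e2]|[e1 e2]] :
  [\/ (t j == (t i).+1) = (j == i.+1) /\ t j = j,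
      (t j == (t i).+1) = (j == i.+1) /\
        (j = i.+1 -> (o < t j < o + a + b)%N /\ (o < j < o + a + b)%N /\ j <> (o + a)%N),
      (t j == (t i).+1) = false /\ (j = i.+1 -> j = o) |
      (t j == (t i).+1) = false /\ (j = i.+1 -> j = (o + a + b)%N)].
- by case: (tcase i) => -[h1 ->]; case: (tcase j) => -[h2 ->]; try (exfalso; lia);
  first [apply: Or41; lia | apply: Or42; lia | apply: Or43; lia | apply: Or44; lia].
- rewrite e1 e2; case: eqP => // ji; have [e|ne] := eqVneq j (o + a)%N.
    by rewrite e cr in e2 *; case: (tcase (o + a)%N); lia.
  by rewrite cc' // jN andbT; lia.
- rewrite e1; case: eqP => // /e2 [h1 [h2 /eqP h3]].
  by rewrite cc' ?c'1 //; lia.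
- rewrite e1; case: eqP => // ji; have e := e2 ji.
  by rewrite cc' ?e ?c'o //; lia.
- rewrite e1; case: eqP => // ji; have e := e2 ji.
  by rewrite cc' ?e ?c'm //; lia.
Qed.

(* The unipotent radical and the Levi part of U for the cut at o + a. *)
Let rad_pat : rel 'I_N.+1 := fun i j => (i < o + a <= j)%N.
Let lev_pat : rel 'I_N.+1 := fun i j => (i < j)%N && ((j < o + a)%N || (o + a <= i)%N).
Let V := pat G rad_pat.
Let K := pat G lev_pat.

Let rad_strict : strict rad_pat.
Proof. by move=> i j; rewrite /rad_pat; lia. Qed.
Let rad_trans : transitive rad_pat.
Proof. by move=> i j k; rewrite /rad_pat; lia. Qed.
Let lev_strict : strict lev_pat.
Proof. by move=> i j; rewrite /lev_pat; lia. Qed.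
Let lev_trans : transitive lev_pat.
Proof. by move=> i j k; rewrite /lev_pat; lia. Qed.
Let V_group := Group (pat_group_set G rad_strict rad_trans).
Let K_group := Group (pat_group_set G lev_strict lev_trans).
Let VU v : v \in V -> v \in U.
Proof. exact: (fintype.subsetP (pat_sub G rad_strict)). Qed.
Let KU v : v \in K -> v \in U.
Proof. exact: (fintype.subsetP (pat_sub G lev_strict)). Qed.

Let levi_factor u : u \in U -> exists2 k, k \in K & (u * k^-1)%g \in V.
Proof.
move=> /patP[u1 u2].
have u0 (i j : 'I_N.+1) : (j < i)%N -> ent u i j = 0.
  by move=> ji; apply: u2; rewrite ?/ltI -?leqNgt ?(ltnW ji) // -val_eqE gtn_eqF.
pose k := uni G (fun i j => if lev_pat i j then ent u i j else 0).
have kE i j : ent k i j = if i == j then 1 else if lev_pat i j then ent u i j else 0.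
  by rewrite uniE // => x y; case: ifP => [/lev_strict|_]; rewrite ?eqxx.
have Kk : k \in K.
  by apply/patP; split=> [i|i j ij /negPf nij]; rewrite kE ?eqxx // (negPf ij) nij.
have Kv : (k^-1)%g \in K by apply: (@groupVr _ K_group).
have /patP[w1 w2] := Kv; exists k => //.
have low (i j : 'I_N.+1) : (o + a <= i)%N -> ent u i j = ent k i j.
  move=> ri; rewrite kE; case: eqP => [<-|/eqP ij]; first by rewrite u1.
  rewrite /lev_pat ri orbT andbT; case: ltnP => // ji; apply: u0.
  by rewrite ltn_neqAle ji andbT eq_sym.
have left (i j : 'I_N.+1) : (j < o + a)%N -> ent u i j = ent k i j.
  move=> jr; rewrite kE; case: eqP => [<-|/eqP ij]; first by rewrite u1.
  rewrite /lev_pat jr andbT; case: ltnP => // ji; apply: u0.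
  by rewrite ltn_neqAle ji andbT eq_sym.
have lowE (i j : 'I_N.+1) : (o + a <= i)%N || (j < o + a)%N -> ent (u * k^-1)%g i j = (i == j)%:R.
  move=> side; have -> : (i == j)%:R = ent (k * k^-1)%g i j by rewrite mulgV ent1 mxE.
  rewrite !entM !mxE; apply: eq_bigr => m _; case/orP: side => h; first by rewrite low.
  have [mr|rm] := ltnP m (o + a); first by rewrite left.
  by rewrite w2 ?mulr0 //; rewrite /lev_pat -?val_eqE /=; lia.
apply/patP; split=> [i|i j ij]; last first.
  by rewrite /rad_pat => h; rewrite lowE ?(negPf ij) //; move: h; lia.
by rewrite lowE ?eqxx //; lia.
Qed.

Let K0 k (i x : 'I_N.+1) : k \in K ->
  ~~ ((i <= x)%N && ((x < o + a)%N || (o + a <= i)%N)) -> ent k i x = 0.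
Proof.
move=> /patP[_ k2] h; apply: k2; last by move: h; rewrite /lev_pat; lia.
by apply: contraNneq h => ->; lia.
Qed.

Let V_conj k v : k \in K -> v \in V -> (k * v * k^-1)%g \in V.
Proof.
move=> Kk /patP[v1 v2].
have Kv : (k^-1)%g \in K by apply: (@groupVr _ K_group).
pose X := ent v - 1%:M.
have X0 i j : ~~ rad_pat i j -> X i j = 0.
  move=> nD; rewrite !mxE; case: eqP => [<-|/eqP ij]; first by rewrite v1 subrr.
  by rewrite v2 // subr0.
have E : ent (k * v * k^-1)%g = 1%:M + ent k *m X *m ent k^-1%g.
  rewrite /X mulmxBr mulmxBl mulmx1 -!entM mulgV ent1.
  by rewrite addrCA subrr addr0.
have Y0 i j : ~~ rad_pat i j -> (ent k *m X *m ent k^-1%g) i j = 0.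
  move=> nD; rewrite mxE big1 // => m _; rewrite mxE mulr_suml big1 // => x _.
  have [Dxm|/X0->] := boolP (rad_pat x m); last by rewrite mulr0 mul0r.
  have [h1|/(K0 Kk)->] := boolP ((i <= x)%N && ((x < o + a)%N || (o + a <= i)%N));
    last by rewrite !mul0r.
  have [h2|/(K0 Kv)->] := boolP ((m <= j)%N && ((j < o + a)%N || (o + a <= m)%N));
    last by rewrite mulr0.
  by exfalso; move: nD Dxm h1 h2; rewrite /rad_pat; lia.
apply/patP; rewrite E; split=> [i|i j ij nD]; rewrite mxE Y0 ?addr0 ?mxE ?eqxx ?(negPf ij) //.
by rewrite /rad_pat; lia.
Qed.

Let chi_V v : v \in V -> chi c v = 0.
Proof.
move=> /patP[_ v2]; rewrite /chi big1 // => i _; rewrite big1 // => j /eqP ji.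
have [Dij|nD] := boolP (rad_pat i j); last by rewrite v2 ?mulr0 // -val_eqE /= ji ltn_eqF.
have -> : (j : nat) = (o + a)%N by move: Dij; rewrite /rad_pat; lia.
by rewrite cr mul0r.
Qed.

Let conj_tau u i j : ent (permG tau^-1 * u * permG tau)%g i j = ent u (tau^-1%g i) (tau^-1%g j).
Proof.
have -> : permG tau = permG (tau^-1)^-1 by rewrite invgK.
exact: permG_mulE.
Qed.

Let K_conj_U k : k \in K -> (permG tau^-1 * k * permG tau)%g \in U.
Proof.
move=> /patP[k1 k2]; apply/patP; split=> [i|i j ij nD]; rewrite conj_tau //.
apply: k2; first by rewrite (inj_eq perm_inj).
apply: contra nD => /andP[h1 h2]; have := t_mono h1 h2.
by rewrite -!tauE !permKV.
Qed.

Let K_conj_chi k : k \in K -> chi c' (permG tau^-1 * k * permG tau)%g = chi c k.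
Proof.
move=> /patP[k1 k2]; rewrite /chi (reindex_inj (@perm_inj _ tau)) /=; apply: eq_bigr => i _.
rewrite [RHS]big_mkcond [LHS]big_mkcond [LHS](reindex_inj (@perm_inj _ tau)) /=;
  apply: eq_bigr => j _.
rewrite conj_tau !permK !tauE.
have [->|ij] := eqVneq i j; first by rewrite !ltn_eqF.
have [/andP[lt side]|nD] := boolP (lev_pat i j); last first.
  by rewrite k2 // !mulr0 !if_same.
have := t_chi lt side (ltn_ord j).
by do 2![case: eqP => _] => [->|->|<-|_]; rewrite ?mul0r.
Qed.

Let y1 : A := whit G psi rad_pat (fun => 0) * galg_of (permG tau) * st c'.

Let y1_ideal : y1 = (whit G psi rad_pat (fun => 0) * galg_of (permG tau) * whit G psi (@ltI N)
  c') * eps.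
Proof. by rewrite /y1 /whit_eps !mulrA. Qed.

Let chi0 (g : G) : chi (fun => 0 : F) g = 0.
Proof. by rewrite /chi big1 // => i _; rewrite big1 // => j _; rewrite mul0r. Qed.

Let V_hat_conj k : k \in K ->
  galg_of k * whit G psi rad_pat (fun => 0) = whit G psi rad_pat (fun => 0) * galg_of k :> A.
Proof.
move=> Kk; rewrite /whit mulr_sumr mulr_suml.
rewrite [RHS](reindex_inj (@conjg_inj _ k^-1%g)) /=; apply: eq_big => v.
  apply/idP/idP => h; first by rewrite conjgE invgK mulgA; apply: V_conj.
  have -> : v = (k^-1 * (v ^ k^-1) * k^-1^-1)%g by rewrite conjgE !invgK !mulgA mulVg mul1g mulgKV.
  by apply: V_conj => //; apply: (@groupVr _ K_group).
move=> Vv; rewrite !chi0 oppr0 psi0 scal1 !mul1r -!galg_ofM conjgE invgK.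
by rewrite -!mulgA mulVg mulg1.
Qed.

Let y1_eigen : eigen c y1.
Proof.
move=> u Uu; have [k Kk Vv] := levi_factor Uu; set v := (u * _)%g in Vv.
have -> : u = (v * k)%g by rewrite mulgKV.
rewrite chiM ?(VU Vv) ?(KU Kk) // chi_V // add0r galg_ofM -mulrA.
have -> : galg_of k * y1 = scal (psi (chi c k)) * y1.
  rewrite /y1 !mulrA V_hat_conj // -!mulrA.
  have e : galg_of k * galg_of (permG tau) =
    galg_of (permG tau) * galg_of (permG tau^-1 * k * permG tau)%g :> A.
    by rewrite -!galg_ofM !mulgA -permGM mulgV permG1 mul1g.
  rewrite [galg_of k * _]mulrA e -[galg_of (permG tau) * _ * st c']mulrA.
  rewrite st_eigen ?K_conj_U // K_conj_chi //.
  by rewrite !mulrA [_ * scal _]scalC !mulrA.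
rewrite mulrA scalC -mulrA; congr (_ * _).
by rewrite /y1 !mulrA mul_whit // chi0 psi0 scal1 mul1r.
Qed.

Let tau_rad_chi (i j : 'I_N.+1) : rad_pat i j -> (t j = (t i).+1)%N -> c' (t j) = 0.
Proof.
move=> Dij ji; have : (t j = o /\ 0 < o)%N \/ (t j = o + a + b)%N.
  move: Dij ji; rewrite /rad_pat.
  by case: (tcase i) => -[? ->]; case: (tcase j) => -[? ->]; lia.
case=> [[e o0]|e]; rewrite e ?c'o //; apply: c'm.
by rewrite -e; apply: t_lt.
Qed.

Let st_conj v : v \in V ->
  st c' (permG tau^-1 * v * permG tau * permG (w0 N))%g = (-1) ^+ (w0 N).
Proof.
move=> /patP[v1 v2]; set z := (permG tau^-1 * v * permG tau)%g.
have zE i j : ent z i j = ent v (tau^-1%g i) (tau^-1%g j) by apply: conj_tau.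
have z1 i : ent z i i = 1 by rewrite zE.
have zz i j m : m != i -> m != j -> ent z i m * ent z m j = 0.
  move=> mi mj; rewrite !zE.
  have [D1|n1] := boolP (rad_pat (tau^-1%g i) (tau^-1%g m)); last first.
    by rewrite v2 ?mul0r // (inj_eq perm_inj) eq_sym.
  rewrite [X in _ * X]v2 ?mulr0 // ?(inj_eq perm_inj) //.
  by move: D1; rewrite /rad_pat; lia.
(* V is abelian and z - 1 has square zero, so z is the product of its upper and
lower triangular parts. *)
pose up := uni G (fun i j => if (i < j)%N then ent z i j else 0).
have upE i j : ent up i j = if i == j then 1 else if (i < j)%N then ent z i j else 0.
  by rewrite uniE // => x y; case: ifP; rewrite ?eqxx.
pose Lm := \matrix_(i, j) (if (j <= i)%N then ent z i j else 0) : 'M[F]_N.+1.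
have LmE i j : Lm i j = if (j <= i)%N then ent z i j else 0 by rewrite mxE.
have Lu : Lm \in unitmx.
  apply: lower_unit => [i j ij|i]; rewrite LmE ?leqnn ?z1 ?oner_neq0 //.
  by rewrite leqNgt ij.
have Ez : z = (up * matG G Lm)%g.
  apply: GL_inj => i j; rewrite entM mxE matGK // (bigD1 i) //= upE eqxx mul1r LmE.
  have rest : \sum_(m < N.+1 | m != i) ent up i m * Lm m j = if (i < j)%N then ent z i j else 0.
    have [->|ij] := eqVneq i j.
      rewrite ltnn big1 // => m mj; rewrite upE LmE eq_sym (negPf mj).
      case: ifP => _; rewrite ?mul0r //; case: ifP => _; rewrite ?mulr0 //.
      exact: zz.
    rewrite (bigD1 j) 1?eq_sym //= upE (negPf ij) LmE leqnn z1 mulr1 big1 ?addr0 //.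
    move=> m /andP[mi mj]; rewrite upE LmE eq_sym (negPf mi).
    case: ifP => _; rewrite ?mul0r //; case: ifP => _; rewrite ?mulr0 //.
    exact: zz.
  by rewrite rest; case: (ltnP i j) => h; rewrite ?addr0 ?add0r.
have Uup : up \in U.
  apply/patP; split=> [i|i j ij /negPf nij]; first by rewrite upE eqxx.
  by move: nij; rewrite /ltI upE (negPf ij) => ->.
rewrite Ez -mulgA (eigen_eval _ (st_eigen psiD c') Uup).
have -> : chi c' up = 0.
  rewrite /chi big1 // => i _; rewrite big1 // => j /eqP ji.
  rewrite upE -val_eqE /= ji ltn_eqF // ltnSn zE.
  have [Dij|nD] := boolP (rad_pat (tau^-1%g i) (tau^-1%g j)); last first.
    by rewrite v2 ?mulr0 // (inj_eq perm_inj) -val_eqE /= ji ltn_eqF.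
  have E k : t (tau^-1%g k) = k by rewrite -tauE permKV.
  by have := tau_rad_chi Dij; rewrite !E ji => -> //; rewrite mul0r.
rewrite oppr0 psi0 mul1r.
have -> : (matG G Lm * permG (w0 N) = permG (w0 N) * (permG (w0 N)^-1 * matG G Lm * permG (w0
  N)))%g.
  by rewrite !mulgA -permGM mulgV permG1 mul1g.
rewrite /whit_eps ideal_borel; first exact: st_w0.
have -> : permG (w0 N) = permG ((w0 N)^-1)^-1 by rewrite invgK.
apply/borelP=> i j ji; rewrite permG_mulE matGK // LmE leqNgt.
by rewrite -(w0_lt ((w0 N)^-1%g j)) !permKV ji.
Qed.

Let y1_eval : y1 (permG tau * permG (w0 N))%g = #|V|%:R * (-1) ^+ (w0 N).
Proof.
rewrite /y1 /whit -mulrA mulr_suml galg_sum (eq_bigr (fun =>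
  (-1) ^+ (w0 N))) ?sumr_const ?mulr_natl //.
move=> v Vv; rewrite chi0 oppr0 psi0 scal1 mul1r !galg_of_mulE.
rewrite -(st_conj (v := v^-1%g)) ?(@groupVr _ V_group) //; congr (st c' _).
by rewrite permGV !mulgA.
Qed.

(** A permutation tau exchanges the two parts.  Translating the Whittaker
vector of [c'] by tau and summing over the unipotent radical V of the maximal
parabolic which cuts at o + a gives an eigenvector for [c]: tau conjugates the
Levi part of U into U in a way compatible with the characters.  By
multiplicity one it is a multiple of the Whittaker vector of [c], and the
multiplier is a unit because the value at tau w0 is |V| up to sign. *)
Lemma merge_blocks : exists x : A, st c = x * st c'.
Proof.
have Uu : (#|U|%:R : R) \is a GRing.unit by apply: pat_unit; apply: ltI_strict.
have [r e] : exists r, y1 = scal r * st c.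
  rewrite y1_ideal; apply: (eigen_whit_line psiD psi0 Uu).
  by rewrite -y1_ideal; apply: y1_eigen.
have ru : r \is a GRing.unit.
  have := y1_eval; rewrite e scal_mulE => h.
  have : (#|V|%:R * (-1) ^+ w0 N : R) \is a GRing.unit.
    by rewrite unitrM pat_unit // unitrX // unitrN1.
  by rewrite -h unitrM => /andP[].
exists (scal r^-1 * (whit G psi rad_pat (fun => 0) * galg_of (permG tau))).
by rewrite -mulrA -/y1 e mulrA -scalM mulVr // scal1 mul1r.
Qed.
End Merge.

(** * Whittaker vectors separate left ideals *)

Section Separation.
Variables (R : idomainType) (F : finFieldType) (N : nat) (G : linear_group F N).
Local Notation A := (galg R G).
Local Notation U := (pat G (@ltI N)).
Local Notation permG := (permG G).
Local Notation scal := (scal G).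

Variable psi : F -> R.
Hypotheses (psiD : forall a b, psi (a + b) = psi a * psi b)
  (psi0 : psi 0 = 1) (psi_nontriv : exists a, psi a != 1).
Hypothesis q_unit : (#|F|%:R : R) \is a GRing.unit.
Local Notation eigen := (eigen psi).

(** Columns are treated from the right to the left: [from_col k] collects the
columns already treated, and [at_col k] is the abelian group of one column. *)
Definition from_col (k : nat) : rel 'I_N.+1 := fun i j => (i < j)%N && (k <= j)%N.
Definition at_col (k : nat) : rel 'I_N.+1 := fun i j => (i < j)%N && (j == k :> nat).

Lemma from_col_strict k : strict (from_col k). Proof. by move=> i j /andP[]. Qed.
Lemma at_col_strict k : strict (at_col k). Proof. by move=> i j /andP[]. Qed.
Lemma at_col_trans k : transitive (at_col k).
Proof. by move=> i j m; rewrite /at_col; lia. Qed.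

Definition at_col_group k := Group (pat_group_set G (@at_col_strict k) (@at_col_trans k)).

Lemma from_colP k (g : G) :
  reflect (g \in U /\ forall i j : 'I_N.+1, (j < k)%N -> ent g i j = (i == j)%:R)
    (g \in pat G (from_col k)).
Proof.
apply: (iffP idP) => [Dg|[/patP[g1 g2] Hg]].
  split; first exact: (fintype.subsetP (pat_sub G (@from_col_strict k))).
  move=> i j jk; case/patP: Dg => g1 g2; case: eqP => [->|/eqP ij]; first by rewrite g1.
  by rewrite g2 // /from_col [(k <= j)%N]leqNgt jk andbF.
apply/patP; split=> // i j ij; rewrite negb_and => /orP[h|h]; first exact: g2.
by rewrite Hg ?(negPf ij) // ltnNge.
Qed.

Lemma at_colP k (g : G) :
  reflect (forall i j : 'I_N.+1, (j != k :> nat) || (k <= i)%N -> ent g i j = (i == j)%:R)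
    (g \in pat G (at_col k)).
Proof.
apply: (iffP (patP _ _)) => [[g1 g2] i j h|H].
  case: eqP => [->|/eqP ij]; first by rewrite g1.
  by rewrite g2 // /at_col; move: ij h; rewrite -val_eqE /=; lia.
split=> [i|i j ij]; last by move=> h; rewrite H ?(negPf ij) //; move: ij h;
  rewrite /at_col -val_eqE /=; lia.
by rewrite H ?eqxx //; lia.
Qed.

(** GL_k in the upper left corner. It normalises the column groups from k
on and fixes their simple root coordinates after the column k. *)
Definition corner (k : nat) : {set G} :=
  [set g : G | [forall i : 'I_N.+1, forall j : 'I_N.+1,
     (k <= i)%N || (k <= j)%N ==> (ent g i j == (i == j)%:R)]].

Lemma cornerP k (g : G) :
  reflect (forall i j : 'I_N.+1, (k <= i)%N || (k <= j)%N -> ent g i j = (i == j)%:R)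
    (g \in corner k).
Proof.
rewrite inE; apply: (iffP forallP) => H i; last by apply/forallP=> j; apply/implyP=> h; rewrite H.
by move=> j h; have /forallP/(_ j)/implyP/(_ h)/eqP := H i.
Qed.

Lemma corner_group_set k : group_set (corner k).
Proof.
apply/group_setP; split; first by apply/cornerP => i j _; rewrite ent1 mxE.
move=> g h /cornerP Hg /cornerP Hh; apply/cornerP => i j ij.
have [ki|ik] := boolP (k <= i)%N.
  rewrite entM mxE (bigD1 i) //= Hg ?ki // eqxx mul1r Hh ?ki // big1 ?addr0 // => m mi.
  by rewrite Hg ?ki // eq_sym (negPf mi) mul0r.
rewrite (negPf ik) /= in ij.
rewrite entM mxE (bigD1 j) //= Hg ?ij ?orbT // Hh ?ij ?orbT // eqxx mulr1 big1 ?addr0 // => m mj.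
by rewrite Hh ?ij ?orbT // (negPf mj) mulr0.
Qed.
Definition corner_group k := Group (corner_group_set k).

Lemma cornerV k g : g \in corner k -> (g^-1)%g \in corner k.
Proof. exact: (@groupVr _ (corner_group k)). Qed.

Section Corner.
Variables (k : nat) (h : G).
Hypothesis hk : h \in corner k.
Let hP := cornerP _ _ hk.

Lemma corner_mul_row (g : G) (i j : 'I_N.+1) : (k <= i)%N -> ent (h * g)%g i j = ent g i j.
Proof.
move=> ki; rewrite entM mxE (bigD1 i) //= hP ?ki // eqxx mul1r big1 ?addr0 // => m mi.
by rewrite hP ?ki // eq_sym (negPf mi) mul0r.
Qed.

Lemma corner_mul_col (g : G) (i j : 'I_N.+1) : (k <= j)%N -> ent (g * h)%g i j = ent g i j.
Proof.
move=> kj; rewrite entM mxE (bigD1 j) //= hP ?kj ?orbT // eqxx mulr1 big1 ?addr0 // => m mj.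
by rewrite hP ?kj ?orbT // (negPf mj) mulr0.
Qed.
End Corner.

Lemma corner_conj_E k h (u : G) (i j : 'I_N.+1) : h \in corner k -> (k <= i)%N -> (k <= j)%N ->
  ent (h^-1 * u * h)%g i j = ent u i j.
Proof. by move=> hk ki kj; rewrite (corner_mul_col hk) // (corner_mul_row (cornerV hk)). Qed.

Lemma corner_conj_col k h (u : G) (j : 'I_N.+1) : h \in corner k ->
  (forall i m : 'I_N.+1, ent h m j != 0 -> ent u i m = (i == m)%:R) ->
  forall i, ent (h^-1 * u * h)%g i j = (i == j)%:R.
Proof.
move=> hk Hu i; have -> : (i == j)%:R = ent (h^-1 * h)%g i j by rewrite mulVg ent1 mxE.
rewrite -mulgA !entM !mxE; apply: eq_bigr => m _; congr (_ * _).
rewrite -entM entM mxE (bigD1 m) //= big1 ?addr0 => [|x xm].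
  have [->|h0] := eqVneq (ent h m j) 0; first by rewrite mulr0.
  by rewrite Hu // eqxx mul1r.
have [->|h0] := eqVneq (ent h x j) 0; first by rewrite mulr0.
by rewrite Hu // eq_sym (negPf xm) mul0r.
Qed.

Lemma from_col_conj k h u : h \in corner k -> u \in pat G (from_col k.+1) ->
  (h^-1 * u * h)%g \in pat G (from_col k.+1).
Proof.
move=> hk /from_colP[Uu Hu]; have hP := cornerP _ _ hk.
have Hcol (i j : 'I_N.+1) : (j < k.+1)%N -> ent (h^-1 * u * h)%g i j = (i == j)%:R.
  move=> jk; apply: (corner_conj_col hk) => x m hm; apply: Hu.
  rewrite ltnNge; apply: contra hm => km.
  by rewrite hP ?(ltnW km) // (_ : (m == j) = false) // -val_eqE /= gtn_eqF // (leq_trans jk).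
apply/from_colP; split=> //.
have /patP[u1 u2] := Uu.
apply/patP; split=> [i|i j ij nij].
  case: (ltnP i k.+1) => ik; first by rewrite Hcol ?eqxx.
  by rewrite (corner_conj_E _ hk) ?u1 // ltnW.
case: (ltnP j k.+1) => jk; first by rewrite Hcol // (negPf ij).
have ji : (j <= i)%N by rewrite leqNgt.
by rewrite (corner_conj_E _ hk) ?u2 // ltnW // (leq_trans jk).
Qed.

Lemma from_col_conj_chi k h u c : h \in corner k -> u \in pat G (from_col k.+1) ->
  chi c (h^-1 * u * h)%g = chi c u.
Proof.
move=> hk Du; have /from_colP[_ Hu] := Du; have /from_colP[_ Hw] := from_col_conj hk Du.
rewrite /chi; apply: eq_bigr => i _; apply: eq_bigr => j /eqP ji; congr (_ * _).
case: (ltnP j k.+1) => jk; first by rewrite Hu ?Hw.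
by rewrite (corner_conj_E _ hk) //; rewrite ji in jk; lia.
Qed.

Lemma at_col_conj k h g : h \in corner k -> g \in pat G (at_col k) ->
  (h^-1 * g * h)%g \in pat G (at_col k).
Proof.
move=> hk /at_colP Hg; have hP := cornerP _ _ hk; apply/at_colP => i j /orP[jk|ki].
  apply: (corner_conj_col hk) => x m hm; apply: Hg; apply/orP; left.
  apply: contra hm => /eqP mk; rewrite hP ?mk ?leqnn //.
  by rewrite (_ : (m == j) = false) // -val_eqE /= mk eq_sym (negPf jk).
have [jk|kj] := ltnP j k.
  apply: (corner_conj_col hk) => x m hm; apply: Hg; apply/orP; left.
  apply: contra hm => /eqP mk; rewrite hP ?mk ?leqnn //.
  by rewrite (_ : (m == j) = false) // -val_eqE /= mk gtn_eqF.
by rewrite (corner_conj_E _ hk) // Hg ?ki ?orbT.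
Qed.

(** The characters of the column group k, indexed by row vectors of which
only the first k entries matter. *)
Definition pair_col k (z : 'rV[F]_N.+1) (g : G) : F :=
  \sum_(i < N.+1 | (i < k)%N) \sum_(j < N.+1 | j == k :> nat) z 0 i * ent g i j.

Lemma pair_colM k z g h : g \in pat G (at_col k) -> h \in pat G (at_col k) ->
  pair_col k z (g * h)%g = pair_col k z g + pair_col k z h.
Proof.
move=> /at_colP Hg /at_colP Hh; rewrite /pair_col -big_split; apply: eq_bigr => i ik.
rewrite -big_split; apply: eq_bigr => j /eqP jk /=; rewrite -mulrDr; congr (_ * _).
have ij : i != j by rewrite -val_eqE /= jk ltn_eqF.
rewrite entM mxE (bigD1 i) //= (bigD1 j) 1?eq_sym //= Hg; last by rewrite ltn_eqF.
rewrite eqxx mul1r (Hh j j) ?jk ?leqnn ?orbT // eqxx mulr1 big1 ?addr0 1?addrC //.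
move=> m /andP[mi mj]; rewrite Hg; first by rewrite eq_sym (negPf mi) mul0r.
by rewrite -jk; move: mj; rewrite -val_eqE /= => ->.
Qed.

Lemma pair_colD k z z' g : pair_col k (z + z') g = pair_col k z g + pair_col k z' g.
Proof.
rewrite /pair_col -big_split; apply: eq_bigr => i _; rewrite -big_split.
by apply: eq_bigr => j _; rewrite mxE mulrDl.
Qed.

Lemma pair_colV k z g : g \in pat G (at_col k) -> pair_col k z g^-1%g = - pair_col k z g.
Proof.
move=> Dg; have Dv := @groupVr _ (at_col_group k) _ Dg.
have D1 := @group1 _ (at_col_group k).
have e1 : pair_col k z 1%g = 0.
  by apply: (addrI (pair_col k z 1%g)); rewrite addr0 -pair_colM ?mulg1.
by apply: (addrI (pair_col k z g)); rewrite -pair_colM // mulgV e1 subrr.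
Qed.

Definition col_proj k z : A :=
  \sum_(g in pat G (at_col k)) scal (psi (- pair_col k z g)) * galg_of g.

Lemma col_proj_eigen k z g : g \in pat G (at_col k) ->
  galg_of g * col_proj k z = scal (psi (pair_col k z g)) * col_proj k z.
Proof.
move=> Dg; rewrite /col_proj !mulr_sumr [RHS](reindex_inj (mulgI g)) /=.
apply: eq_big => u; first by rewrite (@groupMl _ (at_col_group k)).
move=> Du; rewrite [LHS]mulrA [galg_of g * scal _]scalC -mulrA -galg_ofM.
by rewrite [RHS]mulrA -scalM -psiD pair_colM // opprD addrA subrr add0r.
Qed.

(** The projections onto the characters of the column group add up to a
constant, a power of q; it is a unit, so some projection of a vector
outside a submodule remains outside. *)
Lemma col_proj_sum k : \sum_z col_proj k z = scal #|{: 'rV[F]_N.+1}|%:R.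
Proof.
rewrite /col_proj exchange_big /= (bigD1 1%g) /=; last exact: (@group1 _ (at_col_group k)).
rewrite (eq_bigr (fun => 1)) => [|z _]; last first.
  rewrite -{1}[1%g]invg1 pair_colV; last exact: (@group1 _ (at_col_group k)).
  rewrite opprK /pair_col big1 ?psi0 ?scal1 ?mul1r // => i ik; rewrite big1 // => j /eqP jk.
  by rewrite ent1 mxE (_ : (i == j) = false) ?mulr0 // -val_eqE /= jk ltn_eqF.
rewrite sumr_const mulrn_scal mulr1 cardT -cardE big1 ?addr0 // => g /andP[Dg g1].
rewrite -mulr_suml -scal_sum.
suff -> : \sum_z psi (- pair_col k z g) = 0 by rewrite scal0 mul0r.
have [i [j [ik jk gij]]] : exists i : 'I_N.+1, exists j : 'I_N.+1,
    [/\ (i < k)%N, j = k :> nat & ent g i j != 0].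
  apply: contrapT => none; case/eqP: g1; apply: GL_inj => i j; rewrite ent1 mxE.
  have /at_colP Hg := Dg; have [jk|jk] := eqVneq (j : nat) k; last by rewrite Hg ?jk.
  have [ki|ik] := leqP k i; first by rewrite Hg ?ki ?orbT.
  rewrite (_ : (i == j) = false); last by rewrite -val_eqE /= jk ltn_eqF.
  by apply/eqP; apply: contrapT => /negP gij; apply: none; exists i, j.
(* A shift by z0 multiplies the character sum by psi a0. *)
have [a0 a01] := psi_nontriv.
pose z0 : 'rV[F]_N.+1 := \row_m (if m == i then - (a0 / ent g i j) else 0).
have z0g : - pair_col k z0 g = a0.
  rewrite /pair_col (bigD1 i) //= (bigD1 j) ?jk //= big1 ?addr0 => [|m /andP[/eqP mk]]; last first.
    by move/eqP; case; apply: val_inj; rewrite /= mk jk.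
  rewrite big1 ?addr0 => [|m /andP[_ mi]]; last first.
    by rewrite big1 // => x _; rewrite mxE (negPf mi) mul0r.
  by rewrite mxE eqxx mulNr opprK divfK.
set S := \sum_z _; have : (psi a0 - 1) * S = 0.
  rewrite mulrBl mul1r mulr_sumr [X in _ - X](reindex_inj (addrI z0)) /=.
  apply/eqP; rewrite subr_eq0; apply/eqP/eq_bigr => z _.
  by rewrite pair_colD opprD psiD z0g.
by move/eqP; rewrite mulf_eq0 subr_eq0 (negPf a01) => /eqP.
Qed.

(** A nonzero row of length k is the last row of an invertible matrix. *)
Lemma complete_row k (kk : 'I_N.+1) (z : 'rV[F]_N.+1) (i0 : 'I_N.+1) :
  k = kk.+1 -> (i0 < k)%N -> z 0 i0 != 0 ->
  exists2 h, h \in corner k & forall j : 'I_N.+1, (j < k)%N -> ent h kk j = z 0 j.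
Proof.
move=> kE i0k zi0; pose s := tperm i0 kk.
pose M := \matrix_(i, j)
  (if i == kk then if (j < k)%N then z 0 (s j) else 0 else (i == j)%:R) : 'M[F]_N.+1.
have Mu : M \in unitmx.
  apply: lower_unit => [i j ij|i]; rewrite mxE.
    case: (i =P kk) => [e|_]; last by rewrite -val_eqE /= ltn_eqF.
    by rewrite kE ltnS leqNgt -e ij.
  case: (i =P kk) => [->|_]; last by rewrite eqxx oner_neq0.
  by rewrite kE ltnSn tpermR.
have sk (j : 'I_N.+1) : (k <= j)%N -> s j = j.
  by move=> kj; rewrite tpermD // -val_eqE /=; lia.
have sk' (j : 'I_N.+1) : (s j < k)%N = (j < k)%N.
  by rewrite /s; case: tpermP => [->|->|] //; rewrite ?kE; lia.
have sV : (s^-1)%g = s by rewrite /s tpermV.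
exists (matG G M * permG s)%g => [|j jk].
  apply/cornerP=> i j h; rewrite mul_permE sV matGK // mxE.
  have [ki|ik] := leqP k i.
    rewrite (_ : (i == kk) = false); last by rewrite -val_eqE /= kE in ki *; lia.
    by rewrite -(inj_eq (@perm_inj _ s)) tpermK sk.
  rewrite leqNgt ik /= in h; rewrite (sk j h) ltnNge h /=.
  by case: eqP => // ->; rewrite -val_eqE /= ltn_eqF //; lia.
by rewrite mul_permE sV matGK // mxE eqxx sk' jk tpermK.
Qed.

Definition col_eigen k (c : nat -> F) (y : A) : Prop :=
  forall u, u \in pat G (from_col k) -> galg_of u * y = scal (psi (chi c u)) * y.

Section Ideals.
Variables (P Q : A -> Prop).
Hypotheses (Pm : forall a x, P x -> P (a * x)) (Qm : forall a x, Q x -> Q (a * x))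
  (Q0 : Q 0) (Qd : forall x y, Q x -> Q y -> Q (x + y)).

(** Project onto a character of the column k.  If it is nontrivial, an element
of GL_k moves it to the character that reads off the last entry of the column,
the simple root coordinate.  The later columns keep their characters, since
this group fixes them. *)
Lemma sep_step k (c : nat -> F) y : (k < N.+1)%N -> P y -> ~ Q y ->
  col_eigen k.+1 c y ->
  exists (b : bool) y', [/\ P y', ~ Q y' & col_eigen k (fun j => if j == k then b%:R else c j) y'].
Proof.
move=> kN Py nQy ey; set kI := Ordinal kN.
have [z nQz] : exists z, ~ Q (col_proj k z * y).
  apply: contrapT => none; apply: nQy.
  have all z : Q (col_proj k z * y) by apply: contrapT => h; apply: none; exists z.
  have qu : (#|{: 'rV[F]_N.+1}|%:R : R) \is a GRing.unit by rewrite card_mx natrX unitrX.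
  have -> : y = scal (#|{: 'rV[F]_N.+1}|%:R)^-1 * \sum_z col_proj k z * y.
    by rewrite -mulr_suml col_proj_sum mulrA -scalM mulVr // scal1 mul1r.
  by apply: Qm; elim/big_ind: _.
set w := col_proj k z * y in nQz.
have Pw : P w by apply: Pm.
have at_sub g : g \in pat G (at_col k) -> g \in U by apply/fintype.subsetP/pat_sub/at_col_strict.
have fr_sub g : g \in pat G (from_col k.+1) -> g \in U by
  apply/fintype.subsetP/pat_sub/from_col_strict.
have w_at g : g \in pat G (at_col k) -> galg_of g * w = scal (psi (pair_col k z g)) * w.
  by move=> Dg; rewrite /w mulrA col_proj_eigen // mulrA.
have w_from u : u \in pat G (from_col k.+1) -> galg_of u * w = scal (psi (chi c u)) * w.
  move=> Du; rewrite /w /col_proj mulr_suml !mulr_sumr; apply: eq_bigr => g Dg.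
  have Ug := at_sub _ Dg; have Uu := fr_sub _ Du.
  have -> : galg_of u * (scal (psi (- pair_col k z g)) * galg_of g * y) =
    scal (psi (- pair_col k z g)) * (galg_of g * (galg_of (g^-1 * u * g)%g * y)).
    rewrite -!mulrA [LHS]mulrA [galg_of u * scal _]scalC -!mulrA; congr (_ * _).
    by rewrite !mulrA -!galg_ofM !mulgA mulgV mul1g.
  have Dc : (g^-1 * u * g)%g \in pat G (from_col k.+1).
    have Ugv := @groupVr _ (U_group G) _ Ug.
    have /from_colP[_ Hu] := Du.
    apply/from_colP; split; first by apply: (@groupM _ (U_group G)) => //;
      apply: (@groupM _ (U_group G)).
    move=> i j jk; have -> : (i == j)%:R = ent (g^-1 * g)%g i j by rewrite mulVg ent1 mxE.
    rewrite -mulgA !entM !mxE; apply: eq_bigr => m _; congr (_ * _).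
    have g0 (x : 'I_N.+1) : ent g x j != 0 -> (x < k.+1)%N.
      apply: contraR; rewrite -leqNgt => kx; case/patP: Ug => _ g2.
      by rewrite g2 // /ltI -?leqNgt -?val_eqE /=; lia.
    rewrite -entM entM mxE (bigD1 m) //= big1 ?addr0 => [|x xm].
      have [->|h0] := eqVneq (ent g m j) 0; first by rewrite mulr0.
      by rewrite Hu ?g0 // eqxx mul1r.
    have [->|h0] := eqVneq (ent g x j) 0; first by rewrite mulr0.
    by rewrite Hu ?g0 // eq_sym (negPf xm) mul0r.
  rewrite ey // chiM ?chiM ?(@groupVr _ (U_group G)) //; last first.
    by apply: (@groupM _ (U_group G)) => //; apply: (@groupVr _ (U_group G)).
  rewrite chiV // addrAC addNr add0r.
  by rewrite !mulrA [scal _ * galg_of g * scal _]scalC !mulrA.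
(* It remains to bring the row z into the form b * (0, ..., 0, 1). *)
have finish (b : bool) y' : P y' -> ~ Q y' ->
    (forall g, g \in pat G (at_col k) -> galg_of g * y' =
       scal (psi (\sum_(i < N.+1 | k == i.+1) b%:R * ent g i kI)) * y') ->
    (forall u, u \in pat G (from_col k.+1) -> galg_of u * y' = scal (psi (chi c u)) * y') ->
    exists (b : bool) y', [/\ P y', ~ Q y' & col_eigen k (fun j =>
      if j == k then b%:R else c j) y'].
  move=> Py' nQy' at_y' from_y'; exists b, y'; split=> // u Du.
  have /from_colP[Uu Hu] := Du; have /patP[u1 u2] := Uu.
  pose g := uni G (fun i j => if at_col k i j then ent u i j else 0).
  have gE i j : ent g i j = if i == j then 1 else if at_col k i j then ent u i j else 0.
    by rewrite uniE // => x x'; case: ifP => [/andP[]|]; rewrite ?eqxx.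
  have Dg : g \in pat G (at_col k).
    by apply/patP; split=> [i|i j ij /negPf nij]; rewrite gE ?eqxx // (negPf ij) nij.
  have Ug := at_sub _ Dg; have Ugv := @groupVr _ (U_group G) _ Ug.
  have col_gu (i j : 'I_N.+1) : (j < k.+1)%N -> ent u i j = ent g i j.
    move=> jk; rewrite gE; case: eqP => [->|/eqP ij]; first by rewrite u1.
    case: ifP => // /negbT; rewrite negb_and => /orP[h|h]; first by rewrite u2.
    by rewrite Hu ?(negPf ij) //; move: h jk; lia.
  have Dv : (g^-1 * u)%g \in pat G (from_col k.+1).
    apply/from_colP; split; first exact: (@groupM _ (U_group G)).
    move=> i j jk; have -> : (i == j)%:R = ent (g^-1 * g)%g i j by rewrite mulVg ent1 mxE.
    by rewrite !entM !mxE; apply: eq_bigr => m _; rewrite col_gu.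
  have -> : u = (g * (g^-1 * u))%g by rewrite mulKVg.
  move: (g^-1 * u)%g Dv => v Dv; have Uv := fr_sub _ Dv.
  rewrite galg_ofM -mulrA from_y' // mulrA scalC -mulrA at_y' // mulrA -scalM -psiD.
  congr (scal (psi _) * _); rewrite chiM // addrC; congr (_ + _).
    rewrite /chi [LHS]big_mkcond; apply: eq_bigr => i _.
    have [kE|nk] := eqVneq k i.+1.
      rewrite (bigD1 kI) /= ?kE // eqxx big1 ?addr0 // => j /andP[/eqP e1 e2].
      by case/eqP: e2; apply: val_inj; rewrite /= e1.
    rewrite big1 // => j /eqP ji; rewrite gE (_ : (i == j) = false);
      last by rewrite -val_eqE /= ji ltn_eqF.
    by rewrite /at_col (_ : (j == k :> nat) = false) ?andbF ?mulr0 // ji eq_sym (negPf nk).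
  rewrite /chi; apply: eq_bigr => i _; apply: eq_bigr => j /eqP ji.
  case: eqP => // jk; have /from_colP[_ Hv] := Dv.
  by rewrite !Hv ?jk // -val_eqE /= ji ltn_eqF // !mulr0.
have [[i0 i0k zi0]|none] := pselect (exists2 i0 : 'I_N.+1, (i0 < k)%N & z 0 i0 != 0); last first.
  apply: (finish false w) => // g Dg; rewrite w_at //; congr (scal (psi _) * _).
  rewrite [RHS]big1 => [|i _]; last by rewrite mul0r.
  rewrite /pair_col big1 // => i ik; rewrite big1 // => j _.
  have [->|zi] := eqVneq (z 0 i) 0; first by rewrite mul0r.
  by case: none; exists i.
have k0 : (0 < k)%N by lia.
have kkN : (k.-1 < N.+1)%N by lia.
have kE : k = (Ordinal kkN).+1 by rewrite /=; lia.
have [h hk hz] := complete_row kE i0k zi0.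
have hVh : galg_of h^-1 * galg_of h = 1 :> A by rewrite -galg_ofM mulVg.
have move_h g : galg_of g * (galg_of h * w) = galg_of h * (galg_of (h^-1 * g * h)%g * w).
  by rewrite !mulrA -!galg_ofM !mulgA mulgV mul1g.
apply: (finish true (galg_of h * w)) => [||g Dg|u Du].
- exact: Pm.
- by move=> Qh; apply: nQz; rewrite -[w]mul1r -hVh -mulrA; apply: Qm.
- rewrite move_h w_at ?at_col_conj // mulrA scalC -mulrA; congr (scal (psi _) * _).
  rewrite (bigD1 (Ordinal kkN)) /=; last by rewrite -kE.
  rewrite mul1r [X in _ = _ + X]big1 => [|i /andP[/eqP e1 e2]]; last first.
    by case/eqP: e2; apply: val_inj; rewrite /=; lia.
  rewrite addr0; set x := (h^-1 * g * h)%g.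
  have hx : (h * x = g * h)%g by rewrite /x !mulgA mulgV mul1g.
  have <- : ent (g * h)%g (Ordinal kkN) kI = ent g (Ordinal kkN) kI by rewrite (corner_mul_col
    hk) /=.
  rewrite -hx entM mxE /pair_col [RHS](bigID (fun i : 'I_N.+1 =>
    (i < k)%N)) /= [X in _ = _ + X]big1 ?addr0.
    apply: eq_bigr => i ik; rewrite (bigD1 kI) //= big1 ?addr0 ?hz // => j /andP[/eqP e1 e2].
    by case/eqP: e2; apply: val_inj.
  move=> i; rewrite -leqNgt => ki; have /cornerP -> := hk; last by rewrite ki orbT.
  by rewrite -val_eqE /= ltn_eqF ?mul0r //; lia.
- by rewrite move_h w_from ?from_col_conj // (from_col_conj_chi _ hk) // mulrA scalC -mulrA.
Qed.

Lemma submodule_separation x : P x -> ~ Q x ->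
  exists (J : nat -> bool) y, [/\ P y, ~ Q y & eigen (fun j => (J j)%:R) y].
Proof.
move=> Px nQx.
suff H k : (k <= N.+1)%N -> exists (J : nat -> bool) y,
    [/\ P y, ~ Q y & col_eigen (N.+1 - k) (fun j => (J j)%:R) y].
  have [J [y [Py nQy ey]]] := H N.+1 (leqnn _); exists J, y; split=> // u Uu.
  by apply: ey; rewrite subnn; apply/from_colP; split.
elim: k => [|k IHk] kN.
  exists (fun => false), x; split=> // u /from_colP[Uu Hu].
  have -> : u = 1%g by apply: GL_inj => i j; rewrite Hu ?subn0 ?ent1 ?mxE.
  by rewrite chi1 psi0 scal1 galg_of1.
have [J [y [Py nQy]]] := IHk (ltnW kN).
have -> : (N.+1 - k = (N.+1 - k.+1).+1)%N by lia.
move=> ey; have [|b [y' [Py' nQy' ey']]] := sep_step _ Py nQy ey; first by lia.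
exists (fun j => if j == (N.+1 - k.+1)%N then b else J j), y'; split=> //.
move=> u Du; rewrite ey' //; congr (scal (psi (chi _ u)) * _); apply/funext => j.
by case: ifP.
Qed.
End Ideals.
End Separation.

(** * Duality between Whittaker vectors *)

Section Symmetry.
Variables (R : idomainType) (F : finFieldType) (N : nat) (G : linear_group F N).
Local Notation A := (galg R G).
Local Notation U := (pat G (@ltI N)).
Local Notation B := (borelG G).
Local Notation eps := (steinberg_gen R G).
Local Notation scal := (scal G).

Variable psi : F -> R.
Hypotheses (psiD : forall a b, psi (a + b) = psi a * psi b)
  (psi0 : psi 0 = 1) (psi_nontriv : exists a, psi a != 1).
Local Notation st := (whit_eps G psi).
Local Notation E := (whit G psi (@ltI N)).

Variable l : nat.
Hypotheses (l_prime : prime l) (char0 : [pchar R] =i pred0)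
  (unitP : forall x : R, (forall y, x <> y *+ l) -> x \is a GRing.unit)
  (lnon : forall y : R, 1 <> y *+ l).
Hypothesis q_coprime : coprime l #|F|.

Lemma natr_neq0 m : (0 < m)%N -> (m%:R : R) != 0.
Proof. by move=> m0; have /pcharf0P -> := char0; rewrite -lt0n. Qed.

(** By Bezout, m is invertible modulo l. *)
Lemma coprime_unit m : coprime l m -> (m%:R : R) \is a GRing.unit.
Proof.
move=> lm; apply: unitP => y e; have m0 : (0 < m)%N.
  by case: m lm {e} => //; rewrite /coprime gcdn0 => /eqP l1; move: l_prime; rewrite l1.
case: (egcdnP l m0) => a b; rewrite gcdnC (eqP lm) => h _.
apply: (@lnon (a%:R * y - b%:R)).
rewrite mulrnBl -mulrnAr -e -[b%:R *+ l]mulr_natr -!natrM h natrD.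
by rewrite addrAC subrr add0r.
Qed.

Lemma not_mul_unit (x r : R) : x \is a GRing.unit -> x - r *+ l \is a GRing.unit.
Proof.
move=> ux; apply: unitP => y e; apply: (@lnon (x^-1 * (y + r))).
by rewrite -mulrnAr mulrnDl -e subrK mulVr.
Qed.

Lemma unit_not_mul (x r : R) : x \is a GRing.unit -> x <> r *+ l.
Proof. by move=> ux e; apply: (@lnon (x^-1 * r)); rewrite -mulrnAr -e mulVr. Qed.

Lemma q_unit : (#|F|%:R : R) \is a GRing.unit.
Proof. exact: coprime_unit. Qed.

Lemma U_unit : (#|U|%:R : R) \is a GRing.unit.
Proof. by apply: pat_unit; [exact: q_unit | exact: ltI_strict]. Qed.

Lemma B_neq0 : (#|B|%:R : R) != 0.
Proof. by apply: natr_neq0; apply: (@cardG_gt0 _ (B_group G)). Qed.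

(** The anti-involution g |-> g^-1 is the adjunction for the form. *)
Definition star (x : A) : A := \sum_g scal (x g) * galg_of g^-1%g.

Lemma form_star x y z : form (x * y) z = form y (star x * z).
Proof.
rewrite {1}(galg_expand x) mulr_suml form_suml /star mulr_suml form_sumr.
by apply: eq_bigr => g _; rewrite -!mulrA formZl formZr form_of.
Qed.

Lemma star_whit c : star (E c) = E (fun j => - c j).
Proof.
have EE g : E c g = if g \in U then psi (- chi c g) else 0.
  rewrite /whit galg_sum; case: ifP => Ug.
    rewrite (bigD1 g) //= scal_mulE galg_ofE eqxx mulr1 big1 ?addr0 // => u /andP[_ ug].
    by rewrite scal_mulE galg_ofE eq_sym (negPf ug) mulr0.
  rewrite big1 // => u Uu; rewrite scal_mulE galg_ofE.
  by case: eqP => [e|]; rewrite ?mulr0 //; rewrite e Uu in Ug.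
rewrite /star (reindex_inj invg_inj) /= [RHS]/whit [RHS]big_mkcond.
apply: eq_bigr => g _ /=; rewrite EE invgK (@groupV _ (U_group G)).
case: ifP => Ug; last by rewrite scal0 mul0r.
by rewrite chiV // chiN opprK.
Qed.

Let d : G := diagG G (fun i => (-1) ^+ i).
Let dE i j : ent d i j = if i == j then (-1) ^+ i else 0.
Proof. by apply: diagGE => k; rewrite expf_neq0 // oppr_eq0 oner_neq0. Qed.
Let dT : d \in torus G.
Proof. by apply/torusP => i j /negPf ij; rewrite dE ij. Qed.

(** Conjugation by the diagonal matrix of alternating signs inverts every
simple root coordinate and fixes [eps]. *)
Lemma sign_conj c : galg_of d * st c = st (fun j => - c j).
Proof.
have dVe : galg_of d^-1 * eps = eps.
  by rewrite -{1}(eps_torus R dT) mulrA -galg_ofM mulVg galg_of1 mul1r.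
rewrite /whit_eps mulrA -{1}dVe mulrA; congr (_ * _).
rewrite /whit mulr_sumr mulr_suml.
rewrite [RHS](reindex_inj (@conjg_inj _ d^-1%g)) /=; apply: eq_big => u.
  apply/idP/idP => h; first by rewrite conjgE invgK mulgA torus_conj_U.
  have -> : u = (d^-1 * (u ^ d^-1) * d^-1^-1)%g by rewrite conjgE !invgK !mulgA mulVg mul1g mulgKV.
  apply: torus_conj_U => //; apply/torusP => i j ij.
  have : ent (d * d^-1)%g i j = 0 by rewrite mulgV ent1 mxE (negPf ij).
  by rewrite torus_mulE // dE eqxx => /eqP; rewrite mulf_eq0 expf_eq0 oppr_eq0 oner_eq0 andbF =>
    /eqP.
move=> Uu; rewrite conjgE invgK.
have -> : chi (fun j => - c j) (d * (u * d^-1))%g = chi c u.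
  rewrite chiN mulgA -sumrN; apply: eq_bigr => i _; rewrite -sumrN.
  apply: eq_bigr => j /eqP ji; rewrite torus_conj // !dE !eqxx ji exprS mulN1r.
  by rewrite invrN mulrN mulrN opprK mulrAC divff ?mul1r // expf_neq0 // oppr_eq0 oner_neq0.
by rewrite [galg_of d * _]mulrA scalC -!mulrA -!galg_ofM mulgA.
Qed.

Lemma scalMn (r : R) m : scal (r *+ m) = scal r *+ m.
Proof. by elim: m => [|m IHm]; rewrite ?mulr0n ?scal0 // !mulrS scalD IHm. Qed.

(** Apply E c to the hypothesis: a unit x times st c is E c * a * st c2.
Pairing with eps and moving E c * a to the other side shows that
star a * E (- c) * eps has component r2 on the line of st (- c2), where
x * n1 = r2 * n2.  Equal valuations make r2 a unit, so st (- c2) lies in the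
left ideal of st (- c); the signs are undone by [sign_conj]. *)
Lemma whit_symmetry (c c2 : nat -> F) (n1 n2 : nat) (a b : A) : (0 < n1)%N -> (0 < n2)%N ->
  logn l n1 = logn l n2 ->
  form (st c) eps = #|B|%:R * n1%:R -> form (st c2) eps = #|B|%:R * n2%:R ->
  st c = a * st c2 + (b * eps) *+ l -> exists a', st c2 = a' * st c.
Proof.
move=> n1_0 n2_0 v12 f1 f2 e.
have [r Er] := whit_line psiD c b.
have e1 : scal (#|U|%:R - r *+ l) * st c = E c * (a * st c2).
  rewrite scalD scalN mulrBl -(whit_eigen psiD psi0 (st_eigen psiD c)) {1}e mulrDr.
  by rewrite mulrnAr Er scalMn mulrnAl addrK.
have u1 := not_mul_unit r U_unit; set x := _ - _ in u1 e1.
have [r2 [g1 g2]] := whit_pairing psiD c2 (star a * E (fun j => - c j)).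
have e2 : x * n1%:R = r2 * n2%:R.
  apply: (mulfI B_neq0); rewrite ![#|B|%:R * (_ * _)]mulrCA -f1 -f2 -g1 -mulrA.
  by rewrite -form_star -star_whit -form_star -e1 formZl.
have [m1 c1 E1] := pfactor_coprime l_prime n1_0.
have [m2 c3 E2] := pfactor_coprime l_prime n2_0.
have {}e2 : x * m1%:R = r2 * m2%:R.
  have lv : ((l ^ logn l n2)%:R : R) != 0 by rewrite natr_neq0 // expn_gt0 prime_gt0.
  by apply: (mulIf lv); rewrite -!mulrA -!natrM -E2 -v12 -E1.
have ur : r2 \is a GRing.unit.
  have : x * m1%:R \is a GRing.unit by rewrite unitrM u1 coprime_unit.
  by rewrite e2 unitrM => /andP[].
exists (galg_of d^-1 * scal r2^-1 * E (fun j => - c2 j) * star a * galg_of d).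
rewrite -!mulrA sign_conj; move: g2; rewrite -mulrA => ->.
rewrite [scal r2^-1 * _]mulrA -scalM mulVr // scal1 mul1r -sign_conj mulrA.
by rewrite -galg_ofM mulVg galg_of1 mul1r.
Qed.

Definition in_filt (k : nat) (x : A) : Prop :=
  forall b, exists r, form x (b * eps) = #|B|%:R * (l%:R ^+ k * r).

Lemma in_filt_mul k a x : in_filt k x -> in_filt k (a * x).
Proof. by move=> H b; rewrite form_star mulrA; apply: H. Qed.

(** The pairing of st c with the lattice has the image R * |B| n1.  If st c is
congruent to an element of I(k) modulo l, apply E c to both: a unit multiple
of st c itself lies in I(k). *)
Lemma in_filt_whit k (c : nat -> F) (n1 : nat) : (0 < n1)%N ->
  form (st c) eps = #|B|%:R * n1%:R ->
  (exists a b, in_filt k (a * eps) /\ st c = a * eps + (b * eps) *+ l) <-> (k <= logn l n1)%N.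
Proof.
move=> n1_0 f1; have [m1 c1 E1] := pfactor_coprime l_prime n1_0; split; last first.
  move=> kn; exists (E c), 0; split; last by rewrite mul0r mul0rn addr0.
  move=> b; have [r [-> _]] := whit_pairing psiD c b.
  exists (r * (m1 * l ^ (logn l n1 - k))%:R); rewrite f1 mulrCA; congr (_ * _).
  by rewrite mulrCA -natrX -natrM {1}E1 mulnCA -expnD subnKC.
move=> [a [b [H e]]].
have [r Er] := whit_line psiD c b; have [s Es] := whit_line psiD c a.
have us : s \is a GRing.unit.
  have : s = #|U|%:R - r *+ l.
    have : scal s * st c = scal (#|U|%:R - r *+ l) * st c.
      rewrite -Es scalD scalN mulrBl -(whit_eigen psiD psi0 (st_eigen psiD c)) {1}e mulrDr.
      by rewrite mulrnAr Er scalMn mulrnAl addrK.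
    move/(congr1 (fun y : A => y (permG G (w0 N)))); rewrite !scal_mulE (st_w0 G psi0).
    by apply: mulIf; rewrite expf_neq0 // oppr_eq0 oner_neq0.
  by move=> ->; apply: not_mul_unit U_unit.
have [t] := in_filt_mul (E c) H 1; rewrite mul1r Es formZl f1 mulrCA => /(mulfI B_neq0) h.
rewrite leqNgt; apply/negP => lt.
have h2 : s * m1%:R = (l%:R ^+ (k - logn l n1).-1 * t) *+ l.
  have lv : ((l ^ logn l n1)%:R : R) != 0 by rewrite natr_neq0 // expn_gt0 prime_gt0.
  apply: (mulIf lv); rewrite -mulrA -natrM -E1 h natrX -[(_ * t) *+ l]mulr_natr.
  have {1}-> : k = ((k - logn l n1).-1 + 1 + logn l n1)%N by lia.
  by rewrite !exprD expr1 -!mulrA; congr (_ * _); rewrite mulrA mulrC.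
by apply: (unit_not_mul _ h2); rewrite unitrM us coprime_unit.
Qed.
End Symmetry.

(** * Filtrations that are radical series *)

Section Submodules.
Local Open Scope classical_set_scope.
Local Open Scope ring_scope.
Variables (A : pzRingType) (V : lmodType A).
Implicit Types (M N : set V) (u w : V).

Lemma submod0 M : submodule M -> M 0.
Proof. by case. Qed.

Lemma submodD M u w : submodule M -> M u -> M w -> M (u + w).
Proof. by move=> [_ H] Mu Mw; rewrite -[u]scale1r; apply: H. Qed.

Lemma submodZ M a u : submodule M -> M u -> M (a *: u).
Proof. by move=> [M0 H] Mu; rewrite -[_ *: _]addr0; apply: H. Qed.

Lemma submod_cyclic u : submodule [set a *: u | a in setT].
Proof.
split; first by exists 0; rewrite ?scale0r.
by move=> a _ _ [b _ <-] [c _ <-]; exists (a * b + c); rewrite // scalerDl scalerA.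
Qed.

Lemma submod_sum M N : submodule M -> submodule N -> submodule [set x + y | x in M & y in N].
Proof.
move=> SM SN; split.
  by exists 0; [exact: submod0 | exists 0; [exact: submod0 | rewrite addr0]].
move=> a _ _ [u Mu [w Nw <-]] [u' Mu' [w' Nw' <-]].
exists (a *: u + u'); first by case: SM => _; apply.
exists (a *: w + w'); first by case: SN => _; apply.
by rewrite scalerDr addrACA.
Qed.

Lemma submod_radical M : submodule M -> submodule (radical M).
Proof.
move=> SM; split; first by split; [exact: submod0 | move=> K [SK _ _]; exact: submod0].
move=> a u w [Mu Ru] [Mw Rw]; split; first by case: SM => _; apply.
by move=> K HK; have [SK _ _] := HK; case: (SK) => _; apply; [apply: Ru | apply: Rw].
Qed.
End Submodules.

(** The vectors [b x] are abstract Whittaker vectors, with valuations [v x];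
the hypotheses are the facts which force a filtration to be the radical
series. *)
Section RadicalSeries.
Local Open Scope classical_set_scope.
Local Open Scope ring_scope.
Variables (A : pzRingType) (V : lmodType A) (X : Type) (b : X -> V) (v : X -> nat).
Variable Fil : nat -> set V.
Hypotheses (FilS : forall k, submodule (Fil k)) (Fil0 : Fil 0%N = setT)
  (Fil_le : forall k, Fil k.+1 `<=` Fil k)
  (Fil_b : forall k x, Fil k (b x) <-> (k <= v x)%N)
  (sep : forall N M : set V, submodule N -> submodule M ->
     (forall x, N (b x) -> M (b x)) -> N `<=` M)
  (prime_b : forall (N M : set V) x y1 y2, submodule N -> submodule M ->
     N y1 -> M y2 -> b x = y1 + y2 -> N (b x) \/ M (b x))
  (sym : forall x y, v x = v y -> (exists a, b x = a *: b y) -> exists a, b y = a *: b x)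
  (climb_b : forall x, (0 < v x)%N -> exists2 y, v x = (v y).+1 & exists a, b x = a *: b y).

Lemma generated_val x y a : b x = a *: b y -> (v y <= v x)%N.
Proof. by move=> e; apply/Fil_b; rewrite e; apply: submodZ => //; apply/Fil_b. Qed.

(** Below each [b x] in the filtration there is one of every smaller
valuation that generates it. *)
Lemma climb_to k x : (k <= v x)%N -> exists2 y, v y = k & exists a, b x = a *: b y.
Proof.
move: {2}(v x - k)%N (erefl (v x - k)%N) => m; elim: m x => [|m IHm] x mE kx.
  by exists x; [lia | exists 1; rewrite scale1r].
have [|y e1 [a e2]] := climb_b (x := x); first by lia.
have [||z e3 [a' e4]] := IHm y; try lia.
by exists z => //; exists (a * a'); rewrite e2 e4 scalerA.
Qed.

(** For v x = k, the y in Fil k that do not generate [b x] form a maximal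
submodule, which does not contain [b x]; for the converse inclusion, a maximal
submodule M without some [b x] of Fil (k + 1) would satisfy
M + Fil (k + 1) = Fil k, and [prime_b] excludes it. *)
Lemma radical_Fil k : radical (Fil k) = Fil k.+1.
Proof.
apply/seteqP; split.
  apply: sep => //; first exact: submod_radical.
  move=> x [Fx Rx]; apply/Fil_b; rewrite ltnNge; apply/negP => vx.
  have {vx Fx}vx : v x = k by apply/eqP; rewrite eqn_leq vx; apply/Fil_b.
  pose M := [set y | Fil k y /\ ~ exists a, b x = a *: y].
  have b0 a : b x <> a *: 0.
    rewrite scaler0 => e; have : Fil (v x).+1 (b x) by rewrite e; apply: submod0.
    by move/Fil_b; rewrite ltnn.
  have SM : submodule M.
    split; first by split; [exact: submod0 | case=> a /b0].
    move=> a u w [Fu nu] [Fw nw]; split; first by case: (FilS k) => _; apply.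
    case=> c; rewrite scalerDr scalerA => e.
    have [] := prime_b (submod_cyclic u) (submod_cyclic w) _ _ e.
    - by exists (c * a).
    - by exists c.
    - by case=> a' _ e'; apply: nu; exists a'.
    - by case=> a' _ e'; apply: nw; exists a'.
  have Mmax : maximal_submodule_of (Fil k) M.
    split=> // [|M' SM' MM' M'F].
      split; first by move=> y [].
      move=> H; have [|_] := H (b x); first by apply/Fil_b; rewrite vx.
      by apply; exists 1; rewrite scale1r.
    have [M'M|/existsNP[y /not_implyP[M'y nMy]]] := pselect (M' `<=` M).
      by left; apply/seteqP; split.
    right; apply/seteqP; split=> //; apply: sep => // z Fz.
    have [Mz|nMz] := pselect (M (b z)); first exact: MM'.
    have [a e] : exists a, b x = a *: y.
      by apply: contrapT => h; apply: nMy; split=> //; apply: M'F.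
    have [a' e'] : exists a, b x = a *: b z.
      by apply: contrapT => h; apply: nMz; split.
    have vz : v x = v z.
      by apply/eqP; rewrite eqn_leq (generated_val e') andbT vx; apply/Fil_b.
    have [a'' ->] := sym vz (ex_intro _ a' e').
    by rewrite e; apply: submodZ => //; apply: submodZ.
  by have [_] := Rx M Mmax; apply; exists 1; rewrite scale1r.
move=> y Fy; split; first exact: Fil_le.
move=> M [SM MF Mmax]; move: y Fy; apply: sep => // x Fx.
apply: contrapT => nMx.
(* z has valuation k and generates b x. *)
have [|z vz [a e]] := @climb_to k x; first by apply/Fil_b; apply: Fil_le.
have S : submodule [set x + y | x in M & y in Fil k.+1] by apply: submod_sum.
have [| |E|E] := Mmax _ S.
- by move=> u Mu; exists u => //; exists 0; [exact: submod0 | rewrite addr0].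
- move=> _ [u Mu [w Fw <-]]; apply: submodD => //; first by case: MF => MF _; apply: MF.
  exact: Fil_le.
- apply: nMx; rewrite -E; exists 0; first exact: submod0.
  by exists (b x); rewrite ?add0r.
- have : Fil k (b z) by apply/Fil_b; rewrite vz.
  rewrite -E => -[u Mu [w Fw e']].
  have [Mz|/Fil_b] := prime_b SM (FilS k.+1) Mu Fw (esym e'); last by rewrite vz ltnn.
  by apply: nMx; rewrite e; apply: submodZ.
Qed.

Lemma radical_seriesE i : radical_series V i = Fil i.
Proof.
elim: i => [|i IHi]; first by rewrite Fil0.
by rewrite /radical_series iterS -/(radical_series V i) IHi radical_Fil.
Qed.

(** A repetition occurs only where no valuation reaches k, and then the
filtration vanishes by separation from 0. *)
Lemma Fil_new k : Fil k.+1 <> Fil k \/ (forall j, (k <= j)%N -> Fil j = [set 0]).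
Proof.
have [[x kx]|none] := pselect (exists x, (k <= v x)%N).
  left => E; have [z vz _] := climb_to kx.
  have : Fil k (b z) by apply/Fil_b; rewrite vz.
  by rewrite -E => /Fil_b; rewrite vz ltnn.
right=> j kj; apply/seteqP; split; last by move=> _ ->; apply: submod0.
have S0 : submodule [set (0 : V)] by split=> // a _ _ -> ->; rewrite scaler0 addr0.
apply: sep => // x /Fil_b jx; case: none; exists x; exact: leq_trans jx.
Qed.

Lemma next_newE k : next_new Fil k = k.+1 \/
  (next_new Fil k = k /\ forall j, (k <= j)%N -> Fil j = [set 0]).
Proof.
rewrite /next_new; case: pselect => [h|none].
  case: ex_minnP => m /andP[km /asboolP ne] mmin; left; apply/eqP; rewrite eqn_leq km andbT.
  have [new|all0] := Fil_new k; first by apply: mmin; rewrite ltnSn; apply/asboolP.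
  by case: ne; rewrite !all0 // ltnW.
right; split=> //; have [new|//] := Fil_new k.
by case: none; exists k.+1; rewrite ltnSn; apply/asboolP.
Qed.

Lemma remove_repetitionsE i : remove_repetitions Fil i = Fil i.
Proof.
rewrite /remove_repetitions.
have : iter i (next_new Fil) 0%N = i \/
    exists2 k, iter i (next_new Fil) 0%N = k & (k <= i)%N /\ forall j,
      (k <= j)%N -> Fil j = [set 0].
  elim: i => [|i [e|[k e [ki H]]]]; first by left.
    rewrite iterS e; have [->|[-> H]] := next_newE i; first by left.
    by right; exists i.
  rewrite iterS e; right; have [->|[-> _]] := next_newE k; last by exists k => //; split=> //;
    apply: leqW.
  by exists k.+1 => //; split=> // j kj; apply: H; apply: ltnW.
by case=> [->//|[k -> [ki H]]]; rewrite !H.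
Qed.

Theorem radical_series_filtration i : remove_repetitions Fil i = radical_series V i.
Proof. by rewrite remove_repetitionsE radical_seriesE. Qed.
End RadicalSeries.

Section LocalRing.
Local Open Scope classical_set_scope.
Local Open Scope ring_scope.
Variables (R : idomainType) (l : nat).
Hypothesis R_local : local_with_maximal_ideal (principal_ideal (l%:R : R)).

(** A maximal submodule is proper. *)
Lemma one_notin_maximal (y : R) : 1 <> y *+ l.
Proof.
move=> e; have [S [_ ns] _] := (R_local (principal_ideal (l%:R : R))).2 erefl.
have H (x : R) : x * y * l%:R = x by rewrite -mulrA mulr_natr -e mulr1.
by apply: ns => x _; exists (x * y : R) => //; apply: H.
Qed.

(** A nonunit lies in a maximal ideal by Zorn's lemma, and lR is the only
one. *)
Lemma unit_criterion (x : R) : (forall y, x <> y *+ l) -> x \is a GRing.unit.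
Proof.
move=> nx; apply: contrapT => /negP nu.
(* Zorn's lemma is applied to unions with the ideal of x, so that the empty
   chain causes no exception. *)
pose P (J : set R^o) := submodule (J `|` principal_ideal x) /\ ~ (J `|` principal_ideal x) 1.
have Px1 : ~ principal_ideal x 1.
  move=> [r _ e]; case/negP: nu; apply/unitrPr; exists r; by rewrite mulrC.
have SPx : submodule (principal_ideal x : set R^o).
  split; first by exists 0; rewrite ?mul0r.
  move=> a _ _ [r _ <-] [s _ <-]; exists (a * r + s) => //.
  have H (a' r' s' : R) : (a' * r' + s') * x = a' * (r' * x) + s' * x by rewrite mulrDl mulrA.
  exact: H.
have [|J [[SJ J1] Jmax]] := @Zorn_bigcup R P.
  move=> FF FP chain; split; last first.
    by case=> [[Y FY Y1]|//]; have [_] := FP _ FY; apply; left.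
  split; first by right; case: SPx.
  have one (Y : set R) (a u w : R) : FF Y \/ Y = set0 ->
     (Y `|` principal_ideal x) u -> (Y `|` principal_ideal x) w ->
     (\bigcup_(Z in FF) Z `|` principal_ideal x) (a * u + w).
    move=> [FY|->] Yu Yw; last by right; move: Yu Yw; rewrite set0U => Yu Yw; case: SPx => _; apply.
    have [[_ H] _] := FP Y FY.
    by case: (H a u w Yu Yw) => h; [left; exists Y | right].
  move=> a u w [[Y FY Yu]|Pu] [[Z FZ Zw]|Pw].
  - have [YZ|ZY] := chain Y Z FY FZ.
      by apply: (one Z); [left | left; apply: YZ | left].
    by apply: (one Y); [left | left | left; apply: ZY].
  - by apply: (one Y); [left|left|right].
  - by apply: (one Z); [left|right|left].
  - by apply: (one set0); [right|right|right].
(* The union is a maximal ideal, hence lR. *)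
have Jx : J `|` principal_ideal x = principal_ideal (l%:R : R).
  apply/R_local; split=> // [|M SM JM _].
    by split=> // H; apply: J1; apply: H.
  have [M1|nM1] := pselect (M 1).
    right; apply/seteqP; split=> // y _; rewrite -[y]mulr1; exact: (submodZ y SM M1).
  left; apply: contrapT => ne; apply: (Jmax M).
    split; first by apply: subset_trans JM; apply: subsetUl.
    move=> MJ; apply: ne; apply/seteqP; split=> // y My; left; exact: MJ.
  have MP : M `|` principal_ideal x = M.
    by apply/setUidPl; apply: subset_trans JM; apply: subsetUr.
  by split; rewrite MP.
have : (J `|` principal_ideal x) x by right; exists 1; rewrite ?mul1r.
by rewrite Jx => -[r _ e]; apply: (nx r); rewrite -e mulr_natr.
Qed.
End LocalRing.

Section AdditiveCharacter.
Variables (R : idomainType) (F : finFieldType) (p : nat).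
Hypotheses (p_char : p \in [pchar F]) (R_root : exists z : R, p.-primitive_root z).

(** A coordinate of F over its prime field, followed by powers of a root of
unity of order p. *)
Lemma additive_character : exists psi : F -> R,
  [/\ forall a b, psi (a + b) = psi a * psi b, psi 0 = 1 & exists a, psi a != 1].
Proof.
have [z zp] := R_root; have p_pr := pcharf_prime p_char.
pose L := pPrimeCharType p_char.
pose bs := vbasis (fullv : {vspace L}).
have d0 : (0 < \dim (fullv : {vspace L}))%N.
  rewrite lt0n dimv_eq0; apply/negP => /eqP e.
  have : (1 : L) \in (fullv : {vspace L}) by apply: memvf.
  by rewrite e memv0 oner_eq0.
pose i := Ordinal d0; pose phi (a : F) : 'F_p := coord bs i (a : L).
have phiD a b : phi (a + b) = phi a + phi b by exact: (raddfD (coord bs i)).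
have zE (x y : 'F_p) : z ^+ (x + y)%R = z ^+ x * z ^+ y.
  rewrite -exprD; apply/eqP; rewrite (eq_prim_root_expr zp) /=.
  by move: (x + y)%N => m; rewrite (Fp_cast p_pr) modn_mod.
exists (fun a => z ^+ phi a); split=> [a b||].
- by rewrite phiD zE.
- by have -> : phi 0 = 0 by exact: (raddf0 (coord bs i)).
exists bs`_i; have -> : phi bs`_i = 1.
  by rewrite /phi coord_free ?eqxx //; apply: (basis_free (vbasisP _)).
rewrite -[1 in X in _ != X](expr0 z).
rewrite (eq_prim_root_expr zp); have p1 := prime_gt1 p_pr.
by rewrite /= mod0n modn_small; rewrite ?(Fp_cast p_pr) ?modn_small.
Qed.
End AdditiveCharacter.

(** * The reduction of the Steinberg lattice *)

(** The form and the filtrations, for any generator [e0] and any scale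
[b] of the form. *)
Section ScaledForm.
Local Open Scope classical_set_scope.
Local Open Scope ring_scope.
Local Open Scope quotient_scope.
Variables (R : idomainType) (gT : finGroupType) (b l : nat) (e0 : galg R gT).
Local Notation I := (left_ideal e0).
Local Notation L := (reduction I l).

Definition scaled_form (x y : I) : {fraction R} :=
  (@FracField.tofrac R
    (\sum_(g : gT) (val x : galg R gT) g * (val y : galg R gT) g)) / b%:R.

Definition scaled_filt (c : nat) : set I :=
  [set x | forall y, exists r : R,
     scaled_form x y = @FracField.tofrac R (l%:R ^+ c * r)].

Definition reduced_filt (c : nat) : set L :=
  \pi_L @` [set x + y *+ l | x in scaled_filt c & y in setT].
End ScaledForm.

Section Lattice.
Local Open Scope classical_set_scope.
Local Open Scope ring_scope.
Local Open Scope quotient_scope.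
Variables (R : idomainType) (F : finFieldType) (N : nat) (G : linear_group F N).
Local Notation A := (galg R G).
Local Notation U := (pat G (@ltI N)).
Local Notation B := (borelG G).
Local Notation eps := (steinberg_gen R G).
Local Notation scal := (scal G).

Variable psi : F -> R.
Hypotheses (psiD : forall a b, psi (a + b) = psi a * psi b)
  (psi0 : psi 0 = 1) (psi_nontriv : exists a, psi a != 1).
Local Notation st := (whit_eps G psi).
Local Notation E := (whit G psi (@ltI N)).

Variable l : nat.
Hypotheses (l_prime : prime l) (char0 : [pchar R] =i pred0)
  (unitP : forall x : R, (forall y, x <> y *+ l) -> x \is a GRing.unit)
  (lnon : forall y : R, 1 <> y *+ l).
Hypothesis q_coprime : coprime l #|F|.
Variable e : nat.
Hypotheses (e_ge2 : (2 <= e)%N) (l_dvd : (l %| qint #|F| e)%N)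
  (e_min : forall i, (2 <= i)%N -> (l %| qint #|F| i)%N -> (e <= i)%N)
  (logn_qe : logn l (qint #|F| e) = 1%N).

Local Notation I := (left_ideal eps).
Local Notation L := (reduction I l).
Local Notation lattice_filt := (@scaled_filt R G #|B| l eps).
Local Notation mod_filt := (@reduced_filt R G #|B| l eps).

Lemma ideal_mem (a : A) : (a * eps : A^o) \in in_left_ideal eps.
Proof. by apply/in_left_idealP; exists a. Qed.

(** Every element of the lattice is of this form, so computations may be
carried out in the group algebra. *)
Definition mk (a : A) : I := exist _ (a * eps : A^o) (ideal_mem a).

Lemma mk_surj (x : I) : exists a, x = mk a.
Proof. by case: x => x xI; have /in_left_idealP[a e'] := xI; exists a; apply: val_inj. Qed.

Lemma mkZ a b : a *: mk b = mk (a * b).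
Proof. by apply: val_inj; rewrite /= -mulrA. Qed.

Lemma mkD a b : mk a + mk b = mk (a + b).
Proof. by apply: val_inj; rewrite /= mulrDl. Qed.

Lemma mkMn a m : mk a *+ m = mk (a *+ m).
Proof. by elim: m => [|m IHm]; [apply: val_inj; rewrite /= mul0r | rewrite !mulrS IHm mkD]. Qed.

Lemma piZ (a : A) (x : I) : \pi_L (a *: x) = galg_red l a *: \pi_L x.
Proof. exact: reduction_scale_pi. Qed.

Lemma liftZ a (x : I) : a *: \pi_L x = \pi_L (galg_lift a *: x).
Proof. by rewrite piZ galg_redK. Qed.

Lemma pi0 : \pi_L (0 : I) = 0.
Proof.
have h := @reduction_piD R G I l 0 0; rewrite addr0 in h.
apply: (addrI (\pi_L (0 : I))).
by rewrite -h addr0.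
Qed.

Lemma piD (x y : I) : \pi_L (x + y) = \pi_L x + \pi_L y.
Proof. exact: (@reduction_piD R G I l x y). Qed.

Lemma pi_eqP (x y : I) : \pi_L x = \pi_L y <-> exists z, x - y = z *+ l.
Proof.
split=> [h|h]; first by apply/(@reduction_eqP R G I l)/eqP.
by apply/eqP; apply/(@reduction_eqP R G I l).
Qed.

Lemma pi_addmul (x y : I) : \pi_L (x + y *+ l) = \pi_L x.
Proof. by apply/pi_eqP; exists y; rewrite addrAC subrr add0r. Qed.

(** As R has characteristic 0, the denominator |B| can be cleared. *)
Lemma filtP c a : lattice_filt c (mk a) <-> in_filt l c (a * eps).
Proof.
have B0 : (#|B|%:R : {fraction R}) != 0.
  by rewrite -(rmorph_nat (@FracField.tofrac R)) tofrac_eq0 B_neq0.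
have key (x r : R) : @FracField.tofrac R x / #|B|%:R = @FracField.tofrac R r <-> x = #|B|%:R * r.
  split=> [h|->].
    by apply/eqP; rewrite -tofrac_eq tofracM rmorph_nat -h mulrCA divff ?mulr1.
  by rewrite tofracM rmorph_nat mulrC mulKf.
split=> H.
  by move=> b; have [r h] := H (mk b); exists r; apply/key.
by move=> y; have [b ->] := mk_surj y; have [r h] := H b; exists r; apply/key.
Qed.

Lemma mod_filtP c z : mod_filt c z <-> exists2 a, in_filt l c (a * eps) & z = \pi_L (mk a).
Proof.
split=> [[_ [x Fx [y _ <-]] <-]|[a Fa ->]].
  have [a ea] := mk_surj x; exists a; first by apply/filtP; rewrite -ea.
  by rewrite pi_addmul ea.
exists (mk a + 0 *+ l); last by rewrite pi_addmul.
by exists (mk a); [exact/filtP | exists 0].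
Qed.

Lemma in_filtD k (x y : A) : in_filt l k x -> in_filt l k y -> in_filt l k (x + y).
Proof.
move=> Hx Hy b; have [r1 e1] := Hx b; have [r2 e2] := Hy b; exists (r1 + r2).
by rewrite formC formDr ![form (b * eps) _]formC e1 e2 -!mulrDr.
Qed.

Lemma mod_filt_submod k : submodule (mod_filt k).
Proof.
split.
  apply/mod_filtP; exists 0; last by rewrite -pi0; congr \pi_L; apply: val_inj; rewrite /= mul0r.
  by move=> b; exists 0; rewrite /form big1 ?mulr0 // => g _; rewrite mul0r ffunE mul0r.
move=> a u w /mod_filtP[a1 F1 ->] /mod_filtP[a2 F2 ->]; apply/mod_filtP.
exists (galg_lift a * a1 + a2); last by rewrite liftZ mkZ -piD mkD.
by rewrite mulrDl -mulrA; apply: in_filtD => //; apply: in_filt_mul.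
Qed.

Lemma pi_surj (z : L) : exists a, z = \pi_L (mk a).
Proof. by have [a e'] := mk_surj (repr z); exists a; rewrite -e' reprK. Qed.

(** The scaled form takes its values in R, by [form_eps]. *)
Lemma mod_filt0 : mod_filt 0 = setT.
Proof.
apply/seteqP; split=> // z _; apply/mod_filtP; have [a ->] := pi_surj z; exists a => //.
move=> b; exists (\sum_(s : 'S_N.+1) (-1) ^+ s * (star b * a * eps) (permG G s)).
by rewrite formC form_star formC [star b * (a * _)]mulrA form_eps expr0 mul1r.
Qed.

Lemma mod_filt_le k : mod_filt k.+1 `<=` mod_filt k.
Proof.
move=> z /mod_filtP[a Fa ->]; apply/mod_filtP; exists a => // b.
by have [r ->] := Fa b; exists (l%:R * r); rewrite exprSr -mulrA.
Qed.

(** The indicator of the simple roots inside the blocks of a composition. *)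
Definition block_char (m : seq nat) (j : nat) : F := (joined (block_index m) j)%:R.

Definition whit_vec (m : seq nat) : L := \pi_L (mk (E (block_char m))).

Definition whit_val (m : seq nat) : nat := logn l (decreasing_sum #|F| N.+1 (block_index m)).

Lemma chi_ext (c c' : nat -> F) (g : G) : (forall j, (0 < j < N.+1)%N -> c j = c' j) ->
  chi c g = chi c' g.
Proof.
move=> cc; apply: eq_bigr => i _; apply: eq_bigr => j /eqP ji.
by rewrite cc // ltn_ord ji.
Qed.

Lemma q_gt1 : (1 < #|F|)%N.
Proof. exact: card_finRing_gt1. Qed.

Lemma decreasing_sum_gt0 m : (0 < decreasing_sum #|F| N.+1 (block_index m))%N.
Proof.
have := @decreasing_sum_fact #|F| N.+1 _ (@block_index_homo m).
have : (0 < qfact #|F| N.+1)%N by apply: prodn_gt0 => i; apply: qint_gt0.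
by move=> + e'; rewrite -e' muln_gt0 => /andP[].
Qed.

Lemma form_whit m : form (st (block_char m)) eps =
  #|B|%:R * (decreasing_sum #|F| N.+1 (block_index m))%:R.
Proof.
apply: form_st_eps => // [|j _]; first exact: block_index_homo.
by rewrite /block_char; case: joined; rewrite ?oner_eq0 ?eqxx.
Qed.

Local Notation g := (carry_sum l e N.+1).

(** Take valuations in [decreasing_sum_fact]. *)
Lemma whit_valE m : sumn m = N.+1 -> (whit_val m + parts_sum l e N.+1 m)%N = g N.+1.
Proof.
move=> sm; rewrite -(logn_qfact l_prime q_gt1 e_ge2 l_dvd e_min logn_qe (leqnn _)).
rewrite -(decreasing_sum_fact _ _ (@block_index_homo m)) lognM ?decreasing_sum_gt0 //; last first.
  by apply: prodn_gt0 => i; apply: qint_gt0; rewrite /tail_size (bigD1 i) //= leqnn eqxx.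
congr (_ + _)%N.
have -> : block_fact #|F| N.+1 (block_index m) = (\prod_(a <- m) qfact #|F| a)%N.
  by rewrite -block_fact_index sm.
have : all (fun a => a <= N.+1)%N m.
  by rewrite -sm; elim: (m) => //= a m' IH; rewrite leq_addr; apply: sub_all IH => x; lia.
elim: (m) => [|a m' IH] /=; first by rewrite big_nil logn1.
move=> /andP[aN am]; rewrite big_cons lognM; last first.
- by elim: (m') => [|x y IHy]; rewrite ?big_nil // big_cons muln_gt0 IHy andbT;
  apply: prodn_gt0 => i; apply: qint_gt0.
- by apply: prodn_gt0 => i; apply: qint_gt0.
by rewrite parts_sum_cons IH // (logn_qfact l_prime q_gt1 e_ge2 l_dvd e_min logn_qe aN).
Qed.

Lemma pi_rel c c2 a : \pi_L (mk (E c)) = a *: \pi_L (mk (E c2)) ->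
  exists b : A, st c = galg_lift a * st c2 + (b * eps) *+ l.
Proof.
rewrite liftZ mkZ => /pi_eqP[z ez]; have [b eb] := mk_surj z; exists b.
have h : mk (E c) = mk (galg_lift a * E c2) + mk (b *+ l) by rewrite -mkMn -eb -ez addrC subrK.
by have := congr1 val h; rewrite /= mulrnAl -mulrA.
Qed.

Lemma whit_vec_symmetry m m2 : whit_val m = whit_val m2 ->
  (exists a, whit_vec m = a *: whit_vec m2) -> exists a, whit_vec m2 = a *: whit_vec m.
Proof.
move=> vv [a /pi_rel[b eb]].
have [a' ea] := whit_symmetry psiD psi0 l_prime char0 unitP lnon q_coprime
  (decreasing_sum_gt0 m) (decreasing_sum_gt0 m2) vv (form_whit m) (form_whit m2) eb.
exists (galg_red l a'); rewrite /whit_vec -piZ mkZ; congr \pi_L.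
by apply: val_inj; rewrite /= -mulrA.
Qed.

Lemma mod_filt_whit k m : mod_filt k (whit_vec m) <-> (k <= whit_val m)%N.
Proof.
rewrite -(in_filt_whit psiD psi0 l_prime char0 unitP lnon q_coprime k (decreasing_sum_gt0 m)
  (form_whit m)).
split=> [/mod_filtP[a Fa /pi_eqP[z ez]]|[a [b [Fa eb]]]].
  have [b eb] := mk_surj z; exists a, b; split=> //.
  have h : mk (E (block_char m)) = mk a + mk (b *+ l) by rewrite -mkMn -eb -ez addrC subrK.
  by have := congr1 val h; rewrite /= mulrnAl.
apply/mod_filtP; exists a => //; rewrite /whit_vec.
have -> : mk (E (block_char m)) = mk a + mk b *+ l; last exact: pi_addmul.
by rewrite mkMn; apply: val_inj; rewrite /= mulrnAl.
Qed.

Lemma whit_pi c a : exists r,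
  galg_red l (E c) *: \pi_L (mk a) = galg_red l (scal r) *: \pi_L (mk (E c)).
Proof.
have [r Er] := whit_line psiD c a; exists r; rewrite -!piZ !mkZ; congr \pi_L.
by apply: val_inj; rewrite /= -mulrA Er /whit_eps mulrA.
Qed.

Lemma red_mul_kill (r : R) (z : L) : galg_red l (scal (r *+ l)) *: z = 0.
Proof.
have [a ->] := pi_surj z; rewrite -piZ mkZ -pi0.
apply/pi_eqP; exists (mk (scal r * a)); rewrite subr0 mkMn; congr mk.
by rewrite scalMn mulrnAl.
Qed.

Lemma red_scalM (r s : R) : galg_red l (scal (r * s)) = galg_red l (scal r) * galg_red l (scal s).
Proof. by rewrite scalM galg_redM. Qed.

(** E c multiplies y1 and y2 into the line of the Whittaker vector.  If
neither multiplier is a unit, both products vanish modulo l, and so does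
|U| times the Whittaker vector. *)
Lemma whit_vec_prime (Ns Ms : set L) m y1 y2 : submodule Ns -> submodule Ms ->
  Ns y1 -> Ms y2 -> whit_vec m = y1 + y2 -> Ns (whit_vec m) \/ Ms (whit_vec m).
Proof.
move=> SN SM N1 M2 e12; set c := block_char m in e12 *.
have [a1 ea1] := pi_surj y1; have [a2 ea2] := pi_surj y2.
have [r1 er1] := whit_pi c a1; have [r2 er2] := whit_pi c a2.
have unit_in (S : set L) y (r : R) : submodule S -> S y -> r \is a GRing.unit ->
    galg_red l (E c) *: y = galg_red l (scal r) *: whit_vec m -> S (whit_vec m).
  move=> SS Sy ru ey.
  have -> : whit_vec m = galg_red l (scal r^-1) *: (galg_red l (E c) *: y).
    by rewrite ey scalerA -red_scalM mulVr // scal1 galg_red1 scale1r.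
  by do 2!apply: submodZ => //.
have [u1|n1] := boolP (r1 \is a GRing.unit).
  by left; apply: (unit_in Ns y1 r1) => //; rewrite ea1.
have [u2|n2] := boolP (r2 \is a GRing.unit).
  by right; apply: (unit_in Ms y2 r2) => //; rewrite ea2.
have mult (r : R) : r \isn't a GRing.unit -> exists s, r = s *+ l.
  move=> nr; apply: contrapT => h; case/negP: nr; apply: unitP => y ey.
  by apply: h; exists y.
have [s1 es1] := mult _ n1; have [s2 es2] := mult _ n2.
(* E c acts on the Whittaker vector as |U|. *)
have z0 : galg_red l (scal #|U|%:R) *: whit_vec m = 0.
  have -> : galg_red l (scal #|U|%:R) *: whit_vec m = galg_red l (E c) *: whit_vec m.
    rewrite /whit_vec -!piZ !mkZ; congr \pi_L; apply: val_inj; rewrite /= -!mulrA.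
    by rewrite -[E c * eps]/(st c) -(whit_eigen psiD psi0 (st_eigen psiD c)).
  by rewrite e12 scalerDr ea1 ea2 er1 er2 es1 es2 !red_mul_kill addr0.
left; have -> : whit_vec m = 0; last exact: submod0.
have Uu := U_unit G l_prime unitP lnon q_coprime.
by rewrite -[whit_vec m]scale1r -galg_red1 -scal1 -(mulVr Uu) red_scalM -scalerA z0 scaler0.
Qed.

(** [submodule_separation] gives an eigenvector in Ns outside Ms; it is a unit
multiple of a Whittaker vector, since multiples of l are 0 in the
reduction. *)
Lemma whit_vec_separates (Ns Ms : set L) : submodule Ns -> submodule Ms ->
  (forall m, sumn m = N.+1 -> Ns (whit_vec m) -> Ms (whit_vec m)) -> Ns `<=` Ms.
Proof.
move=> SN SM NM z Nz; apply: contrapT => nMz.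
pose lift_set (S : set L) (x : A) := exists2 y : I, val y = x & S (\pi_L y).
have lift_mul S a x : submodule S -> lift_set S x -> lift_set S (a * x).
  move=> SS [y <- Sy]; exists (a *: y) => //; rewrite piZ; exact: submodZ.
have lift0 S : submodule S -> lift_set S 0.
  by move=> SS; exists 0 => //; rewrite pi0; apply: submod0.
have liftD S x1 x2 : submodule S -> lift_set S x1 -> lift_set S x2 -> lift_set S (x1 + x2).
  move=> SS [w1 <- S1] [w2 <- S2]; exists (w1 + w2) => //; rewrite piD; exact: submodD.
have [a ea] := pi_surj z.
have Px : lift_set Ns (a * eps) by exists (mk a); rewrite // -ea.
have nQx : ~ lift_set Ms (a * eps).
  by move=> [y ey My]; apply: nMz; rewrite ea (_ : mk a = y) //; apply: val_inj.
have qu := q_unit l_prime unitP lnon q_coprime.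
have [J [x [[y ey Ny] nQ ex]]] := submodule_separation psiD psi0 psi_nontriv qu
  (fun a x => @lift_mul Ns a x SN) (fun a x => @lift_mul Ms a x SM) (lift0 Ms SM)
  (fun x1 x2 => @liftD Ms x1 x2 SM) Px nQx.
have [m sm mJ] := joined_exists J N.+1.
have {ex} ex : eigen psi (block_char m) x.
  move=> u Uu; rewrite ex //; congr (scal (psi _) * _); apply: chi_ext => j jN.
  by rewrite /block_char mJ.
have [a2 ea2] := mk_surj y; have xE : x = a2 * eps by rewrite -ey ea2.
have Uu := U_unit G l_prime unitP lnon q_coprime.
have [r er] : exists r, x = scal r * st (block_char m).
  by rewrite xE; apply: (eigen_whit_line psiD psi0 Uu); rewrite -xE.
have yE : y = mk (scal r * E (block_char m)).
  by apply: val_inj; rewrite ey er /= -mulrA.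
have piy : \pi_L y = galg_red l (scal r) *: whit_vec m by rewrite yE -mkZ piZ.
have [ru|nr] := boolP (r \is a GRing.unit).
  apply: nQ; exists y => //; rewrite piy; apply: submodZ => //; apply: NM => //.
  have -> : whit_vec m = galg_red l (scal r^-1) *: \pi_L y.
    by rewrite piy scalerA -red_scalM mulVr // scal1 galg_red1 scale1r.
  exact: submodZ.
have [s es] : exists s, r = s *+ l.
  apply: contrapT => h; case/negP: nr; apply: unitP => w ew; apply: h; by exists w.
by apply: nQ; exists y => //; rewrite piy es red_mul_kill; apply: submod0.
Qed.

(** Quantified over a prefix, so that the relation is stable under adding
parts in front. *)
Definition below (m m2 : seq nat) : Prop := forall x, (sumn x + sumn m)%N = N.+1 ->
  exists a, whit_vec (x ++ m) = a *: whit_vec (x ++ m2).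

Lemma whit_vec_ext m m2 :
  (forall j, (0 < j < N.+1)%N ->
     joined (block_index m) j = joined (block_index m2) j) ->
  whit_vec m = whit_vec m2.
Proof.
move=> mm; rewrite /whit_vec; congr (\pi_L (mk _)); apply: eq_bigr => u _.
by rewrite (@chi_ext _ (block_char m2)) // => j /mm; rewrite /block_char => ->.
Qed.

(** An empty part changes nothing; otherwise [merge_blocks] applies. *)
Lemma below_merge a b m : below (a :: b :: m) ((a + b)%N :: m).
Proof.
move=> x sx.
have J1 j : (j < sumn x)%N -> 
    joined (block_index (x ++ (a + b)%N :: m)) j =
    joined (block_index (x ++ a :: b :: m)) j.
  by move=> jx; rewrite !joined_cat jx.
have J2 j : (sumn x <= j)%N -> joined (block_index (x ++ (a + b)%N :: m)) j =
    if (j - sumn x < a + b)%N then (0 < j - sumn x)%N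
    else joined (block_index m) (j - sumn x - (a + b)).
  by move=> jx; rewrite joined_cat ltnNge jx joined_cons.
have J3 j : (sumn x <= j)%N -> joined (block_index (x ++ a :: b :: m)) j =
    if (j - sumn x < a)%N then (0 < j - sumn x)%N else
    if (j - sumn x - a < b)%N then (0 < j - sumn x - a)%N
    else joined (block_index m) (j - sumn x - a - b).
  by move=> jx; rewrite joined_cat ltnNge jx !joined_cons.
have J23 j : (sumn x <= j)%N -> a = 0%N \/ b = 0%N \/ j <> (sumn x + a)%N ->
    joined (block_index (x ++ a :: b :: m)) j =
    joined (block_index (x ++ (a + b)%N :: m)) j.
  move=> jx h; rewrite J2 // J3 //.
  case: (ltnP (j - sumn x) a) => h1; first by have -> : (j - sumn x < a + b)%N by lia.
  case: (ltnP (j - sumn x - a) b) => h2.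
    have -> : (j - sumn x < a + b)%N by lia.
    by lia.
  have -> : (j - sumn x < a + b)%N = false by lia.
  by rewrite subnDA.
have ext : a = 0%N \/ b = 0%N ->
    exists a0, whit_vec (x ++ a :: b :: m) = a0 *: whit_vec (x ++ (a + b)%N :: m).
  move=> h; exists 1; rewrite scale1r; apply: whit_vec_ext => j _.
  have [jx|jx] := ltnP j (sumn x); first by rewrite J1.
  by apply: J23 => //; case: h; auto.
have [a0|a0] := posnP a; first by apply: ext; left.
have [b0|b0] := posnP b; first by apply: ext; right.
have qu := q_unit l_prime unitP lnon q_coprime.
have [||||||y ey] := @merge_blocks R F N G psi psiD psi0 qu (sumn x) a b a0 b0 _
  (block_char (x ++ a :: b :: m)) (block_char (x ++ (a + b)%N :: m)).
- by move: sx => /=; lia.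
- move=> j jx; rewrite /block_char J2; last by lia.
  rewrite ifT; last by lia.
  by have -> : (0 < j - sumn x)%N by lia.
- move=> j _ ja; rewrite /block_char; have [jx|jx] := ltnP j (sumn x); first by rewrite J1.
  by rewrite J23 //; right; right; apply/eqP.
- rewrite /block_char J3; last by lia.
  by rewrite addKn ltnn subnn b0.
- by move=> _; rewrite /block_char J2 // subnn; case: ltnP => // h; lia.
- by move=> _; rewrite /block_char J2 -?addnA ?leq_addr // addKn ltnn subnn.
exists (galg_red l y); rewrite /whit_vec -piZ mkZ; congr \pi_L.
by apply: val_inj; rewrite /= -mulrA.
Qed.

Lemma whit_vec_climb m : sumn m = N.+1 -> (0 < whit_val m)%N ->
  exists m2, [/\ sumn m2 = N.+1, whit_val m = (whit_val m2).+1
    & exists a, whit_vec m = a *: whit_vec m2].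
Proof.
move=> sm vm; have vE := whit_valE sm.
have [|||||||m2 [s2 b2 p2]] := @climb l e N.+1 l_prime e_ge2 below _ _ _ _ _ m.
- by move=> m' x _; exists 1; rewrite scale1r.
- move=> m1 m2 m3 s12 s23 b12 b23 x sx; have [a1 ->] := b12 x sx.
  have [|a2 ->] := b23 x; first by rewrite -s12.
  by exists (a1 * a2); rewrite scalerA.
- move=> a m1 m2 s12 b12 x sx; rewrite -!cat_rcons; apply: b12.
  by rewrite sumn_rcons -addnA.
- exact: below_merge.
- move=> a b m' gab x sx; apply: whit_vec_symmetry; last by apply: below_merge; move: sx => /=; lia.
  have E1 : sumn (x ++ a :: b :: m') = N.+1 by rewrite sumn_cat; move: sx => /=; lia.
  have E2 : sumn (x ++ (a + b)%N :: m') = N.+1 by rewrite sumn_cat.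
  have := whit_valE E1; have := whit_valE E2.
  by rewrite /parts_sum !map_cat !sumn_cat /= gab; lia.
- by rewrite sm.
- by rewrite sm; lia.
exists m2; rewrite s2 sm; split=> //; last by have := b2 [::]; apply; rewrite add0n.
by have := whit_valE (etrans s2 sm); lia.
Qed.

(** Stated for any [e0] equal to the generator, so that it applies to the
concrete description of the latter as it stands. *)
Theorem lattice_radical_series e0 : e0 = eps -> forall i,
  remove_repetitions (@reduced_filt R G #|B| l e0) i =
  radical_series (reduction (left_ideal e0) l) i.
Proof.
move=> -> i.
pose X := {m : seq nat | sumn m = N.+1}.
apply: (@radical_series_filtration _ L X (fun m => whit_vec (sval m)) (fun m => whit_val (sval m))).
- exact: mod_filt_submod.
- exact: mod_filt0.
- exact: mod_filt_le.
- by move=> k m; apply: mod_filt_whit.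
- by move=> Ns Ms SN SM NM; apply: whit_vec_separates => // m sm; apply: (NM (exist _ m sm)).
- by move=> Ns Ms m y1 y2; apply: whit_vec_prime.
- by move=> m m2; apply: whit_vec_symmetry.
- move=> [m sm] /= vm; have [m2 [s2 v2 b2]] := whit_vec_climb sm vm.
  by exists (exist _ m2 s2).
Qed.
End Lattice.

(** * The concrete general linear group *)

Section GLn.
Variables (F : finFieldType) (n : nat).

Definition GL_of (M : 'M[F]_n.-1.+1) : {'GL_n[F]} :=
  oapp id (1%g : {'GL_n[F]}) (insub M).

Lemma GL_ofK M : M \in unitmx -> GLval (GL_of M) = M.
Proof. by move=> Mu; rewrite /GL_of insubT. Qed.

Definition GLn : linear_group F n.-1 :=
  @LinearGroup F n.-1 {'GL_n[F]} (@GLval n F) GL_of (@GL_MxE n F)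
    (@GL_1E n F) val_inj (@GL_unitmx n F) GL_ofK.

Lemma permG_GLn s : permG GLn s = perm_GL F s.
Proof. by apply: val_inj; rewrite /= GL_ofK ?unitmx_perm. Qed.

Lemma steinberg_elt_gen (R : idomainType) :
  steinberg_elt F n R = steinberg_gen R GLn.
Proof.
rewrite /steinberg_elt /steinberg_gen.
by under [RHS]eq_bigr => s _ do rewrite permG_GLn.
Qed.
End GLn.

Theorem theorem6p7 (F : finFieldType) (n p l : nat) (R : idomainType)
    (n_ge2 : (2 <= n)%N)
    (p_char : p \in [pchar F])
    (l_prime : prime l)
    (l_neq_p : l <> p)
    (R_char0 : [pchar R] =i pred0)
    (R_pid : principal_ideal_domain R)
    (R_local : local_with_maximal_ideal (principal_ideal (l%:R : R)))
    (R_root : exists z : R, p.-primitive_root z)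
    (e : nat)
    (e_ge2 : (2 <= e)%N)
    (l_dvd : (l %| (#|F| ^ e - 1) %/ (#|F| - 1))%N)
    (e_min : forall i : nat, (2 <= i)%N ->
       (l %| (#|F| ^ i - 1) %/ (#|F| - 1))%N -> (e <= i)%N)
    (d : nat)
    (d_def : d = logn l ((#|F| ^ e - 1) %/ (#|F| - 1)))
    (d1 : d = 1%N) :
  forall i : nat,
    remove_repetitions (@mod_filtration F n R l) i =
    radical_series (steinberg_mod F n R l) i.
Proof.
have q1 : (1 < #|F|)%N by exact: card_finRing_gt1.
have [psi [psiD psi0 psi_nt]] := additive_character p_char R_root.
have l_coprime : coprime l #|F|.
  have -> := card_pprimeChar p_char.
  rewrite coprimeXr // prime_coprime // dvdn_prime2 //.
    by apply/eqP.
  exact: pcharf_prime p_char.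
move=> i; rewrite qintE // in l_dvd d_def.
have e_min' j : (2 <= j)%N -> (l %| qint #|F| j)%N -> (e <= j)%N.
  by move=> j2 lj; apply: e_min => //; rewrite qintE.
have main := @lattice_radical_series R F n.-1 (GLn F n) psi psiD psi0 psi_nt
  l l_prime R_char0 (unit_criterion R_local) (one_notin_maximal R_local)
  l_coprime e e_ge2 l_dvd e_min' (etrans (esym d_def) d1)
  (steinberg_elt F n R) (steinberg_elt_gen F n R).
exact: main.
Qed.
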